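(* Let $\pi:E\to D$ be an ample holomorphic line bundle over a compact complex manifold $D$ of dimension $n-1\ge1$, and let $h$ be a Hermitian metric on $E$ whose curvature form is a Kähler form $\omega_D$ on $D$. Let $E'$ be the complement of the zero section, let $\omega_0=\sqrt{-1}\partial\overline\partial|S|^{-2}_{\pi^*h}$ on $E'$, and let $V=z\partial_z+\bar z\partial_{\bar z}$ (see the context). Put $\omega=\omega_0-\mathrm{Ric}(\omega_0)+\sqrt{-1}\partial\overline\partial u$. There is a unique asymptotic expansion $$u\sim\sum_{k>0}u_{(k)},\qquad\mathcal L_Vu_{(k)}=k\,u_{(k)},$$ so that $\omega$ formally satisfies the expanding soliton equation $$\mathrm{Ric}(\omega)+\tfrac12\mathcal L_V\omega=-\omega.$$
   Context: The curvature form of $h$ is $-\sqrt{-1}\partial\overline\partial\log|s|_h^2$ for a local nonvanishing holomorphic section $s$. $S$ is the canonical section of $\pi^*E$ over $E$, $S(e)=e\in(\pi^*E)_e\cong E_{\pi(e)}$; in a local holomorphic trivialization with coordinates $w=(w^1,\dots,w^{n-1})$ on $D$ and fiber coordinate $z$, $|S|^2_{\pi^*h}=h(w)z\bar z$. The vector field $V=z\partial_z+\bar z\partial_{\bar z}$ is globally defined on $E'$ (generator of fiberwise rescaling). $\mathrm{Ric}(\omega)=-\sqrt{-1}\partial\overline\partial\log\det(g_{i\bar j})$ is the Ricci form. One has $\mathcal L_V\omega_0=-2\omega_0$ and $\mathcal L_V\mathrm{Ric}(\omega_0)=0$. The index $k$ runs over positive integers and the $u_{(k)}$ are smooth functions on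 $E'$. ''Formally satisfies'' means that the equation holds as an identity of formal series graded by $\mathcal L_V$-weight (weight component by weight component), where $\mathrm{Ric}(\omega)=\mathrm{Ric}(\omega_0)-\sqrt{-1}\partial\overline\partial\,\mathrm{Tr}\log\big(I-\omega_0^{-1}\mathrm{Ric}(\omega_0)+\sqrt{-1}\,\omega_0^{-1}\partial\overline\partial\sum_ku_{(k)}\big)$ is expanded in weights; $\omega_0^{-1}\mathrm{Ric}(\omega_0)$ has weight $2$ and $\omega_0^{-1}\partial\overline\partial u_{(k)}$ has weight $k+2$. *)

(* Defs.v *)
From HB Require Import structures.
From mathcomp Require Import all_boot all_order all_algebra.
From mathcomp Require Import all_classical all_reals all_analysis.
From mathcomp Require Import complex.
Set Implicit Arguments.
Unset Strict Implicit.
Unset Printing Implicit Defensive.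
Import Order.TTheory GRing.Theory Num.Theory.
Import numFieldNormedType.Exports.
Local Open Scope classical_set_scope.
Local Open Scope ring_scope.
Local Open Scope complex_scope.

(** * Calculus on open subsets of C^n *)

(* C^n as a real normed space: the pair (x, y) stands for x + i y. *)
Definition Cn (R : realType) (n : nat) : normedModType R :=
  ('rV[R]_n * 'rV[R]_n)%type.

Definition ccoord (R : realType) (n : nat) (p : Cn R n) (k : 'I_n) : R[i] :=
  p.1 0 k +i* p.2 0 k.

Fixpoint Ck (R : realType) (V : normedModType R) (k : nat) (U : set V)
    (f : V -> R) : Prop :=
  (forall x, U x -> {for x, continuous f}) /\
  match k with
  | 0%N => True
  | k'.+1 => forall v : V,
      (forall x, U x -> derivable f x v) /\ Ck k' U (fun x => 'D_v f x)
  end.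

(* C^oo on U; meant for open U. *)
Definition smooth (R : realType) (V : normedModType R) (U : set V)
    (f : V -> R) : Prop :=
  forall k, Ck k U f.

Definition csmooth (R : realType) (V : normedModType R) (U : set V)
    (F : V -> R[i]) : Prop :=
  smooth U (fun x => complex.Re (F x)) /\ smooth U (fun x => complex.Im (F x)).

(* Real directional derivative of a complex-valued function. *)
Definition cderive (R : realType) (V : normedModType R) (F : V -> R[i])
    (v : V) (x : V) : R[i] :=
  'D_v (fun y => complex.Re (F y)) x +i* 'D_v (fun y => complex.Im (F y)) x.

Definition dirRe (R : realType) (n : nat) (k : 'I_n) : Cn R n :=
  (delta_mx 0 k, 0).
Definition dirIm (R : realType) (n : nat) (k : 'I_n) : Cn R n :=
  (0, delta_mx 0 k).

(* d/dz^k = (d/dx^k - i d/dy^k)/2 and d/dzbar^k = (d/dx^k + i d/dy^k)/2 *)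
Definition del (R : realType) (n : nat) (k : 'I_n) (F : Cn R n -> R[i])
    (p : Cn R n) : R[i] :=
  2^-1 * (cderive F (dirRe R k) p - 'i * cderive F (dirIm R k) p).
Definition delbar (R : realType) (n : nat) (k : 'I_n) (F : Cn R n -> R[i])
    (p : Cn R n) : R[i] :=
  2^-1 * (cderive F (dirRe R k) p + 'i * cderive F (dirIm R k) p).

Definition holomorphic (R : realType) (n : nat) (U : set (Cn R n))
    (F : Cn R n -> R[i]) : Prop :=
  csmooth U F /\ forall p, U p -> forall k, delbar k F p = 0.

(** * (1,1)-forms in coordinates *)

(* The (1,1)-form  i G_{a bbar} dz^a /\ dzbar^b  is represented by its
   coefficient matrix G; thus [ddbar F] represents  i del delbar F. *)
Definition ddbar (R : realType) (n : nat) (F : Cn R n -> R[i])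
    (p : Cn R n) : 'M[R[i]]_n :=
  \matrix_(a, b) del a (delbar b F) p.

Definition ddbarR (R : realType) (n : nat) (f : Cn R n -> R) :
    Cn R n -> 'M[R[i]]_n :=
  ddbar (fun p => (f p)%:C).

(* Ric = - i del delbar log det g; det g is real for a Hermitian g. *)
Definition ric (R : realType) (n : nat) (G : Cn R n -> 'M[R[i]]_n) :
    Cn R n -> 'M[R[i]]_n :=
  fun p => - ddbarR (fun q => ln (complex.Re (\det (G q)))) p.

(* Smooth, Hermitian, positive definite and d-closed. *)
Definition kahler_on (R : realType) (n : nat) (U : set (Cn R n))
    (G : Cn R n -> 'M[R[i]]_n) : Prop :=
  [/\ forall a b, csmooth U (fun p => G p a b),
      forall p, U p -> forall a b, G p b a = conjc (G p a b),
      forall p, U p -> forall v : 'rV[R[i]]_n, v != 0 ->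
        0 < \sum_a \sum_b G p a b * v 0 a * conjc (v 0 b),
      forall p, U p -> forall a b c,
        del c (fun q => G q a b) p = del a (fun q => G q c b) p
    & forall p, U p -> forall a b c,
        delbar c (fun q => G q a b) p = delbar b (fun q => G q a c) p].

(* Lie derivatives along the real vector field X + Xbar, where X is the
   holomorphic field sum_k X^k d/dz^k. *)
Definition lieF (R : realType) (n : nat) (X : Cn R n -> 'rV[R[i]]_n)
    (F : Cn R n -> R[i]) (p : Cn R n) : R[i] :=
  \sum_k (X p 0 k * del k F p + conjc (X p 0 k) * delbar k F p).

(* Uses L dz^k = dX^k = sum_a (dX^k/dz^a) dz^a. *)
Definition lie11 (R : realType) (n : nat) (X : Cn R n -> 'rV[R[i]]_n)
    (G : Cn R n -> 'M[R[i]]_n) (p : Cn R n) : 'M[R[i]]_n :=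
  \matrix_(a, b)
    (lieF X (fun q => G q a b) p
     + \sum_k del a (fun q => X q 0 k) p * G p k b
     + \sum_k conjc (del b (fun q => X q 0 k) p) * G p a k).

(** * Complex manifolds and holomorphic line bundles *)

Record complexManifold (R : realType) (d : nat) := ComplexManifold {
  cm_space :> topologicalType;
  cm_idx : Type;
  cm_dom : cm_idx -> set cm_space;
  cm_chart : cm_idx -> cm_space -> Cn R d;
  cm_inv : cm_idx -> Cn R d -> cm_space;
  cm_hausdorff : hausdorff_space cm_space;
  cm_second_countable : @second_countable cm_space;
  cm_dom_open : forall i, open (cm_dom i);
  cm_cover : forall x, exists i, cm_dom i x;
  cm_chart_open : forall i, open (cm_chart i @` cm_dom i);
  cm_chartK : forall i x, cm_dom i x -> cm_inv i (cm_chart i x) = x;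
  cm_chart_cont : forall i x, cm_dom i x -> {for x, continuous (cm_chart i)};
  cm_inv_cont : forall i p, (cm_chart i @` cm_dom i) p ->
    {for p, continuous (cm_inv i)};
  cm_trans_holo : forall i j k,
    holomorphic (cm_chart i @` (cm_dom i `&` cm_dom j))
      (fun p => ccoord (cm_chart j (cm_inv i p)) k)
}.

Definition holomorphic_on (R : realType) (d : nat) (D : complexManifold R d)
    (W : set D) (f : D -> R[i]) : Prop :=
  forall i, holomorphic (cm_chart i @` (cm_dom i `&` W))
    (fun p => f (cm_inv i p)).

(* The total space carries local trivializations
     e |-> (lb_proj e, lb_fib j e),  lb_proj^-1 (lb_dom j) -> lb_dom j x C,
   with inverses [lb_inv j], and transition functions [lb_trans j k] (which are
   nowhere zero by bijectivity).  Its vector space, topological and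
   holomorphic structures are the ones transported by these. *)
Record lineBundle (R : realType) (d : nat) (D : complexManifold R d) :=
    LineBundle {
  lb_total :> Type;
  lb_proj : lb_total -> D;
  lb_idx : Type;
  lb_dom : lb_idx -> set D;
  lb_fib : lb_idx -> lb_total -> R[i];
  lb_inv : lb_idx -> D -> R[i] -> lb_total;
  lb_trans : lb_idx -> lb_idx -> D -> R[i];
  lb_dom_open : forall j, open (lb_dom j);
  lb_cover : forall x, exists j, lb_dom j x;
  lb_fibK : forall j e, lb_dom j (lb_proj e) ->
    lb_inv j (lb_proj e) (lb_fib j e) = e;
  lb_proj_inv : forall j x z, lb_dom j x -> lb_proj (lb_inv j x z) = x;
  lb_fib_inv : forall j x z, lb_dom j x -> lb_fib j (lb_inv j x z) = z;
  lb_trans_holo : forall j k,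
    holomorphic_on (lb_dom j `&` lb_dom k) (lb_trans j k);
  lb_transE : forall j k e,
    lb_dom j (lb_proj e) -> lb_dom k (lb_proj e) ->
    lb_fib k e = lb_trans j k (lb_proj e) * lb_fib j e
}.

Definition lb_frame (R : realType) (d : nat) (D : complexManifold R d)
    (E : lineBundle D) (j : lb_idx E) (x : D) : E :=
  lb_inv j x 1.

(* Image in C^d of the part of the i-th chart of D over which the j-th
   trivialization is defined. *)
Definition base_dom (R : realType) (d : nat) (D : complexManifold R d)
    (E : lineBundle D) (i : cm_idx D) (j : lb_idx E) : set (Cn R d) :=
  cm_chart i @` (cm_dom i `&` lb_dom j).

(* Global holomorphic sections of the m-th tensor power of E, given by their
   components in the local frames. *)
Definition power_section (R : realType) (d : nat) (D : complexManifold R d)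
    (E : lineBundle D) (m : nat) (s : lb_idx E -> D -> R[i]) : Prop :=
  (forall j, holomorphic_on (lb_dom j) (s j)) /\
  (forall j k x, lb_dom j x -> lb_dom k x ->
     s k x = lb_trans j k x ^+ m * s j x).

(* Some positive power of E has sections s_0, ..., s_N without common zero such
   that [s_0 : ... : s_N] : D -> P^N is injective with injective differential
   (v is in the kernel of the differential of [s] iff ds(v) is proportional
   to s). *)
Definition ample (R : realType) (d : nat) (D : complexManifold R d)
    (E : lineBundle D) : Prop :=
  exists (m N : nat) (s : 'I_N.+1 -> lb_idx E -> D -> R[i]),
  (0 < m)%N /\
  [/\ forall a, power_section m (s a),
      forall j x, lb_dom j x -> exists a, s a j x != 0,
      forall j k x y (c : R[i]), lb_dom j x -> lb_dom k y ->
        (forall a, s a j x = c * s a k y) -> x = y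
    & forall (i : cm_idx D) (j : lb_idx E) p, base_dom i j p ->
        forall (v : 'rV[R[i]]_d) (c : R[i]),
        (forall a, \sum_b v 0 b * del b (fun q => s a j (cm_inv i q)) p
                   = c * s a j (cm_inv i p)) ->
        v = 0].

(* A Hermitian metric is given by its squared norm e |-> |e|_h^2. *)
Record hermitianMetric (R : realType) (d : nat) (D : complexManifold R d)
    (E : lineBundle D) := HermitianMetric {
  hm_sq :> E -> R;
  hm_sqE : forall j e, lb_dom j (lb_proj e) ->
    hm_sq e = hm_sq (lb_frame j (lb_proj e)) *
              (complex.Re (lb_fib j e) ^+ 2 + complex.Im (lb_fib j e) ^+ 2);
  hm_pos : forall (j : lb_idx E) x, lb_dom j x -> 0 < hm_sq (lb_frame j x);
  hm_smooth : forall (i : cm_idx D) (j : lb_idx E),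
    smooth (base_dom i j) (fun p => hm_sq (lb_frame j (cm_inv i p)))
}.

Definition curvature (R : realType) (d : nat) (D : complexManifold R d)
    (E : lineBundle D) (h : hermitianMetric E) (i : cm_idx D) (j : lb_idx E) :
    Cn R d -> 'M[R[i]]_d :=
  fun p => - ddbarR (fun q => ln (h (lb_frame j (cm_inv i q)))) p.

Definition kahler_curvature (R : realType) (d : nat) (D : complexManifold R d)
    (E : lineBundle D) (h : hermitianMetric E) : Prop :=
  forall i j, kahler_on (base_dom i j) (curvature h i j).

(** * The complement E' of the zero section *)

Definition off_zero (R : realType) (d : nat) (D : complexManifold R d)
    (E : lineBundle D) : set E :=
  [set e | forall j, lb_dom j (lb_proj e) -> lb_fib j e != 0].

(* Coordinates (w, z) in C^d x C = C^(d + 1); the last one is the fiber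
   coordinate z. *)
Definition wpart (R : realType) (d : nat) (p : Cn R (d + 1)) : Cn R d :=
  (lsubmx p.1, lsubmx p.2).
Definition zpart (R : realType) (d : nat) (p : Cn R (d + 1)) : R[i] :=
  ccoord p (rshift d ord0).

Definition total_dom (R : realType) (d : nat) (D : complexManifold R d)
    (E : lineBundle D) (i : cm_idx D) (j : lb_idx E) : set (Cn R (d + 1)) :=
  [set p | base_dom i j (wpart p) /\ zpart p != 0].

(* The point of E' with coordinates p = (w, z). *)
Definition total_inv (R : realType) (d : nat) (D : complexManifold R d)
    (E : lineBundle D) (i : cm_idx D) (j : lb_idx E) (p : Cn R (d + 1)) : E :=
  lb_inv j (cm_inv i (wpart p)) (zpart p).

(* A function on E' is a function on E whose values on the zero section are
   ignored. *)
Definition smooth_off_zero (R : realType) (d : nat) (D : complexManifold R d)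
    (E : lineBundle D) (f : E -> R) : Prop :=
  forall (i : cm_idx D) (j : lb_idx E),
    smooth (total_dom i j) (fun p => f (total_inv i j p)).

(* The holomorphic part z d/dz of V = z d/dz + zbar d/dzbar. *)
Definition euler (R : realType) (d : nat) (p : Cn R (d + 1)) :
    'rV[R[i]]_(d + 1) :=
  row_mx 0 (zpart p)%:M.

Definition has_weight (R : realType) (d : nat) (D : complexManifold R d)
    (E : lineBundle D) (k : nat) (f : E -> R) : Prop :=
  forall (i : cm_idx D) (j : lb_idx E) p, total_dom i j p ->
    lieF (@euler R d) (fun q => (f (total_inv i j q))%:C) p
    = k%:R * (f (total_inv i j p))%:C.

(** * Formal series graded by weight *)

(* Weight m component of the p-th power of the formal series sum_m A_m. *)
Fixpoint series_pow (K : pzRingType) (n : nat) (A : nat -> 'M[K]_n)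
    (p m : nat) : 'M[K]_n :=
  match p with
  | 0%N => if m == 0%N then 1%:M else 0
  | p'.+1 => \sum_(l < m.+1) A l *m series_pow A p' (m - l)
  end.

(* Weight m component of Tr log (I + A) = sum_p (-1)^(p+1)/p Tr A^p; when
   A_0 = 0 the terms with p > m do not contribute to weight m. *)
Definition trlog_comp (K : fieldType) (n : nat) (A : nat -> 'M[K]_n)
    (m : nat) : K :=
  \sum_(1 <= p < m.+1) (-1) ^+ p.+1 / p%:R * \tr (series_pow A p m).

(* In the four definitions below, f0 and u k are the coordinate expressions of
   |S|^-2 and u_(k), the latter being used for k > 0 only. *)

(* Weight components of
     - omega_0^-1 Ric(omega_0) + i omega_0^-1 del delbar sum_k u_(k). *)
Definition pert_comp (R : realType) (n : nat) (f0 : Cn R n -> R)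
    (u : nat -> Cn R n -> R) (p : Cn R n) (m : nat) : 'M[R[i]]_n :=
  let g0 := ddbarR f0 in
  match m with
  | 0%N | 1%N => 0
  | 2%N => - (invmx (g0 p) *m ric g0 p)
  | k.+3 => invmx (g0 p) *m ddbarR (u k.+1) p
  end.

(* Weight components of omega = omega_0 - Ric(omega_0) + i del delbar u; note
   that Negz 1 = -2. *)
Definition omega_comp (R : realType) (n : nat) (f0 : Cn R n -> R)
    (u : nat -> Cn R n -> R) (m : int) : Cn R n -> 'M[R[i]]_n :=
  let g0 := ddbarR f0 in
  match m with
  | Negz 1 => g0
  | Negz _ => fun=> 0
  | Posz 0 => fun p => - ric g0 p
  | Posz k.+1 => ddbarR (u k.+1)
  end.

(* Weight components of
     Ric(omega) = Ric(omega_0) - i del delbar Tr log (I + pert). *)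
Definition ric_comp (R : realType) (n : nat) (f0 : Cn R n -> R)
    (u : nat -> Cn R n -> R) (m : int) : Cn R n -> 'M[R[i]]_n :=
  match m with
  | Negz _ => fun=> 0
  | Posz 0 => ric (ddbarR f0)
  | Posz k.+1 => fun p => - ddbar (fun q => trlog_comp (pert_comp f0 u q) k.+1) p
  end.

(* Ric(omega) + (1/2) L_{X + Xbar} omega = - omega, in each weight. *)
Definition formal_soliton_at (R : realType) (n : nat)
    (X : Cn R n -> 'rV[R[i]]_n) (f0 : Cn R n -> R) (u : nat -> Cn R n -> R)
    (p : Cn R n) : Prop :=
  forall m : int,
    ric_comp f0 u m p + 2^-1 *: lie11 X (omega_comp f0 u m) p
    = - omega_comp f0 u m p.

Definition formal_soliton (R : realType) (d : nat) (D : complexManifold R d)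
    (E : lineBundle D) (h : hermitianMetric E) (u : nat -> E -> R) : Prop :=
  forall (i : cm_idx D) (j : lb_idx E) p, total_dom i j p ->
    formal_soliton_at (@euler R d)
      (fun q => (h (total_inv i j q))^-1)
      (fun k q => u k (total_inv i j q)) p.

Definition soliton_expansion (R : realType) (d : nat)
    (D : complexManifold R d) (E : lineBundle D) (h : hermitianMetric E)
    (u : nat -> E -> R) : Prop :=
  [/\ forall k, (0 < k)%N -> smooth_off_zero (u k),
      forall k, (0 < k)%N -> has_weight k (u k)
    & formal_soliton h u].

(* Main.v *)
Require Import Defs.
From HB Require Import structures.
From mathcomp Require Import all_boot all_order all_algebra.
From mathcomp Require Import all_classical all_reals all_analysis.
From mathcomp Require Import complex ring lra spectral.
Set Implicit Arguments.
Unset Strict Implicit.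
Unset Printing Implicit Defensive.
Import Order.TTheory GRing.Theory Num.Theory.
Import numFieldNormedType.Exports.
Local Open Scope classical_set_scope.
Local Open Scope ring_scope.
Local Open Scope complex_scope.

(* Both sides of the equation are graded by weight.  Weights -2 and 0 hold
   identically; in weight k > 0 the equation reads
     i del delbar T_k = (1 + k/2) i del delbar u_(k),
   where T_k, the weight k part of Tr log, only involves u_(l) with l + 2 <= k.

   Existence: take u_(k) = 2/(k + 2) T_k recursively.  T_k is natural under
   holomorphic maps pulling omega_0 back to a multiple of itself.  For changes of
   charts this makes u_(k) globally defined, for fiberwise dilations it gives its
   weight.

   Uniqueness: the difference f of two solutions in the first weight k where they
   differ is pluriharmonic and homogeneous of degree k along the fibers.  Then
   f^2 |S|^-2k is invariant under dilations, so it attains its maximum since D is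
   compact.  Where f <> 0, the complex Hessian of its logarithm is
   -2 f^-2 del f delbar f + k pi^* omega_D, which is positive on the vectors in the
   kernel of del f that are not vertical.  These exist: as V f = k f <> 0, every
   base vector lifts to the kernel of del f. *)

(** * Directional derivatives and smooth functions *)

Section Lines.
Variables (R : realType) (V W : normedModType R).
Implicit Types (f : V -> W) (x v : V).

Lemma is_derive_lineP f x v (t : R) (d : W) :
  is_derive (x + t *: v) v f d <-> is_derive t 1 (fun s => f (x + s *: v)) d.
Proof.
have growth_rateE :
    (fun h : R => h^-1 *: ((f \o shift (x + t *: v)) (h *: v) - f (x + t *: v))) =
    (fun h : R => h^-1 *: (((fun s => f (x + s *: v)) \o shift t) (h *: 1) -
                           f (x + t *: v))).
  by apply/funext => h /=; rewrite [h *: 1]mulr1 scalerDl addrCA.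
by split=> -[df <-]; split; rewrite /derivable /derive growth_rateE in df *.
Qed.

Lemma is_derive_line0P f x v (d : W) :
  is_derive x v f d <-> is_derive (0 : R) 1 (fun s => f (x + s *: v)) d.
Proof. by rewrite -{1}[x]addr0 -(scale0r v); exact: is_derive_lineP. Qed.

End Lines.

Section CompositionDerivative.
Variables (R : realType) (V W X : normedModType R).

Lemma is_derive_comp_diff (f : W -> X) (phi : V -> W) x v (d : W) :
  differentiable f (phi x) -> is_derive x v phi d ->
  is_derive x v (f \o phi) ('D_d f (phi x)).
Proof.
move=> df /is_derive_line0P dline; apply/is_derive_line0P.
pose line (s : R) := phi (x + s *: v).
have line0 : line 0 = phi x by rewrite /line scale0r addr0.
have dline0 : differentiable line 0 by apply/derivable1_diffP; case: dline.
have df0 : differentiable f (line 0) by rewrite line0.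
split; first exact/derivable1_diffP/(differentiable_comp (f := line)).
rewrite (deriveE _ (differentiable_comp (f := line) dline0 df0)).
rewrite (diff_comp dline0 df0) /= line0 -deriveE//; congr ('D__ f _).
by rewrite -deriveE//; case: dline.
Qed.

End CompositionDerivative.

Section SecondDifference.
Variables (R : realType) (V : normedModType R).
Implicit Types (f : V -> R) (x u v : V).

Lemma derive_MVT f x v (h : R) :
  (forall t : R, 0 <= t <= 1 -> derivable f (x + (t * h) *: v) v) ->
  exists2 c : R, 0 <= c <= 1 &
    f (x + h *: v) - f x = h * 'D_v f (x + (c * h) *: v).
Proof.
move=> df.
have dline (t : R) : 0 <= t <= 1 -> is_derive t 1 (fun s => f (x + (s * h) *: v))
    ('D_v f (x + (t * h) *: v) * h).
  move=> /df/derivableP/is_derive_lineP dft.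
  have dmulr : is_derive t 1 ( *%R^~ h) h.
    rewrite [X in is_derive _ _ X](_ : _ = h \*: id); last first.
      by apply/funext => s; rewrite /= mulrC.
    by apply: is_derive_eq; rewrite [LHS]mulr1.
  exact: (is_derive1_comp (f := fun s => f (x + s *: v)) (g := *%R^~ h) dft dmulr).
have [|||c] := @MVT_segment R (fun s => f (x + (s * h) *: v))
    (fun s => 'D_v f (x + (s * h) *: v) * h) 0 1; first exact: ler01.
- by move=> t /itvP t01; apply: dline; rewrite !t01.
- apply: derivable_within_continuous => t /itvP t01.
  by have [] // := dline t; rewrite !t01.
move=> /itvP c01; rewrite mul1r mul0r scale0r addr0 subr0 mulr1 => ->.
by exists c; rewrite ?c01// mulrC.
Qed.

Lemma near_shift_le (P : V -> Prop) x (C : R) : (\near x, P x) ->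
  \forall s \near 0^'+, forall w, `|w| <= s * C -> P (x + w).
Proof.
move=> /nbhs_ballP[e /= e0 eP]; have C0 : 0 < `|C| + 1 by rewrite ltr_wpDl.
near=> s => w wC; apply: eP; rewrite -ball_normE /= distrC (addrC x) addrK.
have s0 : 0 < s by near: s; exact: nbhs_right_gt.
apply: (@le_lt_trans _ _ (s * (`|C| + 1))).
  by apply: le_trans wC _; rewrite ler_pM2l// ler_wpDr// ler_norm.
by rewrite -ltr_pdivlMr//; near: s; apply: nbhs_right_lt; exact: divr_gt0.
Unshelve. all: by end_near. Qed.

Lemma near_parallelogram (P : V -> Prop) x u v : (\near x, P x) ->
  \forall s \near 0^'+, forall a b : R, `|a| <= s -> `|b| <= s ->
    P (x + a *: u + b *: v).
Proof.
move=> /(near_shift_le (`|u| + `|v|)); apply: filterS => s sP a b a_s b_s.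
rewrite -addrA; apply: sP; apply: le_trans (ler_normD _ _) _.
by rewrite !normrZ mulrDr lerD// ler_wpM2r.
Qed.

Definition second_difference f x u v (s : R) :=
  f (x + s *: u + s *: v) - f (x + s *: u) - f (x + s *: v) + f x.

Lemma second_differenceC f x u v :
  second_difference f x u v = second_difference f x v u.
Proof.
by apply/funext => s; rewrite /second_difference (addrAC x) (addrAC (f _)).
Qed.

Lemma second_difference_MVT f x u v (s : R) : 0 < s ->
  (forall a b : R, `|a| <= s -> `|b| <= s ->
     derivable f (x + a *: u + b *: v) u /\
     derivable (fun y => 'D_u f y) (x + a *: u + b *: v) v) ->
  exists a b : R, [/\ `|a| <= s, `|b| <= s &
    second_difference f x u v s =
    s * s * 'D_v (fun y => 'D_u f y) (x + a *: u + b *: v)].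
Proof.
move=> s_gt0 df.
have s_le : `|s| <= s by rewrite gtr0_norm.
have norm0_le : `|0 : R| <= s by rewrite normr0 ltW.
have norm_frac_le (t : R) : 0 <= t <= 1 -> `|t * s| <= s.
  by move=> /andP[t0 t1]; rewrite normrM (ger0_norm t0) gtr0_norm// ler_piMl// ltW.
pose diff_v := (fun y => f (y + s *: v)) \- f.
have ddiff_v (a : R) : `|a| <= s -> is_derive (x + a *: u) u diff_v
    ('D_u f (x + a *: u + s *: v) - 'D_u f (x + a *: u)).
  move=> a_s; apply: is_deriveB.
    have /derivableP/is_derive_line0P dfs := (df a s a_s s_le).1.
    by apply/is_derive_line0P; under eq_fun do rewrite addrAC.
  by apply: derivableP; have [+ _] := df a 0 a_s norm0_le; rewrite scale0r addr0.
have [|c c01 diff_vE] := @derive_MVT diff_v x u s.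
  by move=> t t01; have [] := ddiff_v (t * s) (norm_frac_le _ t01).
rewrite (@derive_val _ _ _ _ _ _ _ (ddiff_v _ (norm_frac_le _ c01))) in diff_vE.
have [|c' c'01 diff_uE] :=
    @derive_MVT (fun y => 'D_u f y) (x + (c * s) *: u) v s.
  by move=> t t01; exact: (df _ _ (norm_frac_le _ c01) (norm_frac_le _ t01)).2.
exists (c * s), (c' * s); split; [exact: norm_frac_le|exact: norm_frac_le|].
by rewrite -mulrA -diff_uE -diff_vE /diff_v /second_difference /=; ring.
Qed.

Lemma cvg_second_difference f x u v :
  (\forall y \near x, derivable f y u /\ derivable (fun y => 'D_u f y) y v) ->
  {for x, continuous (fun y => 'D_v (fun y => 'D_u f y) y)} ->
  (fun s => (s * s)^-1 * second_difference f x u v s) @ 0^'+ -->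
    'D_v (fun y => 'D_u f y) x.
Proof.
move=> df cf; apply/cvgrPdist_lt => e e0; move/cvgrPdist_lt/(_ _ e0) in cf.
near=> s.
have s0 : 0 < s by near: s; exact: nbhs_right_gt.
have [|a [b [a_s b_s ->]]] := @second_difference_MVT f x u v s s0.
  by near: s; exact: near_parallelogram df.
rewrite mulKf ?mulf_neq0 ?gt_eqF//; move: a b a_s b_s; near: s.
exact: near_parallelogram cf.
Unshelve. all: by end_near. Qed.

End SecondDifference.

Section PartialDerivatives.
Variables (R : realType) (V : normedModType R) (I : Type) (e : I -> V).
Variables (f : V -> R) (x : V).
Hypothesis df : forall i, \forall y \near x, derivable f y (e i).
Hypothesis cf : forall i, {for x, continuous (fun y => 'D_(e i) f y)}.

Lemma partials_approximation (r : seq I) (eps : R) : 0 < eps ->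
  \forall s \near 0^'+, forall a : I -> R, (forall i, `|a i| <= s) ->
    `|f (x + \sum_(i <- r) a i *: e i) - f x - \sum_(i <- r) a i * 'D_(e i) f x|
    <= eps * \sum_(i <- r) `|a i|.
Proof.
move=> eps0; elim: r => [|i r IH].
  by near=> s => a _; rewrite !big_nil addr0 subrr subr0 normr0 mulr0.
have near_i : \forall y \near x,
    derivable f y (e i) /\ `|'D_(e i) f x - 'D_(e i) f y| <= eps.
  by apply: filterI; [exact: df|have /cvgrPdist_le := @cf i; exact].
have := near_shift_le (\sum_(j <- r) `|e j| + `|e i|) near_i.
move: IH; apply: filterS2 => s IH near_s a a_s; rewrite !big_cons.
set partial_sum := \sum_(j <- r) a j *: e j.
have near_segment (t : R) : 0 <= t <= 1 ->
    derivable f (x + partial_sum + (t * a i) *: e i) (e i) /\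
    `|'D_(e i) f x - 'D_(e i) f (x + partial_sum + (t * a i) *: e i)| <= eps.
  move=> /andP[t0 t1]; rewrite -addrA; apply: near_s.
  apply: le_trans (ler_normD _ _) _; rewrite mulrDr lerD//.
    apply: le_trans (ler_norm_sum _ _ _) _; rewrite mulr_sumr.
    by apply: ler_sum => j _; rewrite normrZ ler_wpM2r.
  rewrite normrZ normrM (ger0_norm t0) ler_wpM2r//.
  by apply: le_trans (a_s i); rewrite ler_piMl.
have [t t01|c c01 fE] := @derive_MVT R V f (x + partial_sum) (e i) (a i).
  by case: (near_segment t t01).
have [_ Dc] := near_segment c c01.
rewrite (addrC (a i *: e i)) addrA -(subrK (f (x + partial_sum)) (f _)) fE.
rewrite (_ : _ - _ - _ = (f (x + partial_sum) - f x - \sum_(j <- r) a j * 'D_(e j) f x)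
  - a i * ('D_(e i) f x - 'D_(e i) f (x + partial_sum + (c * a i) *: e i))); last by ring.
apply: le_trans (ler_normB _ _) _; rewrite [leRHS]mulrDr [leRHS]addrC lerD//.
  exact: IH.
by rewrite normrM mulrC ler_wpM2r.
Unshelve. all: by end_near. Qed.

End PartialDerivatives.

Section Smooth.
Variables (R : realType) (V : normedModType R).
Implicit Types (f g : V -> R) (x u v : V) (U : set V).

Lemma Ck_continuous k U f x : Ck k U f -> U x -> {for x, continuous f}.
Proof. by case: k => [|k] [cf _] Ux; exact: cf. Qed.

Lemma Ck_derivable k U f x v : Ck k.+1 U f -> U x -> derivable f x v.
Proof. by move=> [_ /(_ v)[+ _]]; apply. Qed.

Lemma Ck_derive k U f v : Ck k.+1 U f -> Ck k U (fun x => 'D_v f x).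
Proof. by move=> [_ /(_ v)[]]. Qed.

Lemma open_near U x (P : V -> Prop) : open U -> U x -> (forall y, U y -> P y) ->
  \near x, P x.
Proof.
by move=> oU Ux UP; apply: filterS (open_nbhs_nbhs (conj oU Ux)).
Qed.

Lemma eq_continuous_at U f g x : open U -> U x -> (forall y, U y -> f y = g y) ->
  {for x, continuous f} -> {for x, continuous g}.
Proof.
move=> oU Ux fg cf; rewrite /prop_for /continuous_at -(fg x Ux).
apply: cvg_trans cf; apply: near_eq_cvg.
exact: open_near oU Ux fg.
Qed.

Lemma eq_derive_on U f g x v : open U -> U x -> (forall y, U y -> f y = g y) ->
  'D_v f x = 'D_v g x.
Proof.
by move=> oU Ux fg; apply: near_eq_derive; exact: open_near oU Ux fg.
Qed.

Lemma eq_Ck k U f g : open U -> (forall y, U y -> f y = g y) ->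
  Ck k U f -> Ck k U g.
Proof.
move=> oU; elim: k f g => [|k IH] f g fg [cf df].
  by split=> // x Ux; exact: eq_continuous_at oU Ux fg (cf _ Ux).
split=> [x Ux|v]; first exact: eq_continuous_at oU Ux fg (cf _ Ux).
have [dfv Cv] := df v; split=> [x Ux|].
  by apply: near_eq_derivable (dfv x Ux); exact: open_near oU Ux fg.
by apply: IH Cv => x Ux; exact: eq_derive_on oU Ux fg.
Qed.

Lemma CkS k U f : Ck k.+1 U f -> Ck k U f.
Proof.
elim: k f => [|k IH] f; first by case=> cf _; split.
by move=> [cf df]; split=> // v; have [dfv /IH Cv] := df v.
Qed.

Lemma Ck_sub k U W f : W `<=` U -> Ck k U f -> Ck k W f.
Proof.
move=> WU; elim: k f => [|k IH] f [cf df];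
  (split; first by move=> x /WU; exact: cf) => //.
by move=> v; have [dfv Cv] := df v; split=> [x /WU|]; [exact: dfv|exact: IH].
Qed.

Lemma Ck_cst k U (c : R) : Ck k U (fun=> c).
Proof.
elim: k c => [|k IH] c; (split; first by move=> x _; exact: cst_continuous) => //.
move=> v; split=> [x _|]; first exact: derivable_cst.
have -> : (fun x => 'D_v (fun=> c) x) = (fun=> 0) :> (V -> R).
  by apply/funext => x; exact: derive_cst.
exact: IH.
Qed.

Lemma CkD k U f g : open U -> Ck k U f -> Ck k U g -> Ck k U (fun x => f x + g x).
Proof.
move=> oU; elim: k f g => [|k IH] f g [cf df] [cg dg];
  (split; first by move=> x Ux; apply: continuousD; [exact: cf|exact: cg]) => //.
move=> v; have [dfv Cf] := df v; have [dgv Cg] := dg v; split=> [x Ux|].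
  by apply: derivableD; [exact: dfv|exact: dgv].
apply: eq_Ck oU _ (IH _ _ Cf Cg) => x Ux.
by rewrite -deriveD//; [exact: dfv|exact: dgv].
Qed.

Lemma CkM k U f g : open U -> Ck k U f -> Ck k U g -> Ck k U (fun x => f x * g x).
Proof.
move=> oU; elim: k f g => [|k IH] f g Cf Cg; (split; first by move=> x Ux;
  apply: continuousM; [exact: Ck_continuous Cf Ux|exact: Ck_continuous Cg Ux]) => // v.
have df x : U x -> derivable f x v by exact: Ck_derivable Cf.
have dg x : U x -> derivable g x v by exact: Ck_derivable Cg.
split=> [x Ux|]; first by apply: derivableM; [exact: df|exact: dg].
apply: (eq_Ck (f := fun x => f x * 'D_v g x + g x * 'D_v f x)) => // [x Ux|].
  by rewrite (_ : (fun x => f x * g x) = f * g)// deriveM//; [exact: df|exact: dg].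
by apply: CkD => //; apply: IH => //;
  [exact: CkS|exact: Ck_derive|exact: CkS|exact: Ck_derive].
Qed.

Lemma CkV k U f : open U -> (forall x, U x -> f x != 0) -> Ck k U f ->
  Ck k U (fun x => (f x)^-1).
Proof.
move=> oU f0; elim: k => [|k IH] Cf; (split; first by move=> x Ux;
  apply: continuousV; [exact: f0|exact: Ck_continuous Cf Ux]) => // v.
have df x : U x -> derivable f x v by exact: Ck_derivable Cf.
split=> [x Ux|]; first by apply: derivableV; [exact: f0|exact: df].
have CV := IH (CkS Cf).
apply: (eq_Ck (f := fun x => -1 * ((f x)^-1 * (f x)^-1 * 'D_v f x))) => // [x Ux|].
  by rewrite (deriveV (f0 _ Ux) (df _ Ux)) mulN1r -exprVn expr2 [in RHS]scaleNr.
apply: CkM => //; first exact: Ck_cst.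
by apply: CkM => //; [exact: CkM|exact: Ck_derive].
Qed.

Lemma is_derive_ln_comp f x v : 0 < f x -> derivable f x v ->
  is_derive x v (fun y => ln (f y)) ((f x)^-1 * 'D_v f x).
Proof.
move=> f0 /derivableP /is_derive_line0P df; apply/is_derive_line0P.
apply: (@is_derive1_comp _ (@ln R) (fun s => f (x + s *: v))) df.
by rewrite scale0r addr0; exact: is_derive1_ln.
Qed.

Lemma Ck_ln k U f : open U -> (forall x, U x -> 0 < f x) -> Ck k U f ->
  Ck k U (fun x => ln (f x)).
Proof.
move=> oU f0 Cf.
have cln x : U x -> {for x, continuous (fun x => ln (f x))}.
  move=> Ux; apply: (@continuous_comp _ _ _ f (@ln R)).
    exact: Ck_continuous Cf Ux.
  exact/continuous_ln/f0.
case: k Cf => [|k] Cf; split=> // v.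
have dln x : U x -> is_derive x v (fun y => ln (f y)) ((f x)^-1 * 'D_v f x).
  move=> Ux; apply: is_derive_ln_comp; first exact: f0.
  exact: Ck_derivable Cf Ux.
split=> [x /dln[]//|].
apply: (eq_Ck (f := fun x => (f x)^-1 * 'D_v f x)) => // [x /dln[_ ->]//|].
apply: CkM => //; last exact: Ck_derive.
by apply: CkV => // [x Ux|]; [rewrite gt_eqF// f0|exact: CkS].
Qed.

Lemma smooth_derive U f v : smooth U f -> smooth U (fun x => 'D_v f x).
Proof. by move=> sf k; exact: Ck_derive (sf k.+1). Qed.

Lemma smooth_derivable U f x v : smooth U f -> U x -> derivable f x v.
Proof. by move=> /(_ 1%N)/Ck_derivable; apply. Qed.

Lemma smooth_continuous U f x : smooth U f -> U x -> {for x, continuous f}.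
Proof. by move=> /(_ 0%N)/Ck_continuous; apply. Qed.

Lemma eq_smooth U f g : open U -> (forall y, U y -> f y = g y) ->
  smooth U f -> smooth U g.
Proof. by move=> oU fg sf k; apply: eq_Ck oU fg (sf k). Qed.

Lemma smooth_sub U W f : W `<=` U -> smooth U f -> smooth W f.
Proof. by move=> WU sf k; apply: Ck_sub WU (sf k). Qed.

Lemma smooth_cst U (c : R) : smooth U (fun=> c).
Proof. by move=> k; exact: Ck_cst. Qed.

Lemma smoothD U f g : open U -> smooth U f -> smooth U g ->
  smooth U (fun x => f x + g x).
Proof. by move=> oU sf sg k; exact: CkD. Qed.

Lemma smoothM U f g : open U -> smooth U f -> smooth U g ->
  smooth U (fun x => f x * g x).
Proof. by move=> oU sf sg k; exact: CkM. Qed.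

Lemma smoothN U f : open U -> smooth U f -> smooth U (fun x => - f x).
Proof.
move=> oU sf; have := smoothM oU (smooth_cst U (-1)) sf.
by under eq_fun do rewrite mulN1r.
Qed.

Lemma smoothB U f g : open U -> smooth U f -> smooth U g ->
  smooth U (fun x => f x - g x).
Proof. by move=> oU sf sg; apply: smoothD => //; exact: smoothN. Qed.

Lemma smoothX U f n : open U -> smooth U f -> smooth U (fun x => f x ^+ n).
Proof.
move=> oU sf; elim: n => [|n IH]; first exact: smooth_cst.
by under eq_fun do rewrite exprS; exact: smoothM.
Qed.

Lemma smoothV U f : open U -> (forall x, U x -> f x != 0) -> smooth U f ->
  smooth U (fun x => (f x)^-1).
Proof. by move=> oU f0 sf k; exact: CkV. Qed.

Lemma smooth_ln U f : open U -> (forall x, U x -> 0 < f x) -> smooth U f ->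
  smooth U (fun x => ln (f x)).
Proof. by move=> oU f0 sf k; exact: Ck_ln. Qed.

Lemma smooth_cvg_second_difference U f x u v : open U -> smooth U f -> U x ->
  (fun s => (s * s)^-1 * second_difference f x u v s) @ 0^'+ -->
    'D_v (fun y => 'D_u f y) x.
Proof.
move=> oU sf Ux; have sDf := smooth_derive u sf; apply: cvg_second_difference.
  apply: open_near oU Ux _ => y Uy.
  by split; [exact: smooth_derivable Uy|exact: smooth_derivable sDf Uy].
exact: smooth_continuous (smooth_derive v sDf) Ux.
Qed.

Lemma smooth_schwarz U f x u v : open U -> smooth U f -> U x ->
  'D_v (fun y => 'D_u f y) x = 'D_u (fun y => 'D_v f y) x.
Proof.
move=> oU sf Ux.
have cvg_uv := smooth_cvg_second_difference (u := u) (v := v) oU sf Ux.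
have := smooth_cvg_second_difference (u := v) (v := u) oU sf Ux.
by rewrite second_differenceC; exact: cvg_unique.
Qed.

Lemma is_derive_scalar (f : V -> R) x v : scalar f -> is_derive x v f (f v).
Proof.
move=> linf; apply/is_derive_line0P.
have -> : (fun s : R => f (x + s *: v)) = cst (f x) + f v *: id.
  by apply/funext => s; rewrite addrC linf addrC /= mulrC.
have dZ := @is_deriveZ R R R id (f v) 0 1 1 (is_derive_id _ _).
by apply: is_derive_eq (is_deriveD (is_derive_cst (f x) _ _) dZ) _;
  rewrite add0r [LHS]mulr1.
Qed.

Lemma smooth_linear U (f : V -> R) : scalar f -> continuous f -> smooth U f.
Proof.
move=> linf cf [|k]; (split; first by move=> x _; exact: cf) => // v.
split=> [x _|]; first by have [] := is_derive_scalar x v linf.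
have -> : (fun x => 'D_v f x) = fun=> f v.
  by apply/funext => x; have [_ ->] := is_derive_scalar x v linf.
exact: Ck_cst.
Qed.

End Smooth.

(** * Wirtinger derivatives *)

Section ComplexParts.
Variable R : rcfType.
Implicit Types x y : R[i].

Lemma ReD x y : complex.Re (x + y) = complex.Re x + complex.Re y.
Proof. by case: x; case: y. Qed.

Lemma ImD x y : complex.Im (x + y) = complex.Im x + complex.Im y.
Proof. by case: x; case: y. Qed.

Lemma ReN x : complex.Re (- x) = - complex.Re x.
Proof. by case: x. Qed.

Lemma ImN x : complex.Im (- x) = - complex.Im x.
Proof. by case: x. Qed.

Lemma ReM x y : complex.Re (x * y) =
  complex.Re x * complex.Re y - complex.Im x * complex.Im y.
Proof. by case: x; case: y. Qed.

Lemma ImM x y : complex.Im (x * y) =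
  complex.Re x * complex.Im y + complex.Im x * complex.Re y.
Proof. by case: x => a b; case: y => c d /=; rewrite addrC. Qed.

Lemma ReRM (a : R) x : complex.Re (a%:C * x) = a * complex.Re x.
Proof. by rewrite ReM /= mul0r subr0. Qed.

Lemma ImRM (a : R) x : complex.Im (a%:C * x) = a * complex.Im x.
Proof. by rewrite ImM /= mul0r addr0. Qed.

Lemma ReJ x : complex.Re (conjc x) = complex.Re x.
Proof. by case: x. Qed.

Lemma ImJ x : complex.Im (conjc x) = - complex.Im x.
Proof. by case: x. Qed.

Lemma ReV x : complex.Re x^-1 =
  complex.Re x / (complex.Re x ^+ 2 + complex.Im x ^+ 2).
Proof. by case: x. Qed.

Lemma ImV x : complex.Im x^-1 =
  - (complex.Im x / (complex.Re x ^+ 2 + complex.Im x ^+ 2)).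
Proof. by case: x. Qed.

Lemma complexP x y :
  complex.Re x = complex.Re y -> complex.Im x = complex.Im y -> x = y.
Proof. by case: x => a b; case: y => c d /= -> ->. Qed.

Lemma complexR_eq0 (a : R) : (a%:C == 0) = (a == 0).
Proof. exact: fmorph_eq0. Qed.

Lemma sqr_Re_Im_neq0 x : x != 0 -> complex.Re x ^+ 2 + complex.Im x ^+ 2 != 0.
Proof. by rewrite paddr_eq0 ?sqr_ge0// !sqrf_eq0 -[x == 0]/(_) eq_complex. Qed.

Lemma conjcD x y : conjc (x + y) = conjc x + conjc y.
Proof. exact: rmorphD. Qed.

Lemma conjcM x y : conjc (x * y) = conjc x * conjc y.
Proof. exact: rmorphM. Qed.

Lemma conjci : conjc ('i : R[i]) = - 'i.
Proof. by apply: complexP => //=; rewrite oppr0. Qed.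

Lemma conjc_half : conjc (2^-1 : R[i]) = 2^-1.
Proof. by rewrite conjc_inv (conjc_nat _ 2). Qed.

Lemma Re_mulcJ x : (complex.Re (x * conjc x))%:C = x * conjc x.
Proof. by case: x => a b; apply: complexP => //=; ring. Qed.

Lemma Re_mulcJ_gt0 x : x != 0 -> 0 < complex.Re (x * conjc x).
Proof.
move=> x0; rewrite -ltcR Re_mulcJ lt_def mulcJ_ge0 andbT.
by rewrite mulf_neq0 ?conjc_eq0.
Qed.

Lemma Re_mulcJ_scale (a : R) x :
  complex.Re (a%:C * x * conjc (a%:C * x)) = a ^+ 2 * complex.Re (x * conjc x).
Proof. by case: x => b c /=; ring. Qed.

End ComplexParts.

Section CSmooth.
Variables (R : realType) (V : normedModType R) (U : set V).
Hypothesis oU : open U.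
Implicit Types (F G : V -> R[i]) (x u v : V).

Lemma eq_csmooth F G : (forall x, U x -> F x = G x) -> csmooth U F -> csmooth U G.
Proof.
by move=> FG [sr si]; split; [apply: eq_smooth sr|apply: eq_smooth si] => // x /FG ->.
Qed.

Lemma csmooth_cst (c : R[i]) : csmooth U (fun=> c).
Proof. by split; exact: smooth_cst. Qed.

Lemma csmooth_real (f : V -> R) : smooth U f -> csmooth U (fun x => (f x)%:C).
Proof. by move=> sf; split=> //=; exact: smooth_cst. Qed.

Lemma csmoothD F G : csmooth U F -> csmooth U G -> csmooth U (fun x => F x + G x).
Proof.
move=> [sFr sFi] [sGr sGi]; split.
  by under eq_fun do rewrite ReD; exact: smoothD.
by under eq_fun do rewrite ImD; exact: smoothD.
Qed.

Lemma csmoothN F : csmooth U F -> csmooth U (fun x => - F x).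
Proof.
move=> [sr si]; split.
  by under eq_fun do rewrite ReN; exact: smoothN.
by under eq_fun do rewrite ImN; exact: smoothN.
Qed.

Lemma csmoothM F G : csmooth U F -> csmooth U G -> csmooth U (fun x => F x * G x).
Proof.
move=> [sFr sFi] [sGr sGi]; split.
  by under eq_fun do rewrite ReM; apply: smoothB => //; exact: smoothM.
by under eq_fun do rewrite ImM; apply: smoothD => //; exact: smoothM.
Qed.

Lemma csmoothJ F : csmooth U F -> csmooth U (fun x => conjc (F x)).
Proof.
move=> [sr si]; split.
  by under eq_fun do rewrite ReJ.
by under eq_fun do rewrite ImJ; exact: smoothN.
Qed.

Lemma csmoothV F : (forall x, U x -> F x != 0) -> csmooth U F ->
  csmooth U (fun x => (F x)^-1).
Proof.
move=> F0 [sr si].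
have sV : smooth U (fun x => (complex.Re (F x) ^+ 2 + complex.Im (F x) ^+ 2)^-1).
  apply: smoothV => // [x /F0|]; first exact: sqr_Re_Im_neq0.
  by apply: smoothD => //; exact: smoothX.
split.
  by under eq_fun do rewrite ReV; exact: smoothM.
by under eq_fun do rewrite ImV; apply: smoothN => //; exact: smoothM.
Qed.

Lemma csmooth_sum (I : Type) (r : seq I) (P : pred I) (F : I -> V -> R[i]) :
  (forall i, csmooth U (F i)) -> csmooth U (fun x => \sum_(i <- r | P i) F i x).
Proof.
move=> sF; elim: r => [|i r IH].
  by under eq_fun do rewrite big_nil; exact: csmooth_cst.
by under eq_fun do rewrite big_cons; case: (P i) => //; exact: csmoothD.
Qed.

Lemma csmooth_prod (I : Type) (r : seq I) (P : pred I) (F : I -> V -> R[i]) :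
  (forall i, csmooth U (F i)) -> csmooth U (fun x => \prod_(i <- r | P i) F i x).
Proof.
move=> sF; elim: r => [|i r IH].
  by under eq_fun do rewrite big_nil; exact: csmooth_cst.
by under eq_fun do rewrite big_cons; case: (P i) => //; exact: csmoothM.
Qed.

Lemma csmooth_cderive F v : csmooth U F -> csmooth U (cderive F v).
Proof. by move=> [sr si]; split; exact: smooth_derive. Qed.

Lemma eq_cderive F G v x : U x -> (forall y, U y -> F y = G y) ->
  cderive F v x = cderive G v x.
Proof.
move=> Ux FG; rewrite /cderive.
by congr (_ +i* _); apply: (eq_derive_on _ oU Ux) => y /FG ->.
Qed.

Lemma cderive_real (f : V -> R) v x :
  cderive (fun y => (f y)%:C) v x = ('D_v f x)%:C.
Proof. by congr (_ +i* _); exact: derive_cst. Qed.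

Lemma cderive_cst (c : R[i]) v x : cderive (fun=> c) v x = 0.
Proof. by congr (_ +i* _); exact: derive_cst. Qed.

Lemma cderiveD F G v x : csmooth U F -> csmooth U G -> U x ->
  cderive (fun x => F x + G x) v x = cderive F v x + cderive G v x.
Proof.
move=> [sFr sFi] [sGr sGi] Ux; apply: complexP => /=.
  by under eq_fun do rewrite ReD; rewrite -deriveD//; exact: smooth_derivable Ux.
by under eq_fun do rewrite ImD; rewrite -deriveD//; exact: smooth_derivable Ux.
Qed.

Lemma cderiveM F G v x : csmooth U F -> csmooth U G -> U x ->
  cderive (fun x => F x * G x) v x = F x * cderive G v x + cderive F v x * G x.
Proof.
move=> [sFr sFi] [sGr sGi] Ux.
have dM (f g : V -> R) : smooth U f -> smooth U g ->
    is_derive x v (fun x => f x * g x) (f x * 'D_v g x + g x * 'D_v f x).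
  move=> sf sg; exact: (@is_deriveM _ _ f g x v _ _
    (derivableP (smooth_derivable sf Ux)) (derivableP (smooth_derivable sg Ux))).
rewrite /cderive; apply: complexP => /=.
  under eq_fun do rewrite ReM.
  have [_ ->] := is_deriveB (dM _ _ sFr sGr) (dM _ _ sFi sGi).
  by case: (F x) => a b; case: (G x) => c d /=; ring.
under eq_fun do rewrite ImM.
have [_ ->] := is_deriveD (dM _ _ sFr sGi) (dM _ _ sFi sGr).
by case: (F x) => a b; case: (G x) => c d /=; ring.
Qed.

Lemma cderiveZ (c : R[i]) F v x : csmooth U F -> U x ->
  cderive (fun x => c * F x) v x = c * cderive F v x.
Proof.
move=> sF Ux; rewrite (cderiveM _ (csmooth_cst c) sF Ux) cderive_cst.
by rewrite mul0r addr0.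
Qed.

Lemma cderiveJ F v x : csmooth U F -> U x ->
  cderive (fun x => conjc (F x)) v x = conjc (cderive F v x).
Proof.
move=> [sr si] Ux; rewrite /cderive /=; congr (_ +i* _).
  by under eq_fun do rewrite ReJ.
by under eq_fun do rewrite ImJ; rewrite -deriveN//; exact: smooth_derivable Ux.
Qed.

Lemma cderive_schwarz F u v x : csmooth U F -> U x ->
  cderive (cderive F u) v x = cderive (cderive F v) u x.
Proof.
move=> [sr si] Ux; rewrite /cderive /=.
by rewrite (smooth_schwarz u v oU sr Ux) (smooth_schwarz u v oU si Ux).
Qed.

Lemma cderive_ln (f : V -> R) v x : (forall y, U y -> 0 < f y) -> smooth U f ->
  U x -> cderive (fun y => (ln (f y))%:C) v x =
         (f x)%:C^-1 * cderive (fun y => (f y)%:C) v x.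
Proof.
move=> f0 sf Ux; rewrite !cderive_real -fmorphV -rmorphM.
by have [_ ->] := is_derive_ln_comp (f0 x Ux) (smooth_derivable (v := v) sf Ux).
Qed.

End CSmooth.

Section Wirtinger.
Variables (R : realType) (n : nat) (U : set (Cn R n)).
Hypothesis oU : open U.
Implicit Types (F G : Cn R n -> R[i]) (p : Cn R n) (s t : R[i]).

(* s = -i gives d/dz^k and s = i gives d/dzbar^k. *)
Definition wirtinger s k F p : R[i] :=
  2^-1 * (cderive F (dirRe R k) p + s * cderive F (dirIm R k) p).

Lemma del_wirtinger k F : del k F = wirtinger (- 'i) k F.
Proof. by apply/funext => p; rewrite /wirtinger mulNr. Qed.

Lemma delbar_wirtinger k F : delbar k F = wirtinger 'i k F.
Proof. by []. Qed.

Lemma csmooth_wirtinger s F k : csmooth U F -> csmooth U (wirtinger s k F).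
Proof.
move=> sF; apply: csmoothM => //; first exact: csmooth_cst.
apply: csmoothD => //; first exact: csmooth_cderive.
by apply: csmoothM => //; [exact: csmooth_cst|exact: csmooth_cderive].
Qed.

Lemma eq_wirtinger s F G k p : U p -> (forall q, U q -> F q = G q) ->
  wirtinger s k F p = wirtinger s k G p.
Proof. by move=> Up FG; rewrite /wirtinger !(eq_cderive oU _ Up FG). Qed.

Lemma wirtinger_cst s (c : R[i]) k p : wirtinger s k (fun=> c) p = 0.
Proof. by rewrite /wirtinger !cderive_cst mulr0 addr0 mulr0. Qed.

Lemma wirtingerD s F G k p : csmooth U F -> csmooth U G -> U p ->
  wirtinger s k (fun p => F p + G p) p = wirtinger s k F p + wirtinger s k G p.
Proof.
move=> sF sG Up; rewrite /wirtinger !(cderiveD _ sF sG Up).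
by rewrite -[in RHS]mulrDr addrACA -mulrDr.
Qed.

Lemma wirtingerM s F G k p : csmooth U F -> csmooth U G -> U p ->
  wirtinger s k (fun p => F p * G p) p =
  F p * wirtinger s k G p + wirtinger s k F p * G p.
Proof.
move=> sF sG Up; rewrite /wirtinger !(cderiveM _ sF sG Up).
move: (cderive F _ _) (cderive F _ _) (cderive G _ _) (cderive G _ _) => a b c e.
by move: (F p) (G p) => f g; ring.
Qed.

Lemma wirtingerJ s F k p : csmooth U F -> U p ->
  wirtinger s k (fun p => conjc (F p)) p = conjc (wirtinger (conjc s) k F p).
Proof.
move=> sF Up; rewrite /wirtinger !(cderiveJ _ sF Up).
by rewrite [in RHS]conjcM conjcD conjcM conjcK conjc_half.
Qed.

Lemma cderive_wirtinger s F k v p : csmooth U F -> U p ->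
  cderive (wirtinger s k F) v p =
  2^-1 * (cderive (cderive F (dirRe R k)) v p +
          s * cderive (cderive F (dirIm R k)) v p).
Proof.
move=> sF Up; have sDF w := csmooth_cderive w sF.
have sZ w := csmoothM oU (csmooth_cst U s) (sDF w).
rewrite (cderiveZ _ _ (csmoothD oU (sDF _) (sZ _)) Up); congr (_ * _).
by rewrite (cderiveD _ (sDF _) (sZ _) Up) (cderiveZ s _ (sDF _) Up).
Qed.

Lemma wirtinger_wirtinger s t F a b p : csmooth U F -> U p ->
  wirtinger s a (wirtinger t b F) p =
  2^-1 * (2^-1 * (cderive (cderive F (dirRe R b)) (dirRe R a) p +
                  t * cderive (cderive F (dirIm R b)) (dirRe R a) p) +
     s * (2^-1 * (cderive (cderive F (dirRe R b)) (dirIm R a) p +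
                  t * cderive (cderive F (dirIm R b)) (dirIm R a) p))).
Proof.
by move=> sF Up; rewrite {1}/wirtinger 2!(cderive_wirtinger t b _ sF Up).
Qed.

Lemma wirtingerC s t F a b p : csmooth U F -> U p ->
  wirtinger s a (wirtinger t b F) p = wirtinger t b (wirtinger s a F) p.
Proof.
move=> sF Up; apply: etrans (wirtinger_wirtinger s t a b sF Up) _.
apply: etrans _ (esym (wirtinger_wirtinger t s b a sF Up)).
have mixed_sym (D : Cn R n -> Cn R n -> R[i]) xa ya xb yb :
    (forall u v, D u v = D v u) ->
    2^-1 * (2^-1 * (D xb xa + t * D yb xa) + s * (2^-1 * (D xb ya + t * D yb ya))) =
    2^-1 * (2^-1 * (D xa xb + s * D ya xb) + t * (2^-1 * (D xa yb + s * D ya yb))).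
  by move=> DC; rewrite (DC xa xb) (DC ya xb) (DC xa yb) (DC ya yb); ring.
exact: (mixed_sym (fun u v => cderive (cderive F u) v p) _ _ _ _
  (fun u v => cderive_schwarz oU u v sF Up)).
Qed.

Lemma wirtinger_ln s (f : Cn R n -> R) k p : (forall q, U q -> 0 < f q) ->
  smooth U f -> U p -> wirtinger s k (fun q => (ln (f q))%:C) p =
    (f p)%:C^-1 * wirtinger s k (fun q => (f q)%:C) p.
Proof.
move=> f0 sf Up; rewrite /wirtinger !(cderive_ln _ f0 sf Up).
by rewrite mulrCA -mulrDr mulrCA.
Qed.

Lemma csmooth_del F k : csmooth U F -> csmooth U (del k F).
Proof. by rewrite del_wirtinger; exact: csmooth_wirtinger. Qed.

Lemma csmooth_delbar F k : csmooth U F -> csmooth U (delbar k F).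
Proof. by rewrite delbar_wirtinger; exact: csmooth_wirtinger. Qed.

Lemma eq_del F G k p : U p -> (forall q, U q -> F q = G q) ->
  del k F p = del k G p.
Proof. by rewrite !del_wirtinger; exact: eq_wirtinger. Qed.

Lemma eq_delbar F G k p : U p -> (forall q, U q -> F q = G q) ->
  delbar k F p = delbar k G p.
Proof. by rewrite !delbar_wirtinger; exact: eq_wirtinger. Qed.

Lemma del_cst (c : R[i]) k p : del k (fun=> c) p = 0.
Proof. by rewrite del_wirtinger wirtinger_cst. Qed.

Lemma delbar_cst (c : R[i]) k p : delbar k (fun=> c) p = 0.
Proof. by rewrite delbar_wirtinger wirtinger_cst. Qed.

Lemma delD F G k p : csmooth U F -> csmooth U G -> U p ->
  del k (fun p => F p + G p) p = del k F p + del k G p.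
Proof. by rewrite !del_wirtinger; exact: wirtingerD. Qed.

Lemma delbarD F G k p : csmooth U F -> csmooth U G -> U p ->
  delbar k (fun p => F p + G p) p = delbar k F p + delbar k G p.
Proof. by rewrite !delbar_wirtinger; exact: wirtingerD. Qed.

Lemma delM F G k p : csmooth U F -> csmooth U G -> U p ->
  del k (fun p => F p * G p) p = F p * del k G p + del k F p * G p.
Proof. by rewrite !del_wirtinger; exact: wirtingerM. Qed.

Lemma delbarM F G k p : csmooth U F -> csmooth U G -> U p ->
  delbar k (fun p => F p * G p) p = F p * delbar k G p + delbar k F p * G p.
Proof. by rewrite !delbar_wirtinger; exact: wirtingerM. Qed.

Lemma delZ (c : R[i]) F k p : csmooth U F -> U p ->
  del k (fun p => c * F p) p = c * del k F p.
Proof.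
move=> sF Up; rewrite (delM _ (csmooth_cst U c) sF Up) del_cst.
by rewrite mul0r addr0.
Qed.

Lemma delbarZ (c : R[i]) F k p : csmooth U F -> U p ->
  delbar k (fun p => c * F p) p = c * delbar k F p.
Proof.
move=> sF Up; rewrite (delbarM _ (csmooth_cst U c) sF Up) delbar_cst.
by rewrite mul0r addr0.
Qed.

Lemma delJ F k p : csmooth U F -> U p ->
  del k (fun p => conjc (F p)) p = conjc (delbar k F p).
Proof. by move=> sF Up; rewrite del_wirtinger wirtingerJ// -conjci conjcK. Qed.

Lemma delbarJ F k p : csmooth U F -> U p ->
  delbar k (fun p => conjc (F p)) p = conjc (del k F p).
Proof. by move=> sF Up; rewrite delbar_wirtinger wirtingerJ// conjci del_wirtinger. Qed.

Lemma del_sum (I : Type) (r : seq I) (P : pred I) (F : I -> Cn R n -> R[i]) k p :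
  (forall i, csmooth U (F i)) -> U p ->
  del k (fun p => \sum_(i <- r | P i) F i p) p = \sum_(i <- r | P i) del k (F i) p.
Proof.
move=> sF Up; elim: r => [|i r IH].
  by under eq_fun do rewrite big_nil; rewrite big_nil del_cst.
under eq_fun do rewrite big_cons; rewrite big_cons; case: (P i) => //.
by rewrite delD// ?IH//; exact: csmooth_sum.
Qed.

Lemma delV F k p : (forall q, U q -> F q != 0) -> csmooth U F -> U p ->
  del k (fun p => (F p)^-1) p = - (del k F p / F p ^+ 2).
Proof.
move=> F0 sF Up; have Fp := F0 p Up.
have := delM k sF (csmoothV oU F0 sF) Up.
rewrite (@eq_del _ (fun=> 1)) ?del_cst//; last by move=> q /F0 ?; rewrite mulfV.
move=> /eqP; rewrite eq_sym addr_eq0 => /eqP FdV.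
by apply: (mulfI Fp); rewrite FdV; field.
Qed.

Lemma delC F a b p : csmooth U F -> U p ->
  del a (delbar b F) p = delbar b (del a F) p.
Proof. by rewrite !del_wirtinger !delbar_wirtinger; exact: wirtingerC. Qed.

Lemma delbar_ln (f : Cn R n -> R) a p : (forall q, U q -> 0 < f q) ->
  smooth U f -> U p -> delbar a (fun q => (ln (f q))%:C) p =
    (f p)%:C^-1 * delbar a (fun q => (f q)%:C) p.
Proof. by rewrite !delbar_wirtinger; exact: wirtinger_ln. Qed.

Lemma delbar_real (f : Cn R n -> R) a p : smooth U f -> U p ->
  delbar a (fun q => (f q)%:C) p = conjc (del a (fun q => (f q)%:C) p).
Proof.
move=> sf Up; rewrite -(delbarJ _ (csmooth_real sf) Up).
by apply: eq_delbar => // q _; rewrite conjc_real.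
Qed.

Lemma eq_holomorphic F G : (forall p, U p -> F p = G p) -> holomorphic U F ->
  holomorphic U G.
Proof.
move=> FG [sF hF]; split; first exact: eq_csmooth sF.
by move=> p Up k; rewrite -(eq_delbar k Up FG) hF.
Qed.

Lemma holomorphic_cst c : holomorphic U (fun=> c).
Proof. by split; [exact: csmooth_cst|move=> p _ k; exact: delbar_cst]. Qed.

Lemma holomorphicD F G : holomorphic U F -> holomorphic U G ->
  holomorphic U (fun p => F p + G p).
Proof.
move=> [sF hF] [sG hG]; split; first exact: csmoothD.
by move=> p Up k; rewrite (delbarD _ sF sG Up) hF// hG// addr0.
Qed.

Lemma holomorphicM F G : holomorphic U F -> holomorphic U G ->
  holomorphic U (fun p => F p * G p).
Proof.
move=> [sF hF] [sG hG]; split; first exact: csmoothM.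
by move=> p Up k; rewrite (delbarM _ sF sG Up) hF// hG// mulr0 mul0r addr0.
Qed.

Lemma holomorphic_sum (I : Type) (r : seq I) (P : pred I) (F : I -> Cn R n -> R[i]) :
  (forall i, holomorphic U (F i)) ->
  holomorphic U (fun x => \sum_(i <- r | P i) F i x).
Proof.
move=> hF; elim: r => [|i r IH].
  by under eq_fun do rewrite big_nil; exact: holomorphic_cst.
under eq_fun do rewrite big_cons; case: (P i); last exact: IH.
exact: holomorphicD (hF i) IH.
Qed.

Lemma holomorphic_prod (I : Type) (r : seq I) (P : pred I) (F : I -> Cn R n -> R[i]) :
  (forall i, holomorphic U (F i)) ->
  holomorphic U (fun x => \prod_(i <- r | P i) F i x).
Proof.
move=> hF; elim: r => [|i r IH].
  by under eq_fun do rewrite big_nil; exact: holomorphic_cst.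
under eq_fun do rewrite big_cons; case: (P i); last exact: IH.
exact: holomorphicM (hF i) IH.
Qed.

Lemma holomorphic_det m (M : Cn R n -> 'M[R[i]]_m) :
  (forall a b, holomorphic U (fun p => M p a b)) ->
  holomorphic U (fun p => \det (M p)).
Proof.
move=> hM; apply: holomorphic_sum => s; apply: holomorphicM.
  exact: holomorphic_cst.
exact: holomorphic_prod.
Qed.

Lemma del_conj_holomorphic F k p : holomorphic U F -> U p ->
  del k (fun q => conjc (F q)) p = 0.
Proof. by move=> [sF hF] Up; rewrite (delJ _ sF Up) hF// conjc0. Qed.

Lemma holomorphic_del F k : holomorphic U F -> holomorphic U (del k F).
Proof.
move=> [sF hF]; split; first exact: csmooth_del.
move=> p Up l; rewrite -(delC _ _ sF Up).
by rewrite (@eq_del _ (fun=> 0)) ?del_cst// => q Uq; exact: hF.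
Qed.

End Wirtinger.

(** * The chain rule *)

Section RealCoordinates.
Variables (R : realType) (n : nat).
Implicit Types (v p : Cn R n) (i : 'I_n + 'I_n).

Definition real_basis i : Cn R n :=
  match i with inl k => dirRe R k | inr k => dirIm R k end.

Definition real_coord p i : R := match i with inl k => p.1 0 k | inr k => p.2 0 k end.

Lemma real_coord_decomp v : v = \sum_i real_coord v i *: real_basis i.
Proof.
case: v => v1 v2; rewrite big_sumType /=.
rewrite [v1 in LHS]row_sum_delta [v2 in LHS]row_sum_delta.
have -> : \sum_k v1 0 k *: dirRe R k = (\sum_k v1 0 k *: delta_mx 0 k, 0) :> Cn R n.
  elim/big_rec2: _ => // k x y _ ->.
  by congr (_, _); rewrite /= scaler0 add0r.
have -> : \sum_k v2 0 k *: dirIm R k = (0, \sum_k v2 0 k *: delta_mx 0 k) :> Cn R n.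
  elim/big_rec2: _ => // k x y _ ->.
  by congr (_, _); rewrite /= scaler0 add0r.
by congr (_, _); rewrite /= ?addr0 ?add0r.
Qed.

Lemma real_coord_scalar i : scalar (real_coord^~ i).
Proof. by case: i => k a u v; rewrite /= !mxE. Qed.

Lemma real_coord_continuous i : continuous (real_coord^~ i).
Proof.
case: i => k p.
  by apply: (@continuous_comp _ _ _ fst (fun x : 'rV[R]_n => x 0 k));
    [exact: cvg_fst|exact: coord_continuous].
by apply: (@continuous_comp _ _ _ snd (fun x : 'rV[R]_n => x 0 k));
  [exact: cvg_snd|exact: coord_continuous].
Qed.

Lemma real_coord_norm v i : `|real_coord v i| <= `|v|.
Proof.
have coord_norm (x : 'rV[R]_n) k : `|x 0 k| <= `|x|.
  by rewrite [leRHS]/Num.Def.normr /= mx_normrE (le_bigmax _ _ (0, k)).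
by rewrite [leRHS]prod_normE le_max; case: i => k; rewrite coord_norm ?orbT.
Qed.

Lemma cvg_real_coord (T : Type) (F : set_system T) (FF : Filter F)
    (f : T -> Cn R n) (l : Cn R n) :
  (forall i, (fun t => real_coord (f t) i) @ F --> real_coord l i) -> f @ F --> l.
Proof.
move=> fl; rewrite [l in _ --> l]real_coord_decomp.
under eq_cvg do rewrite [f _]real_coord_decomp.
by apply: cvg_big => [|i _]; [exact: add_continuous|exact: cvgZr_tmp].
Qed.

Lemma is_derive_real_coord (V : normedModType R) (phi : V -> Cn R n) (x v : V)
    (d : Cn R n) :
  (forall i, is_derive x v (fun y => real_coord (phi y) i) (real_coord d i)) ->
  is_derive x v phi d.
Proof.
move=> dphi.
suff cvg_d : (fun h : R => h^-1 *: ((phi \o shift x) (h *: v) - phi x)) @ 0^' --> d.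
  by split; [apply/cvg_ex; exists d|exact/cvg_lim].
apply: cvg_real_coord => i; have [dfi <-] := dphi i.
rewrite [X in X @ _](_ : _ = fun h : R => h^-1 *:
  (((fun y => real_coord (phi y) i) \o shift x) (h *: v) - real_coord (phi x) i)).
  exact: dfi.
by apply/funext => h; case: i {dphi dfi} => k; rewrite /= !mxE.
Qed.

Lemma smooth_differentiable (U : set (Cn R n)) (f : Cn R n -> R) x :
  open U -> smooth U f -> U x -> differentiable f x.
Proof.
move=> oU sf Ux.
pose Df v := \sum_i real_coord v i * 'D_(real_basis i) f x.
have Df_linear : scalar Df.
  move=> a u v; rewrite /Df mulr_sumr -big_split; apply: eq_bigr => i _ /=.
  by rewrite real_coord_scalar mulrDl mulrA.
pose Df_lin : {linear Cn R n -> R} :=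
  HB.pack Df (GRing.isLinear.Build R (Cn R n) R *%R Df Df_linear).
have Df_continuous : continuous Df_lin.
  move=> v; apply: cvg_big => [|i _]; first exact: add_continuous.
  by apply: cvgM; [exact: real_coord_continuous|exact: cvg_cst].
suff expansion : f \o shift x = cst (f x) + Df_lin +o_ 0 id.
  apply/diff_locallyP; rewrite (diff_unique Df_continuous expansion).
  by split; [exact: Df_continuous|exact: expansion].
apply/eqaddoP => e e0; pose N := #|{: 'I_n + 'I_n}|%:R + 1 : R.
have N0 : 0 < N by rewrite ltr_wpDl.
have approx : \forall s \near 0^'+, forall a : 'I_n + 'I_n -> R,
    (forall i, `|a i| <= s) ->
    `|f (x + \sum_i a i *: real_basis i) - f x -
      \sum_i a i * 'D_(real_basis i) f x| <= e / N * \sum_i `|a i|.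
  apply: partials_approximation; last exact: divr_gt0.
    by move=> i; apply: open_near oU Ux _ => y Uy; exact: smooth_derivable Uy.
  by move=> i; apply: smooth_continuous (smooth_derive _ sf) Ux.
have [s [s0 sP]] := filter_ex (filterI (nbhs_right_gt (0 : R)) approx).
near=> h; have hs : `|h| <= s.
  by apply: ltW; near: h; exact: (@nbhs0_lt _ (Cn R n)).
have := sP (real_coord h) (fun i => le_trans (real_coord_norm h i) hs).
rewrite -real_coord_decomp (addrC x) -addrA -opprD => /le_trans; apply.
rewrite -mulrA ler_pM2l// mulrC ler_pdivrMr// mulrC.
apply: (@le_trans _ _ (\sum_(i : 'I_n + 'I_n) `|h|)).
  by apply: ler_sum => i _; exact: real_coord_norm.
by rewrite sumr_const /N mulrDl mulr_natl mul1r lerDl.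
Unshelve. all: by end_near. Qed.

Lemma derive_real_coord (U : set (Cn R n)) (f : Cn R n -> R) v p :
  open U -> smooth U f -> U p ->
  'D_v f p = \sum_i real_coord v i * 'D_(real_basis i) f p.
Proof.
move=> oU sf Up; have df := smooth_differentiable oU sf Up.
rewrite deriveE// {1}[v]real_coord_decomp linear_sum; apply: eq_bigr => i _.
by rewrite linearZ -deriveE.
Qed.

Lemma smooth_dirZ (U : set (Cn R n)) (f : Cn R n -> R) p (c : R) v :
  open U -> smooth U f -> U p -> 'D_(c *: v) f p = c * 'D_v f p.
Proof.
move=> oU sf Up; have df := smooth_differentiable oU sf Up.
by rewrite !deriveE// linearZ.
Qed.

End RealCoordinates.

Section ComplexCoordinates.
Variables (R : realType) (n : nat).
Implicit Types (v p : Cn R n).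

Lemma csmooth_ccoord U k : csmooth U (fun p : Cn R n => ccoord p k).
Proof.
split; apply: smooth_linear.
- exact: real_coord_scalar (inl k).
- exact: real_coord_continuous (inl k).
- exact: real_coord_scalar (inr k).
- exact: real_coord_continuous (inr k).
Qed.

Lemma cderive_ccoord k v p : cderive (fun p => ccoord p k) v p = ccoord v k.
Proof.
rewrite /cderive /ccoord /=.
have [_ ->] := is_derive_scalar p v (@real_coord_scalar R n (inl k)).
by have [_ ->] := is_derive_scalar p v (@real_coord_scalar R n (inr k)).
Qed.

Lemma ccoord_dirRe (k l : 'I_n) : ccoord (dirRe R k) l = (k == l)%:R.
Proof. by rewrite /ccoord /dirRe /= !mxE eqxx /= eq_sym; case: eqP. Qed.

Lemma ccoord_dirIm (k l : 'I_n) : ccoord (dirIm R k) l = 'i * (k == l)%:R.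
Proof.
rewrite /ccoord /dirIm /= !mxE eqxx /= eq_sym.
by case: eqP => _; rewrite ?mulr1 ?mulr0.
Qed.

Lemma wirtinger_ccoord s k l p :
  wirtinger s k (fun p => ccoord p l) p = 2^-1 * (1 + s * 'i) * (k == l)%:R.
Proof.
by rewrite /wirtinger !cderive_ccoord ccoord_dirRe ccoord_dirIm; ring.
Qed.

Lemma del_ccoord k l p : del k (fun p => ccoord p l) p = (k == l)%:R.
Proof.
rewrite del_wirtinger wirtinger_ccoord mulNr -expr2 sqr_i opprK -natr1.
by rewrite mulVf ?mul1r// pnatr_eq0.
Qed.

Lemma delbar_ccoord k l p : delbar k (fun p => ccoord p l) p = 0.
Proof.
by rewrite delbar_wirtinger wirtinger_ccoord -expr2 sqr_i subrr mulr0 mul0r.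
Qed.

Lemma holomorphic_ccoord U (k : 'I_n) : holomorphic U (fun p : Cn R n => ccoord p k).
Proof. by split; [exact: csmooth_ccoord|move=> p _ l; exact: delbar_ccoord]. Qed.

Lemma cderive_real_coord (U : set (Cn R n)) (F : Cn R n -> R[i]) v p :
  open U -> csmooth U F -> U p ->
  cderive F v p = \sum_i (real_coord v i)%:C * cderive F (real_basis R i) p.
Proof.
move=> oU [sr si] Up.
rewrite {1}/cderive (derive_real_coord v oU sr Up) (derive_real_coord v oU si Up).
elim/big_rec3: _ => [//|i a b c _ <-]; rewrite /cderive.
by apply: complexP; rewrite /= mul0r ?subr0 ?addr0.
Qed.

Lemma cderive_del_delbar (U : set (Cn R n)) (F : Cn R n -> R[i]) v p :
  open U -> csmooth U F -> U p ->
  cderive F v p =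
  \sum_k (ccoord v k * del k F p + conjc (ccoord v k) * delbar k F p).
Proof.
move=> oU sF Up; rewrite (cderive_real_coord v oU sF Up).
rewrite big_sumType [LHS]/= -big_split; apply: eq_bigr => k _; rewrite /del /delbar.
move: (cderive F _ p) (cderive F _ p) => B A.
have -> : ccoord v k = (v.1 0 k)%:C + 'i * (v.2 0 k)%:C by exact: complexE.
rewrite conjcD conjcM conjci !conjc_real /=.
move: (v.1 0 k)%:C (v.2 0 k)%:C => x y.
have <- : x * A - 'i ^+ 2 * (y * B) = x * A + y * B.
  by rewrite sqr_i mulN1r opprK.
by field.
Qed.

End ComplexCoordinates.

Section SmoothMaps.
Variables (R : realType) (V : normedModType R) (m : nat).
Variables (U : set V) (W : set (Cn R m)) (phi : V -> Cn R m).
Implicit Types (x v : V).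

Definition csmooth_map := forall k, csmooth U (fun x => ccoord (phi x) k).

Definition map_derive v x : Cn R m :=
  (\row_k 'D_v (fun y => (phi y).1 0 k) x, \row_k 'D_v (fun y => (phi y).2 0 k) x).

Lemma real_coord_map_derive v x i :
  real_coord (map_derive v x) i = 'D_v (fun y => real_coord (phi y) i) x.
Proof. by case: i => k; rewrite /= mxE. Qed.

Lemma ccoord_map_derive v x k :
  ccoord (map_derive v x) k = cderive (fun y => ccoord (phi y) k) v x.
Proof. by rewrite /ccoord /map_derive /= !mxE. Qed.

Hypotheses (oU : open U) (oW : open W) (sphi : csmooth_map).
Hypothesis phiW : forall x, U x -> W (phi x).

Lemma smooth_real_coord_map i : smooth U (fun x => real_coord (phi x) i).
Proof. by case: i => k; have [] := sphi k. Qed.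

Lemma csmooth_map_continuous x : U x -> {for x, continuous phi}.
Proof.
move=> Ux; apply: cvg_real_coord => i.
exact: smooth_continuous (smooth_real_coord_map i) Ux.
Qed.

Lemma is_derive_map x v : U x -> is_derive x v phi (map_derive v x).
Proof.
move=> Ux; apply: is_derive_real_coord => i; rewrite real_coord_map_derive.
exact/derivableP/(smooth_derivable (smooth_real_coord_map i) Ux).
Qed.

Lemma is_derive_chain (f : Cn R m -> R) x v : smooth W f -> U x ->
  is_derive x v (fun y => f (phi y)) ('D_(map_derive v x) f (phi x)).
Proof.
move=> sf Ux; apply: is_derive_comp_diff; last exact: is_derive_map.
exact: smooth_differentiable (phiW Ux).
Qed.

Lemma Ck_sum k (I : Type) (r : seq I) (f : I -> V -> R) :
  (forall i, Ck k U (f i)) -> Ck k U (fun x => \sum_(i <- r) f i x).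
Proof.
move=> Cf; elim: r => [|i r IH].
  by under eq_fun do rewrite big_nil; exact: Ck_cst.
by under eq_fun do rewrite big_cons; exact: CkD.
Qed.

Lemma smooth_comp (f : Cn R m -> R) : smooth W f -> smooth U (fun x => f (phi x)).
Proof.
move=> sf k; elim: k f sf => [|k IH] f sf.
  split=> // x Ux; apply: (@continuous_comp _ _ _ phi f).
    exact: csmooth_map_continuous.
  exact: smooth_continuous sf (phiW Ux).
split=> [x Ux|v]; first exact: Ck_continuous (IH f sf) Ux.
split=> [x Ux|]; first by have [] := is_derive_chain v sf Ux.
apply: (eq_Ck (f := fun x => \sum_i
    'D_v (fun y => real_coord (phi y) i) x * 'D_(real_basis R i) f (phi x))) => //.
  move=> x Ux; have [_ ->] := is_derive_chain v sf Ux.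
  rewrite (derive_real_coord _ oW sf (phiW Ux)); apply: eq_bigr => i _.
  by rewrite real_coord_map_derive.
apply: Ck_sum => i; apply: CkM => //.
  exact: smooth_derive (smooth_real_coord_map i) _.
by apply: (IH (fun y => 'D_(real_basis R i) f y)); exact: smooth_derive.
Qed.

Lemma csmooth_comp (F : Cn R m -> R[i]) : csmooth W F ->
  csmooth U (fun x => F (phi x)).
Proof.
by move=> [sr si]; split; [exact: smooth_comp sr|exact: smooth_comp si].
Qed.

Lemma cderive_chain (F : Cn R m -> R[i]) v x : csmooth W F -> U x ->
  cderive (fun y => F (phi y)) v x =
  \sum_k (cderive (fun y => ccoord (phi y) k) v x * del k F (phi x) +
          conjc (cderive (fun y => ccoord (phi y) k) v x) * delbar k F (phi x)).
Proof.
move=> sF Ux; have [sr si] := sF.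
transitivity (cderive F (map_derive v x) (phi x)).
  rewrite /cderive; have [_ ->] := is_derive_chain v sr Ux.
  by have [_ ->] := is_derive_chain v si Ux.
rewrite (cderive_del_delbar _ oW sF (phiW Ux)).
by apply: eq_bigr => k _; rewrite ccoord_map_derive.
Qed.

End SmoothMaps.

Definition ctrmx (R : rcfType) m n (A : 'M[R[i]]_(m, n)) : 'M[R[i]]_(n, m) :=
  (map_mx conjc A)^T.

Lemma ddbarE (R : realType) n (F : Cn R n -> R[i]) p a b :
  ddbar F p a b = del a (delbar b F) p.
Proof. by rewrite mxE. Qed.

Section HolomorphicMaps.
Variables (R : realType) (n m : nat).
Variables (U : set (Cn R n)) (W : set (Cn R m)) (phi : Cn R n -> Cn R m).

Definition holo_map := forall k, holomorphic U (fun p => ccoord (phi p) k).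

Definition jac (p : Cn R n) : 'M[R[i]]_(n, m) :=
  \matrix_(a, k) del a (fun q => ccoord (phi q) k) p.

(* The differential acts on row vectors. *)
Definition pullback (G : Cn R m -> 'M[R[i]]_m) (p : Cn R n) : 'M[R[i]]_n :=
  jac p *m G (phi p) *m ctrmx (jac p).

Hypotheses (oU : open U) (oW : open W) (hphi : holo_map).
Hypothesis phiW : forall x, U x -> W (phi x).

Lemma holo_csmooth_map : csmooth_map U phi.
Proof. by move=> k; have [] := hphi k. Qed.

Lemma wirtinger_chain s (F : Cn R m -> R[i]) a p : csmooth W F -> U p ->
  wirtinger s a (fun q => F (phi q)) p =
  \sum_k (wirtinger s a (fun q => ccoord (phi q) k) p * del k F (phi p) +
          wirtinger s a (fun q => conjc (ccoord (phi q) k)) p * delbar k F (phi p)).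
Proof.
move=> sF Up; rewrite {1}/wirtinger !(cderive_chain oW holo_csmooth_map phiW _ sF Up).
rewrite mulr_sumr -big_split mulr_sumr; apply: eq_bigr => k _.
rewrite /wirtinger !(cderiveJ _ (holo_csmooth_map k) Up).
move: (cderive _ _ p) (cderive _ _ p) (del _ _ _) (delbar _ _ _) => x y d e.
by move: (conjc x) (conjc y) => xbar ybar /=; ring.
Qed.

Lemma del_chain (F : Cn R m -> R[i]) a p : csmooth W F -> U p ->
  del a (fun q => F (phi q)) p = \sum_k jac p a k * del k F (phi p).
Proof.
move=> sF Up; rewrite del_wirtinger wirtinger_chain//; apply: eq_bigr => k _.
rewrite (_ : wirtinger _ _ (fun q => conjc _) p = 0); last first.
  by rewrite -del_wirtinger; exact: del_conj_holomorphic (hphi k) Up.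
by rewrite mul0r addr0 -del_wirtinger mxE.
Qed.

Lemma delbar_chain (F : Cn R m -> R[i]) a p : csmooth W F -> U p ->
  delbar a (fun q => F (phi q)) p = \sum_k conjc (jac p a k) * delbar k F (phi p).
Proof.
move=> sF Up; rewrite delbar_wirtinger wirtinger_chain//; apply: eq_bigr => k _.
rewrite (_ : wirtinger _ _ (fun q => conjc _) p = conjc (jac p a k)); last first.
  by rewrite -delbar_wirtinger mxE; exact: delbarJ (holo_csmooth_map k) Up.
rewrite (_ : wirtinger _ _ _ p = 0) ?mul0r ?add0r//.
by rewrite -delbar_wirtinger; exact: (hphi k).2.
Qed.

Lemma holomorphic_comp (F : Cn R m -> R[i]) : holomorphic W F ->
  holomorphic U (fun p => F (phi p)).
Proof.
move=> [sF hF]; split; first exact: csmooth_comp holo_csmooth_map phiW _ sF.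
move=> p Up a; rewrite delbar_chain// big1// => k _.
by rewrite hF ?mulr0//; exact: phiW.
Qed.

Lemma holomorphic_jac a k : holomorphic U (fun p => jac p a k).
Proof.
apply: (eq_holomorphic oU (F := del a (fun q => ccoord (phi q) k))).
  by move=> p _; rewrite mxE.
exact: holomorphic_del.
Qed.

Lemma ddbar_pullback (F : Cn R m -> R[i]) p : csmooth W F -> U p ->
  ddbar (fun q => F (phi q)) p = pullback (ddbar F) p.
Proof.
move=> sF Up; apply/matrixP => a b; rewrite ddbarE.
have sJ k := csmoothJ oU (holomorphic_jac b k).1.
have sdF k : csmooth U (fun q => delbar k F (phi q)).
  exact: csmooth_comp oU oW holo_csmooth_map phiW _ (csmooth_delbar oW k sF).
rewrite (eq_del oU a Up (fun q => delbar_chain b sF)).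
rewrite (del_sum oU _ _ _ _ Up); last by move=> k; exact: csmoothM.
rewrite [RHS]mxE; apply: eq_bigr => k _.
rewrite (delM _ (sJ k) (sdF k) Up) (del_conj_holomorphic _ (holomorphic_jac b k) Up).
rewrite mul0r addr0.
rewrite (del_chain _ (csmooth_delbar oW k sF) Up) mulrC !mxE; congr (_ * _).
by apply: eq_bigr => l _; rewrite ddbarE.
Qed.

End HolomorphicMaps.

(** * The complex Hessian *)

Section ComplexHessian.
Variables (R : realType) (n : nat) (U : set (Cn R n)).
Hypothesis oU : open U.
Implicit Types (F G : Cn R n -> R[i]) (f g : Cn R n -> R) (p : Cn R n).

Lemma eq_ddbar F G p : U p -> (forall q, U q -> F q = G q) -> ddbar F p = ddbar G p.
Proof.
move=> Up FG; apply/matrixP => a b; rewrite [LHS]ddbarE [RHS]ddbarE.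
by apply: (eq_del oU a Up) => q Uq; exact: (eq_delbar oU b Uq FG).
Qed.

Lemma ddbarD F G p : csmooth U F -> csmooth U G -> U p ->
  ddbar (fun q => F q + G q) p = ddbar F p + ddbar G p.
Proof.
move=> sF sG Up; apply/matrixP => a b; rewrite [LHS]ddbarE [RHS]mxE.
rewrite [X in _ = X + _]ddbarE [X in _ = _ + X]ddbarE.
rewrite -(delD a (csmooth_delbar oU b sF) (csmooth_delbar oU b sG) Up).
by apply: (eq_del oU a Up) => q Uq; exact: delbarD sF sG Uq.
Qed.

Lemma ddbarZ (c : R[i]) F p : csmooth U F -> U p ->
  ddbar (fun q => c * F q) p = c *: ddbar F p.
Proof.
move=> sF Up; apply/matrixP => a b; rewrite [LHS]ddbarE [RHS]mxE.
rewrite [X in _ = _ * X]ddbarE -(delZ c a (csmooth_delbar oU b sF) Up).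
by apply: (eq_del oU a Up) => q Uq; exact: delbarZ sF Uq.
Qed.

Lemma eq_ddbarR f g p : U p -> (forall q, U q -> f q = g q) ->
  ddbarR f p = ddbarR g p.
Proof. by move=> Up fg; apply: eq_ddbar => // q /fg ->. Qed.

Lemma ddbarRD f g p : smooth U f -> smooth U g -> U p ->
  ddbarR (fun q => f q + g q) p = ddbarR f p + ddbarR g p.
Proof.
move=> sf sg Up; rewrite /ddbarR -(ddbarD (csmooth_real sf) (csmooth_real sg) Up).
by apply: eq_ddbar => // q Uq; rewrite rmorphD.
Qed.

Lemma ddbarRZ (c : R) f p : smooth U f -> U p ->
  ddbarR (fun q => c * f q) p = c%:C *: ddbarR f p.
Proof.
move=> sf Up; rewrite /ddbarR -(ddbarZ _ (csmooth_real sf) Up).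
by apply: eq_ddbar => // q Uq; rewrite rmorphM.
Qed.

Lemma ddbarRN f p : smooth U f -> U p -> ddbarR (fun q => - f q) p = - ddbarR f p.
Proof.
move=> sf Up; rewrite -scaleN1r -(rmorphN1 (real_complex R)) -(ddbarRZ _ sf Up).
by apply: eq_ddbarR => // q _; rewrite mulN1r.
Qed.

Lemma ddbarR_cst (c : R) p : ddbarR (fun=> c) p = 0.
Proof.
apply/matrixP => a b; rewrite [LHS]ddbarE [RHS]mxE.
rewrite (_ : delbar b _ = fun=> 0) ?del_cst//.
by apply/funext => q; exact: delbar_cst.
Qed.

Lemma ddbarR_hermitian f p : smooth U f -> U p -> ctrmx (ddbarR f p) = ddbarR f p.
Proof.
move=> sf Up; have sF := csmooth_real sf.
apply/matrixP => a b; rewrite [LHS]mxE mxE [X in conjc X]ddbarE [RHS]ddbarE.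
rewrite -(delbarJ _ (csmooth_delbar oU a sF) Up) (delC oU _ _ sF Up).
apply: (eq_delbar oU b Up) => q Uq; rewrite -(delJ _ sF Uq).
by apply: (eq_del oU a Uq) => r _; rewrite conjc_real.
Qed.

Lemma pullback_ddbarR m (W : set (Cn R m)) phi (c : R) f (g : Cn R m -> R) p :
  open W -> holo_map U phi -> (forall q, U q -> W (phi q)) ->
  smooth U f -> smooth W g -> U p -> (forall q, U q -> g (phi q) = c * f q) ->
  pullback phi (ddbarR g) p = c%:C *: ddbarR f p.
Proof.
move=> oW hphi phiW sf sg Up gf; rewrite -(ddbarRZ _ sf Up) -(eq_ddbarR Up gf).
exact/esym/(ddbar_pullback oU oW hphi phiW (csmooth_real sg) Up).
Qed.

Definition del_gradient f p : 'cV[R[i]]_n := \col_a del a (fun q => (f q)%:C) p.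

Lemma ddbarR_ln f p : (forall q, U q -> 0 < f q) -> smooth U f -> U p ->
  ddbarR (fun q => ln (f q)) p = (f p)%:C^-1 *: ddbarR f p -
    (f p)%:C^-1 ^+ 2 *: (del_gradient f p *m ctrmx (del_gradient f p)).
Proof.
move=> f0 sf Up; have sF := csmooth_real sf.
have F0 q : U q -> (f q)%:C != 0 by move=> /f0 fq; rewrite complexR_eq0 gt_eqF.
apply/matrixP => a b; rewrite !mxE big_ord1 !mxE.
rewrite (eq_del oU a Up (fun q => delbar_ln b f0 sf)).
rewrite (delM a (csmoothV oU F0 sF) (csmooth_delbar oU b sF) Up).
rewrite (delV oU a F0 sF Up) -(delbar_real oU b sf Up).
move: (del a _ p) (delbar b _ p) (del a _ p) => x y z.
by rewrite exprVn; ring.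
Qed.

Lemma ddbarR_ln_sqnorm F p : holomorphic U F -> (forall q, U q -> F q != 0) -> U p ->
  ddbarR (fun q => ln (complex.Re (F q * conjc (F q)))) p = 0.
Proof.
move=> hF F0 Up; have [sF _] := hF; have sFJ := csmoothJ oU sF.
have s2 : smooth U (fun q => complex.Re (F q * conjc (F q))).
  by have [] := csmoothM oU sF sFJ.
have gt0 q : U q -> 0 < complex.Re (F q * conjc (F q)).
  by move=> /F0; exact: Re_mulcJ_gt0.
have del2 a q : U q -> del a (fun r => (complex.Re (F r * conjc (F r)))%:C) q =
    del a F q * conjc (F q).
  move=> Uq; under eq_fun do rewrite Re_mulcJ.
  by rewrite (delM a sF sFJ Uq) (del_conj_holomorphic a hF Uq) mulr0 add0r.
have hdF b := holomorphic_del oU b hF.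
rewrite (ddbarR_ln gt0 s2 Up) Re_mulcJ; apply/matrixP => a b.
rewrite !mxE big_ord1 !mxE del2// del2//.
rewrite (eq_del oU a Up (G := fun q => conjc (del b F q) * F q)); last first.
  move=> q Uq; rewrite (delbar_real oU b s2 Uq) del2//.
  by rewrite conjcM conjcK.
rewrite (delM a (csmoothJ oU (hdF b).1) sF Up).
rewrite (del_conj_holomorphic a (hdF b) Up) mul0r addr0 (conjcM (del b F p)) conjcK.
have := F0 p Up; have : conjc (F p) != 0 by rewrite conjc_eq0 F0.
move: (conjc (F p)) (F p) (conjc _) (del a F p) => x y z w x0 y0.
by field; rewrite x0 y0.
Qed.

Lemma ddbarR_diag f a p : smooth U f -> U p ->
  ddbarR f p a a = (2^-1 * 2^-1 *
    ('D_(dirRe R a) (fun q => 'D_(dirRe R a) f q) p +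
     'D_(dirIm R a) (fun q => 'D_(dirIm R a) f q) p))%:C.
Proof.
move=> sf Up; have sF := csmooth_real sf.
have cderive2 u v : cderive (cderive (fun q => (f q)%:C) u) v p =
    ('D_v (fun q => 'D_u f q) p)%:C.
  rewrite -cderive_real; congr cderive; apply/funext => q; exact: cderive_real.
have hessian_sym (D : Cn R n -> Cn R n -> R[i]) x y : D x y = D y x ->
    2^-1 * (2^-1 * (D x x + 'i * D y x) + - 'i * (2^-1 * (D x y + 'i * D y y))) =
    2^-1 * 2^-1 * (D x x + D y y).
  move=> ->; rewrite [LHS](_ : _ = 2^-1 * 2^-1 * (D x x - 'i ^+ 2 * D y y)).
    by rewrite sqr_i mulN1r opprK.
  by ring.
rewrite [LHS]ddbarE del_wirtinger delbar_wirtinger.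
apply: etrans (wirtinger_wirtinger oU _ _ _ _ sF Up) _.
apply: etrans (hessian_sym (fun u v => cderive (cderive _ u) v p) _ _
  (cderive_schwarz oU _ _ sF Up)) _.
by rewrite 2!cderive2 2!rmorphM rmorphD fmorphV rmorph_nat.
Qed.

End ComplexHessian.

(** * Formal series of matrices and Hermitian forms *)

Lemma exchange_big_triangle (V : nmodType) (m : nat) (F : nat -> nat -> V) :
  \sum_(l < m.+1) \sum_(k < (m - l).+1) F l k =
  \sum_(k < m.+1) \sum_(l < (m - k).+1) F l k.
Proof.
have widen (G : nat -> nat -> V) : \sum_(l < m.+1) \sum_(k < (m - l).+1) G l k =
    \sum_(l < m.+1) \sum_(k < m.+1 | (l + k <= m)%N) G l k.
  apply: eq_bigr => l _; rewrite (big_ord_widen m.+1 (G l)) ?ltnS ?leq_subr//.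
  by apply: eq_bigl => k; rewrite ltnS leq_subRL// -ltnS ltn_ord.
rewrite widen (widen (fun k l => F l k)) (exchange_big_dep xpredT)//=.
by apply: eq_bigr => k _; apply: eq_bigl => l; rewrite addnC.
Qed.

Section SeriesPow.
Variables (K : fieldType) (n : nat).
Implicit Types (A B : nat -> 'M[K]_n).

Lemma series_powSr A p m : series_pow A p.+1 m =
  \sum_(l < m.+1) series_pow A p (m - l) *m A l.
Proof.
elim: p m => [|p IH] m.
  have sub_eq0 (l : 'I_m.+1) : ((m - l)%N == 0%N) = (l == ord_max).
    by rewrite subn_eq0 -val_eqE /= eqn_leq leq_ord.
  under [RHS]eq_bigr do rewrite /= sub_eq0.
  under [LHS]eq_bigr do rewrite /= sub_eq0.
  rewrite [LHS](bigD1 ord_max)//= [RHS](bigD1 ord_max)//= eqxx mulmx1 mul1mx.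
  by congr (_ + _); apply: eq_bigr => l /negbTE ->; rewrite mulmx0 mul0mx.
transitivity (\sum_(l < m.+1) \sum_(k < (m - l).+1)
    A l *m (series_pow A p (m - l - k) *m A k)).
  by apply: eq_bigr => l _; rewrite -mulmx_sumr -IH.
rewrite (exchange_big_triangle m
  (fun l k => A l *m (series_pow A p (m - l - k) *m A k))).
apply: eq_bigr => k _; rewrite [series_pow _ _ _]/= mulmx_suml.
by apply: eq_bigr => l _; rewrite -mulmxA subnAC.
Qed.

Lemma series_pow_conj (c : K) (Q : 'M[K]_n) A B p m : Q \in unitmx ->
  (forall l, (l <= m)%N -> A l = c ^+ l *: (invmx Q *m B l *m Q)) ->
  series_pow A p m = c ^+ m *: (invmx Q *m series_pow B p m *m Q).
Proof.
move=> uQ; elim: p m => [|p IH] m AB /=.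
  case: eqP => [->|_]; first by rewrite expr0 scale1r mulmx1 mulVmx.
  by rewrite mulmx0 mul0mx scaler0.
rewrite mulmx_sumr mulmx_suml scaler_sumr; apply: eq_bigr => l _.
rewrite AB -1?ltnS// IH; last by move=> k km; apply/AB/(leq_trans km)/leq_subr.
rewrite -scalemxAl -scalemxAr scalerA -exprD subnKC -1?ltnS//.
by congr (_ *: _); rewrite !mulmxA mulmxK.
Qed.

Lemma trlog_comp_conj (c : K) (Q : 'M[K]_n) A B m : Q \in unitmx ->
  (forall l, (l <= m)%N -> A l = c ^+ l *: (invmx Q *m B l *m Q)) ->
  trlog_comp A m = c ^+ m * trlog_comp B m.
Proof.
move=> uQ AB; rewrite /trlog_comp mulr_sumr; apply: eq_bigr => p _.
rewrite (series_pow_conj p uQ AB) mxtraceZ mxtrace_mulC mulmxA mulmxV//.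
by rewrite mul1mx mulrCA.
Qed.

Lemma eq_trlog_comp A B m : (forall l, (l <= m)%N -> A l = B l) ->
  trlog_comp A m = trlog_comp B m.
Proof.
move=> AB; rewrite -[RHS]mul1r -[in RHS](expr1n _ m).
apply: (trlog_comp_conj (unitmx1 _ _)) => l /AB ->.
by rewrite expr1n scale1r invmx1 mul1mx mulmx1.
Qed.

End SeriesPow.

Section Hermitian.
Variables (R : rcfType).
Implicit Types m n k : nat.

Lemma ctrmxM m n k (A : 'M[R[i]]_(m, n)) (B : 'M[R[i]]_(n, k)) :
  ctrmx (A *m B) = ctrmx B *m ctrmx A.
Proof. by rewrite /ctrmx map_mxM trmx_mul. Qed.

Lemma ctrmxN m n (A : 'M[R[i]]_(m, n)) : ctrmx (- A) = - ctrmx A.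
Proof. by rewrite /ctrmx map_mxN linearN. Qed.

Lemma ctrmx0 m n : ctrmx (0 : 'M[R[i]]_(m, n)) = 0.
Proof. by rewrite /ctrmx map_mx0 trmx0. Qed.

Lemma ctrmx_sum m n (I : Type) (r : seq I) (P : pred I) (F : I -> 'M[R[i]]_(m, n)) :
  ctrmx (\sum_(i <- r | P i) F i) = \sum_(i <- r | P i) ctrmx (F i).
Proof. by rewrite /ctrmx map_mx_sum linear_sum. Qed.

Lemma ctrmx_inv n (A : 'M[R[i]]_n) : ctrmx (invmx A) = invmx (ctrmx A).
Proof. by rewrite /ctrmx map_invmx trmx_inv. Qed.

Lemma unitmx_ctrmx n (A : 'M[R[i]]_n) : (ctrmx A \in unitmx) = (A \in unitmx).
Proof. by rewrite /ctrmx unitmx_tr map_unitmx. Qed.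

Lemma ctrmx_series_pow n (A : nat -> 'M[R[i]]_n) p m :
  ctrmx (series_pow A p m) = series_pow (fun l => ctrmx (A l)) p m.
Proof.
elim: p m => [|p IH] m.
  by rewrite /=; case: eqP => _; rewrite ?ctrmx0// /ctrmx map_mx1 trmx1.
by rewrite series_powSr ctrmx_sum; apply: eq_bigr => l _; rewrite ctrmxM IH.
Qed.

Lemma conjc_trlog_comp n (A : nat -> 'M[R[i]]_n) m :
  conjc (trlog_comp A m) = trlog_comp (fun l => ctrmx (A l)) m.
Proof.
rewrite /trlog_comp rmorph_sum; apply: eq_bigr => p _.
rewrite -ctrmx_series_pow /ctrmx mxtrace_tr trace_map_mx rmorphM; congr (_ * _).
by rewrite rmorphM fmorphV rmorph_nat rmorphXn rmorphN1.
Qed.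

(* The A_l are self-adjoint for the form G, hence conjugate to their adjoints. *)
Lemma trlog_comp_real n (G : 'M[R[i]]_n) (H : nat -> 'M[R[i]]_n) m :
  G \in unitmx -> ctrmx G = G -> (forall l, (l <= m)%N -> ctrmx (H l) = H l) ->
  conjc (trlog_comp (fun l => invmx G *m H l) m) =
  trlog_comp (fun l => invmx G *m H l) m.
Proof.
move=> uG hG hH; rewrite conjc_trlog_comp -[LHS]mul1r -[in LHS](expr1n _ m).
apply/esym/(trlog_comp_conj uG) => l lm.
by rewrite expr1n scale1r ctrmxM ctrmx_inv hG hH// -!mulmxA mulVmx// mulmx1.
Qed.

Definition herm_form n (G : 'M[R[i]]_n) (v : 'rV[R[i]]_n) : R[i] :=
  (v *m G *m ctrmx v) 0 0.

Lemma herm_formE n (G : 'M[R[i]]_n) v :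
  herm_form G v = \sum_a \sum_b G a b * v 0 a * conjc (v 0 b).
Proof.
rewrite /herm_form [LHS]mxE exchange_big; apply: eq_bigr => b _.
rewrite !mxE mulr_suml; apply: eq_bigr => a _.
by rewrite (mulrC (G a b)).
Qed.

Lemma herm_formD n (G H : 'M[R[i]]_n) v :
  herm_form (G + H) v = herm_form G v + herm_form H v.
Proof. by rewrite /herm_form mulmxDr mulmxDl mxE. Qed.

Lemma herm_formZ n (a : R[i]) (G : 'M[R[i]]_n) v :
  herm_form (a *: G) v = a * herm_form G v.
Proof. by rewrite /herm_form -scalemxAr -scalemxAl mxE. Qed.

Lemma herm_form_congruence n m (J : 'M[R[i]]_(n, m)) (H : 'M[R[i]]_m) v :
  herm_form (J *m H *m ctrmx J) v = herm_form H (v *m J).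
Proof. by rewrite /herm_form ctrmxM !mulmxA. Qed.

Lemma herm_form_rank1 n (L : 'cV[R[i]]_n) v :
  herm_form (L *m ctrmx L) v = (v *m L) 0 0 * conjc ((v *m L) 0 0).
Proof.
rewrite /herm_form mulmxA -mulmxA -ctrmxM [LHS]mxE big_ord1; congr (_ * _).
by rewrite !mxE.
Qed.

Definition posdef n (G : 'M[R[i]]_n) :=
  forall v : 'rV[R[i]]_n, v != 0 -> 0 < herm_form G v.

Lemma posdef_det_gt0 n (G : 'M[R[i]]_n) : ctrmx G = G -> posdef G -> 0 < \det G.
Proof.
move=> hG pG.
have nG : G \is normalmx.
  apply: hermitian_normalmx; apply/is_hermitianmxP.
  by rewrite expr0 scale1r -{1}hG /ctrmx map_trmx.
have /orthomx_spectralP := nG.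
set P := spectralmx G; set D := spectral_diag G => GE.
have uP : P \in unitmx by exact: spectral_unit.
have unitaryP : P *m ctrmx P = 1%:M.
  by have /unitarymxP := spectral_unitarymx G; rewrite -map_trmx.
have invP : invmx P = ctrmx P.
  by rewrite -[LHS]mulmx1 -unitaryP mulmxA mulVmx// mul1mx.
have -> : \det G = \prod_i D 0 i.
  by rewrite GE !det_mulmx mulrAC -det_mulmx mulVmx// det1 mul1r det_diag.
apply: prodr_gt0 => i _.
have -> : D 0 i = herm_form G (row i P).
  transitivity ((P *m G *m ctrmx P) i i).
    by rewrite GE -invP !mulmxA mulmxV// mul1mx mulmxK// mxE eqxx mulr1n.
  rewrite /herm_form -row_mul mxE [RHS]mxE; apply: eq_bigr => k _.
  by rewrite !mxE.
apply: pG; apply/negP => /eqP rowP0; have := congr1 (row i) unitaryP.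
rewrite row_mul rowP0 mul0mx => /rowP/(_ i); rewrite !mxE eqxx => /eqP.
by rewrite eq_sym oner_eq0.
Qed.

End Hermitian.

Section MatrixSmooth.
Variables (R : realType) (V : normedModType R) (U : set V).
Hypothesis oU : open U.

Definition msmooth m n (M : V -> 'M[R[i]]_(m, n)) :=
  forall a b, csmooth U (fun q => M q a b).

Lemma eq_msmooth m n (M N : V -> 'M[R[i]]_(m, n)) :
  (forall q, U q -> M q = N q) -> msmooth M -> msmooth N.
Proof. by move=> MN sM a b; apply: eq_csmooth (sM a b) => // q Uq; rewrite MN. Qed.

Lemma msmooth_cst m n (M : 'M[R[i]]_(m, n)) : msmooth (fun=> M).
Proof. by move=> a b; exact: csmooth_cst. Qed.

Lemma msmoothM m n p (M : V -> 'M[R[i]]_(m, n)) (N : V -> 'M[R[i]]_(n, p)) :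
  msmooth M -> msmooth N -> msmooth (fun q => M q *m N q).
Proof.
move=> sM sN a b; under eq_fun do rewrite mxE.
by apply: csmooth_sum => // k; exact: csmoothM.
Qed.

Lemma msmoothN m n (M : V -> 'M[R[i]]_(m, n)) :
  msmooth M -> msmooth (fun q => - M q).
Proof. by move=> sM a b; under eq_fun do rewrite mxE; exact: csmoothN. Qed.

Lemma msmooth_sum m n (I : Type) (r : seq I) (P : pred I)
    (M : I -> V -> 'M[R[i]]_(m, n)) :
  (forall i, msmooth (M i)) -> msmooth (fun q => \sum_(i <- r | P i) M i q).
Proof.
move=> sM a b; under eq_fun do rewrite summxE.
by apply: csmooth_sum => // k; exact: sM.
Qed.

Lemma csmooth_det n (M : V -> 'M[R[i]]_n) : msmooth M -> csmooth U (fun q => \det (M q)).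
Proof.
move=> sM; apply: csmooth_sum => // s; apply: csmoothM => //.
  exact: csmooth_cst.
by apply: csmooth_prod => // i; exact: sM.
Qed.

Lemma csmooth_tr n (M : V -> 'M[R[i]]_n) : msmooth M -> csmooth U (fun q => \tr (M q)).
Proof. by move=> sM; apply: csmooth_sum => // i; exact: sM. Qed.

Lemma msmooth_inv n (M : V -> 'M[R[i]]_n) :
  (forall q, U q -> \det (M q) != 0) -> msmooth M -> msmooth (fun q => invmx (M q)).
Proof.
move=> M0 sM.
apply: (@eq_msmooth _ _ (fun q => (\det (M q))^-1 *: \adj (M q))).
  by move=> q /M0 Mq; rewrite /invmx unitmxE unitfE Mq.
move=> a b; under eq_fun do rewrite mxE.
apply: csmoothM => //; first by apply: csmoothV => //; exact: csmooth_det.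
under eq_fun do rewrite mxE /cofactor.
apply: csmoothM => //; first exact: csmooth_cst.
by apply: csmooth_det => i j; under eq_fun do rewrite !mxE; exact: sM.
Qed.

Lemma msmooth_series_pow n (A : V -> nat -> 'M[R[i]]_n) p m :
  (forall l, (l <= m)%N -> msmooth (fun q => A q l)) ->
  msmooth (fun q => series_pow (A q) p m).
Proof.
elim: p m => [|p IH] m sA /=; first exact: msmooth_cst.
apply: msmooth_sum => l; apply: msmoothM; first by apply: sA; rewrite -ltnS.
by apply: IH => k km; apply: sA; apply: leq_trans km (leq_subr _ _).
Qed.

Lemma csmooth_trlog n (A : V -> nat -> 'M[R[i]]_n) m :
  (forall l, (l <= m)%N -> msmooth (fun q => A q l)) ->
  csmooth U (fun q => trlog_comp (A q) m).
Proof.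
move=> sA; apply: csmooth_sum => // p; apply: csmoothM => //.
  exact: csmooth_cst.
by apply: csmooth_tr; exact: msmooth_series_pow.
Qed.

End MatrixSmooth.

(** * Naturality of the expansion of the Ricci form *)

Section MetricPotential.
Variables (R : realType) (n : nat) (U : set (Cn R n)).
Hypothesis oU : open U.
Implicit Types (f : Cn R n -> R) (u : nat -> Cn R n -> R) (p : Cn R n).

Definition metric_potential f :=
  smooth U f /\ forall p, U p -> 0 < \det (ddbarR f p).

Definition logdet f q := ln (complex.Re (\det (ddbarR f q))).

Lemma ric_logdet f p : ric (ddbarR f) p = - ddbarR (logdet f) p.
Proof. by []. Qed.

Lemma metric_potential_unit f p : metric_potential f -> U p -> ddbarR f p \in unitmx.
Proof. by move=> [_ det0] Up; rewrite unitmxE unitfE gt_eqF// det0. Qed.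

Lemma Re_det_gt0 f p : metric_potential f -> U p -> 0 < complex.Re (\det (ddbarR f p)).
Proof. by move=> [_ det0] /det0; rewrite ltcE => /andP[]. Qed.

Lemma msmooth_ddbarR f : smooth U f -> msmooth U (ddbarR f).
Proof.
move=> sf a b; apply: (eq_csmooth oU (F := del a (delbar b (fun q => (f q)%:C)))).
  by move=> q _; rewrite mxE.
by apply: csmooth_del => //; apply: csmooth_delbar => //; exact: csmooth_real.
Qed.

Lemma smooth_logdet f : metric_potential f -> smooth U (logdet f).
Proof.
move=> mf; apply: smooth_ln => //; first by move=> q; exact: Re_det_gt0.
by have [] := csmooth_det oU (msmooth_ddbarR mf.1).
Qed.

Lemma msmooth_ric f : metric_potential f -> msmooth U (ric (ddbarR f)).
Proof.
move=> mf; apply: (eq_msmooth oU (fun q _ => esym (ric_logdet f q))).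
by apply: msmoothN => //; apply: msmooth_ddbarR; exact: smooth_logdet.
Qed.

Lemma ric_hermitian f p : metric_potential f -> U p ->
  ctrmx (ric (ddbarR f) p) = ric (ddbarR f) p.
Proof.
move=> mf Up; rewrite ric_logdet ctrmxN.
by rewrite (ddbarR_hermitian oU (smooth_logdet mf) Up).
Qed.

(* Weight m part of - Ric(omega_0) + i del delbar u, as a form of weight m - 2. *)
Definition pert_form f u p m : 'M[R[i]]_n :=
  match m with
  | 0%N | 1%N => 0
  | 2%N => - ric (ddbarR f) p
  | k.+3 => ddbarR (u k.+1) p
  end.

Lemma pert_compE f u p m :
  pert_comp f u p m = invmx (ddbarR f p) *m pert_form f u p m.
Proof. by case: m => [|[|[|k]]]; rewrite /= ?mulmx0 ?mulmxN. Qed.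

(* The weight m part of Tr log only involves the u_(l) with l + 2 <= m. *)
Definition smooth_below m u :=
  forall l, (0 < l)%N -> (l + 2 <= m)%N -> smooth U (u l).

Lemma smooth_below_le k m u : (k <= m)%N -> smooth_below m u -> smooth_below k u.
Proof. by move=> km su l l0 lk; apply: su => //; exact: leq_trans lk km. Qed.

Lemma msmooth_pert_comp f u m : metric_potential f -> smooth_below m u ->
  msmooth U (fun q => pert_comp f u q m).
Proof.
move=> mf su; apply: (eq_msmooth oU (fun q _ => esym (pert_compE f u q m))).
apply: msmoothM => //.
  by apply: msmooth_inv (msmooth_ddbarR mf.1) => // q Uq; rewrite gt_eqF// mf.2.
case: m su => [|[|[|k]]] su /=; try exact: msmooth_cst.
  by apply: msmoothN => //; exact: msmooth_ric.
by apply: msmooth_ddbarR; apply: su => //; rewrite addn2.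
Qed.

Lemma csmooth_trlog_pert f u m : metric_potential f -> smooth_below m u ->
  csmooth U (fun q => trlog_comp (pert_comp f u q) m).
Proof.
move=> mf su; apply: csmooth_trlog => // l lm.
exact: msmooth_pert_comp mf (smooth_below_le lm su).
Qed.

Lemma trlog_pert_real f u m p : metric_potential f -> smooth_below m u -> U p ->
  (complex.Re (trlog_comp (pert_comp f u p) m))%:C = trlog_comp (pert_comp f u p) m.
Proof.
move=> mf su Up; apply: RRe_real; apply/CrealP.
rewrite (eq_trlog_comp (fun l _ => pert_compE f u p l)).
apply: trlog_comp_real; first exact: metric_potential_unit.
  exact: ddbarR_hermitian mf.1 Up.
case=> [|[|[|k]]] km; rewrite /= ?ctrmx0//.
  by rewrite ctrmxN ric_hermitian.
by apply: (ddbarR_hermitian oU _ Up); apply: su => //; rewrite addn2.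
Qed.

Lemma eq_trlog_pert f u v p k :
  (forall l, (0 < l)%N -> (l + 2 <= k)%N -> ddbarR (u l) p = ddbarR (v l) p) ->
  trlog_comp (pert_comp f u p) k = trlog_comp (pert_comp f v p) k.
Proof.
move=> uv; apply: eq_trlog_comp => l lk.
have formE : pert_form f u p l = pert_form f v p l.
  by case: l lk => [//|[//|[//|l]]] lk; apply: uv; rewrite ?addn2.
apply: etrans (pert_compE f u p l) _; rewrite formE.
exact/esym/pert_compE.
Qed.

End MetricPotential.

Lemma metric_potential_sub (R : realType) n (U W : set (Cn R n)) f :
  W `<=` U -> metric_potential U f -> metric_potential W f.
Proof.
by move=> WU [sf df]; split; [exact: smooth_sub sf|move=> p /WU; exact: df].
Qed.

Lemma invmx_mul_congruence (K : fieldType) n (G G' H H' J Q : 'M[K]_n) (s t : K) :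
  s != 0 -> G' \in unitmx -> Q \in unitmx ->
  J *m G *m Q = s^-1 *: G' -> J *m H *m Q = t *: H' ->
  invmx G *m H = (s * t) *: (Q *m (invmx G' *m H') *m invmx Q).
Proof.
move=> s0 uG' uQ GE HE; pose A := s *: (Q *m invmx G' *m J).
have AG : A *m G = 1%:M.
  apply: (can_inj (mulmxK uQ)); rewrite mul1mx -!scalemxAl -!mulmxA (mulmxA J) GE.
  by rewrite -!scalemxAr scalerA mulfV// scale1r mulVmx// mulmx1.
have -> : invmx G = A.
  by rewrite -[LHS]mul1mx -AG mulmxK// (mulmx1_unit AG).2.
apply: (can_inj (mulmxK uQ)); rewrite /A -!scalemxAl mulmxKV// -!mulmxA.
by rewrite (mulmxA J) HE -!scalemxAr scalerA.
Qed.

Section Naturality.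
Variables (R : realType) (n : nat) (U W : set (Cn R n)) (phi : Cn R n -> Cn R n).
Hypotheses (oU : open U) (oW : open W) (hphi : holo_map U phi).
Hypothesis phiW : forall q, U q -> W (phi q).
Variables (c : R) (f g : Cn R n -> R).
Hypotheses (c0 : 0 < c) (mf : metric_potential U f) (mg : metric_potential W g).
Hypothesis gf : forall q, U q -> g (phi q) = (c ^+ 2)^-1 * f q.

Lemma pullback_metric p : U p ->
  pullback phi (ddbarR g) p = (c ^+ 2)^-1%:C *: ddbarR f p.
Proof. by move=> Up; exact: pullback_ddbarR mf.1 mg.1 Up gf. Qed.

Lemma det_pullback (G : Cn R n -> 'M[R[i]]_n) p : \det (pullback phi G p) =
  \det (jac phi p) * conjc (\det (jac phi p)) * \det (G (phi p)).
Proof. by rewrite !det_mulmx /ctrmx det_tr det_map_mx mulrAC. Qed.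

Lemma jac_unit q : U q -> jac phi q \in unitmx.
Proof.
move=> Uq; rewrite unitmxE unitfE; apply/negP => /eqP J0.
have : (c ^+ 2)^-1%:C ^+ n * \det (ddbarR f q) != 0.
  rewrite mulf_neq0 ?expf_neq0 ?complexR_eq0 ?invr_eq0 ?expf_neq0 ?gt_eqF//.
  exact: mf.2.
by rewrite -detZ -(pullback_metric Uq) det_pullback J0 !mul0r eqxx.
Qed.

Lemma logdet_pullback q : U q ->
  ln ((c ^+ 2)^-1 ^+ n) + logdet f q =
  ln (complex.Re (\det (jac phi q) * conjc (\det (jac phi q)))) + logdet g (phi q).
Proof.
move=> Uq; have := jac_unit Uq; rewrite unitmxE unitfE => /Re_mulcJ_gt0 J0.
have cn0 : 0 < (c ^+ 2)^-1 ^+ n by rewrite exprn_gt0// invr_gt0 exprn_gt0.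
have f0 := Re_det_gt0 mf Uq; have g0 := Re_det_gt0 mg (phiW Uq).
apply: etrans (esym (lnM cn0 f0)) _; apply: etrans _ (lnM J0 g0).
apply: (congr1 (@ln R)); set N := \det (jac phi q) * _.
have : ((c ^+ 2)^-1 ^+ n)%:C * \det (ddbarR f q) =
       (complex.Re N)%:C * \det (ddbarR g (phi q)).
  by rewrite rmorphXn Re_mulcJ -det_pullback (pullback_metric Uq) detZ.
move=> /(congr1 (@complex.Re R)) ReE.
exact: etrans (esym (ReRM _ _)) (etrans ReE (ReRM _ _)).
Qed.

Lemma pullback_ric p : U p -> pullback phi (ric (ddbarR g)) p = ric (ddbarR f) p.
Proof.
move=> Up.
have d0 q : U q -> \det (jac phi q) != 0.
  by move=> /jac_unit; rewrite unitmxE unitfE.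
have hdet : holomorphic U (fun q => \det (jac phi q)).
  by apply: (holomorphic_det oU) => a k; exact: (holomorphic_jac oU hphi).
have sJ : smooth U (fun q => complex.Re (\det (jac phi q) * conjc (\det (jac phi q)))).
  by have [] := csmoothM oU hdet.1 (csmoothJ oU hdet.1).
have slnJ := smooth_ln oU (fun q Uq => Re_mulcJ_gt0 (d0 q Uq)) sJ.
have sg : smooth U (fun q => logdet g (phi q)).
  exact: smooth_comp oU oW (holo_csmooth_map hphi) phiW _ (smooth_logdet oW mg).
have slf := smooth_logdet oU mf.
have logdetE : ddbarR (fun q => logdet g (phi q)) p = ddbarR (logdet f) p.
  apply: (addrI 0); rewrite -[X in X + _ = _](ddbarR_ln_sqnorm oU hdet d0 Up).
  apply: etrans (esym (ddbarRD oU slnJ sg Up)) _.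
  apply: etrans (esym (eq_ddbarR oU Up (fun q => @logdet_pullback q))) _.
  apply: etrans (ddbarRD oU (smooth_cst U _) slf Up) _.
  by rewrite ddbarR_cst.
have pullE : pullback phi (ddbarR (logdet g)) p = ddbarR (logdet f) p.
  rewrite -logdetE -[RHS]scale1r.
  exact: pullback_ddbarR sg (smooth_logdet oW mg) Up (fun q _ => esym (mul1r _)).
by apply: etrans _ (congr1 -%R pullE); rewrite /pullback -mulNmx -mulmxN.
Qed.

Lemma pullback_pert_form (u v : nat -> Cn R n -> R) m p : U p ->
  smooth_below U m u -> smooth_below W m v ->
  (forall l q, (0 < l)%N -> (l + 2 <= m)%N -> U q -> v l (phi q) = c ^+ l * u l q) ->
  pullback phi (fun q => pert_form g v q m) p =
  (c ^+ (m - 2))%:C *: pert_form f u p m.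
Proof.
move=> Up; case: m => [|[|[|k]]] su sv vu.
- by rewrite /pullback mulmx0 mul0mx scaler0.
- by rewrite /pullback mulmx0 mul0mx scaler0.
- rewrite expr0 scale1r; apply: etrans _ (congr1 -%R (pullback_ric Up)).
  by rewrite /pullback -mulNmx -mulmxN.
have k2 : (k.+1 + 2 <= k.+3)%N by rewrite addn2.
rewrite subSS subSS subn0.
exact: pullback_ddbarR (su _ _ k2) (sv _ _ k2) Up (fun q => vu k.+1 q isT k2).
Qed.

Lemma trlog_pert_natural (u v : nat -> Cn R n -> R) m p : U p ->
  smooth_below U m u -> smooth_below W m v ->
  (forall l q, (0 < l)%N -> (l + 2 <= m)%N -> U q -> v l (phi q) = c ^+ l * u l q) ->
  trlog_comp (pert_comp g v (phi p)) m =
  (c ^+ m)%:C * trlog_comp (pert_comp f u p) m.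
Proof.
move=> Up su sv vu; rewrite rmorphXn; set J := jac phi p.
have uQ : ctrmx J \in unitmx by rewrite unitmx_ctrmx; exact: jac_unit.
have uP : invmx (ctrmx J) \in unitmx by rewrite unitmx_inv.
have c2C : (c ^+ 2)%:C != 0 by rewrite complexR_eq0 expf_neq0// gt_eqF.
have metricE := pullback_metric Up; rewrite fmorphV in metricE.
apply: (trlog_comp_conj uP) => l lm; rewrite invmxK.
have formE := pullback_pert_form Up (smooth_below_le lm su) (smooth_below_le lm sv)
  (fun k q k0 kl => vu k q k0 (leq_trans kl lm)).
apply: etrans (pert_compE g v (phi p) l) _.
apply: etrans (invmx_mul_congruence (H := pert_form g v (phi p) l) c2C
  (metric_potential_unit mf Up) uQ metricE formE) _.
rewrite -(pert_compE f u p l) -rmorphM -exprD.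
case: l {lm formE} => [|[|l]]; rewrite ?mulmx0 ?mul0mx ?scaler0//.
by rewrite subSS subSS subn0 rmorphXn.
Qed.

End Naturality.

(** * Fiberwise dilations and weights *)

Section SplitCoordinates.
Variables (R : realType) (d : nat).
Implicit Types (p : Cn R (d + 1)) (w : Cn R d) (z : R[i]).

Definition wz_point w z : Cn R (d + 1) :=
  (row_mx w.1 (complex.Re z)%:M, row_mx w.2 (complex.Im z)%:M).

Lemma wpart_wz w z : wpart (wz_point w z) = w.
Proof. by rewrite /wpart /wz_point /= !row_mxKl; case: w. Qed.

Lemma zpart_wz w z : zpart (wz_point w z) = z.
Proof.
by rewrite /zpart /ccoord /wz_point /= !row_mxEr !mxE !eqxx !mulr1n; case: z.
Qed.

Lemma wz_pointK p : wz_point (wpart p) (zpart p) = p.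
Proof.
have row_mxK (x : 'rV[R]_(d + 1)) : row_mx (lsubmx x) (x 0 (rshift d ord0))%:M = x.
  rewrite -[RHS]hsubmxK; congr row_mx; apply/rowP => k.
  by rewrite !mxE !ord1 eqxx mulr1n.
by case: p => x y; rewrite /wz_point /wpart /zpart /ccoord /= !row_mxK.
Qed.

Lemma ccoord_wzl w z k : ccoord (wz_point w z) (lshift 1 k) = ccoord w k.
Proof. by rewrite /ccoord /wz_point /= !row_mxEl. Qed.

Lemma ccoord_wzr w z : ccoord (wz_point w z) (rshift d ord0) = z.
Proof. exact: zpart_wz. Qed.

Lemma ccoord_wpart p k : ccoord (wpart p) k = ccoord p (lshift 1 k).
Proof. by rewrite -[in RHS](wz_pointK p) ccoord_wzl. Qed.

Lemma wz_pointD w w' z z' : wz_point w z + wz_point w' z' = wz_point (w + w') (z + z').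
Proof.
by rewrite /wz_point; congr (_, _); rewrite /= add_row_mx ?ReD ?ImD raddfD.
Qed.

Lemma wz_pointZ (s : R) w z : s *: wz_point w z = wz_point (s *: w) (s%:C * z).
Proof.
by rewrite /wz_point; congr (_, _); rewrite /= scale_row_mx scale_scalar_mx ?ReRM ?ImRM.
Qed.

Lemma holo_map_wpart U : holo_map U (@wpart R d).
Proof.
move=> k; under eq_fun do rewrite ccoord_wpart.
exact: holomorphic_ccoord.
Qed.

Lemma jac_wpart p : jac (@wpart R d) p = col_mx 1%:M 0.
Proof.
apply/matrixP => a k; rewrite mxE.
under eq_fun do rewrite ccoord_wpart.
rewrite del_ccoord; case: (split_ordP a) => b ->.
  by rewrite col_mxEu mxE (inj_eq (@lshift_inj _ _)).
by rewrite col_mxEd mxE eq_rlshift.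
Qed.

Lemma mul_jac_wpart (v : 'rV[R[i]]_(d + 1)) p : v *m jac (@wpart R d) p = lsubmx v.
Proof. by rewrite jac_wpart -{1}[v]hsubmxK mul_row_col mulmx1 mulmx0 addr0. Qed.

Lemma open_preimage_wpart B : open B -> open (@wpart R d @^-1` B).
Proof.
move=> oB; apply: open_comp => // p _.
exact: (csmooth_map_continuous (holo_csmooth_map (@holo_map_wpart setT)) I).
Qed.

Definition fiber_sqnorm p : R := complex.Re (zpart p * conjc (zpart p)).

Lemma fiber_sqnorm_gt0 p : zpart p != 0 -> 0 < fiber_sqnorm p.
Proof. exact: Re_mulcJ_gt0. Qed.

Lemma smooth_fiber_sqnorm U : open U -> smooth U fiber_sqnorm.
Proof.
move=> oU; have sz := @csmooth_ccoord R (d + 1) U (rshift d ord0).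
by have [] := csmoothM oU sz (csmoothJ oU sz).
Qed.

Lemma zpart_neq0_open : open [set p | @zpart R d p != 0].
Proof.
rewrite (_ : [set p | _] = fiber_sqnorm @^-1` [set x | 0 < x]).
  apply: open_comp; last exact: open_gt.
  by move=> p _; exact: smooth_continuous (smooth_fiber_sqnorm (@openT _)) I.
apply/seteqP; split=> p /= => [|p0]; first exact: fiber_sqnorm_gt0.
by apply: contraTneq p0 => z0; rewrite /fiber_sqnorm z0 mul0r ltxx.
Qed.

End SplitCoordinates.

Section Dilation.
Variables (R : realType) (d : nat).
Implicit Types (p q : Cn R (d + 1)) (t : R) (a b : 'I_(d + 1)).

Definition dilation t p : Cn R (d + 1) := wz_point (wpart p) (t%:C * zpart p).

(* V as a real vector field: in [euler] it is given by its holomorphic part. *)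
Definition euler_vector p : Cn R (d + 1) := wz_point 0 (zpart p).

Definition fiber_degree a : nat := (a == rshift d ord0).

Lemma wpart_dilation t p : wpart (dilation t p) = wpart p.
Proof. exact: wpart_wz. Qed.

Lemma zpart_dilation t p : zpart (dilation t p) = t%:C * zpart p.
Proof. exact: zpart_wz. Qed.

Lemma dilationE t p : dilation t p = wz_point (wpart p) 0 + t *: euler_vector p.
Proof. by rewrite wz_pointZ wz_pointD scaler0 addr0 add0r. Qed.

Lemma dilation1 p : dilation 1 p = p.
Proof. by rewrite /dilation mul1r wz_pointK. Qed.

Lemma add_euler_vector (s : R) p : p + s *: euler_vector p = dilation (1 + s) p.
Proof. by rewrite dilationE scalerDl addrA -dilationE dilation1. Qed.

Lemma euler_vector_dilation t p : euler_vector (dilation t p) = t *: euler_vector p.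
Proof. by rewrite /euler_vector zpart_dilation wz_pointZ scaler0. Qed.

Lemma fiber_sqnorm_dilation t p :
  fiber_sqnorm (dilation t p) = t ^+ 2 * fiber_sqnorm p.
Proof. by rewrite /fiber_sqnorm zpart_dilation Re_mulcJ_scale. Qed.

Lemma ccoord_dilation t p a :
  ccoord (dilation t p) a = t%:C ^+ fiber_degree a * ccoord p a.
Proof.
rewrite /fiber_degree /dilation; case: (split_ordP a) => k ->.
  by rewrite ccoord_wzl ccoord_wpart eq_lrshift expr0 mul1r.
by rewrite (ord1 k) ccoord_wzr eqxx expr1.
Qed.

Lemma holo_map_dilation U t : open U -> holo_map U (dilation t).
Proof.
move=> oU a; under eq_fun do rewrite ccoord_dilation.
by apply: holomorphicM => //; [exact: holomorphic_cst|exact: holomorphic_ccoord].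
Qed.

Lemma jac_dilation t p :
  jac (dilation t) p = diag_mx (\row_b t%:C ^+ fiber_degree b).
Proof.
apply/matrixP => a b; rewrite 3!mxE.
under eq_fun do rewrite ccoord_dilation.
rewrite (delZ _ _ (@csmooth_ccoord R (d + 1) setT b) I) del_ccoord.
by rewrite -[RHS]mulr_natr; case: eqP => [->//|_]; rewrite !mulr0.
Qed.

Lemma pullback_dilationE t (G : Cn R (d + 1) -> 'M[R[i]]_(d + 1)) p a b :
  pullback (dilation t) G p a b =
  t%:C ^+ (fiber_degree a + fiber_degree b) * G (dilation t p) a b.
Proof.
rewrite /pullback jac_dilation /ctrmx map_diag_mx tr_diag_mx.
rewrite mul_mx_diag mxE mul_diag_mx !mxE exprD mulrAC.
by rewrite rmorphXn /= oppr0.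
Qed.

Lemma ccoord_euler_vector p a : ccoord (euler_vector p) a = euler p 0 a.
Proof.
rewrite /euler_vector /euler; case: (split_ordP a) => k ->.
  by rewrite ccoord_wzl row_mxEl mxE /ccoord !mxE.
by rewrite (ord1 k) ccoord_wzr row_mxEr mxE eqxx mulr1n.
Qed.

Lemma eulerE p k : euler p 0 k = (fiber_degree k)%:R * zpart p.
Proof.
rewrite /fiber_degree /euler; case: (split_ordP k) => l ->.
  by rewrite row_mxEl mxE eq_lrshift mul0r.
by rewrite (ord1 l) row_mxEr mxE !eqxx mul1r mulr1n.
Qed.

Lemma del_euler p a k :
  del a (fun q => euler q 0 k) p = (fiber_degree a * fiber_degree k)%:R.
Proof.
under eq_fun do rewrite eulerE.
rewrite (delZ _ _ (@csmooth_ccoord R (d + 1) setT (rshift d ord0)) I) del_ccoord.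
by rewrite mulrC natrM.
Qed.

Lemma sum_fiber_degree a (F : 'I_(d + 1) -> R[i]) :
  \sum_k (fiber_degree a * fiber_degree k)%:R * F k = (fiber_degree a)%:R * F a.
Proof.
rewrite (bigD1 (rshift d ord0))//= big1 ?addr0; last first.
  by move=> k k0; rewrite /fiber_degree (negbTE k0) muln0 mul0r.
by rewrite /fiber_degree eqxx muln1; case: eqP => [->//|_]; rewrite !mul0r.
Qed.

Lemma lieF_cderive U (F : Cn R (d + 1) -> R[i]) p : open U -> csmooth U F -> U p ->
  lieF (@euler R d) F p = cderive F (euler_vector p) p.
Proof.
move=> oU sF Up; rewrite (cderive_del_delbar _ oU sF Up).
by apply: eq_bigr => k _; rewrite ccoord_euler_vector.
Qed.

End Dilation.

Lemma is_derive1_exprz (R : realType) (k : int) :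
  is_derive (1 : R) 1 (fun t => t ^ k) k%:~R.
Proof.
have dexprn n : is_derive (1 : R) 1 (fun t : R => t ^+ n) n%:R.
  split; first exact: exprn_derivable.
  by rewrite exp_derive expr1n [LHS]mulr1 [LHS]mulr1.
case: k => n; first exact: dexprn.
have expr1_neq0 : (1 : R) ^+ n.+1 != 0 by rewrite expr1n oner_eq0.
have [dn vn] := dexprn n.+1; split.
  exact: (@derivableV _ _ (fun t : R => t ^+ n.+1) 1 1 expr1_neq0 dn).
apply: etrans (@deriveV _ _ (fun t : R => t ^+ n.+1) 1 1 expr1_neq0 dn) _.
by rewrite vn !expr1n invr1 scaleN1r NegzE rmorphN.
Qed.

Section Homogeneity.
Variables (R : realType) (d : nat).
Implicit Types (f : Cn R (d + 1) -> R) (p : Cn R (d + 1)) (k : int).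

Lemma derive_euler_vector f k p :
  (forall t, 0 < t -> f (dilation t p) = t ^ k * f p) ->
  'D_(euler_vector p) f p = k%:~R * f p.
Proof.
move=> fk; apply: derive_val; apply/is_derive_line0P.
have dpow : is_derive (1 : R) 1 (fun t : R => t ^ k * f p) (k%:~R * f p).
  apply: is_derive_eq (is_deriveM (is_derive1_exprz R k)
    (is_derive_cst (f p) (1 : R) (1 : R))) _.
  by rewrite scaler0 add0r [LHS]mulrC.
have := (is_derive_line0P (fun t : R => t ^ k * f p) 1 1 (k%:~R * f p)).1 dpow.
under eq_fun do rewrite [_ *: 1]mulr1.
apply: near_eq_is_derive; near=> s; rewrite add_euler_vector fk//.
have : `|s| < 1 by near: s; exact: (@nbhs0_lt R R 1 ltr01).
by rewrite ltr_norml => /andP[]; lra.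
Unshelve. all: by end_near. Qed.

Lemma cderive_euler_vector (F : Cn R (d + 1) -> R[i]) k p :
  (forall t, 0 < t -> F (dilation t p) = (t ^ k)%:C * F p) ->
  cderive F (euler_vector p) p = k%:~R * F p.
Proof.
move=> Fk; rewrite -(rmorph_int (real_complex R)).
apply: complexP; rewrite ?ReRM ?ImRM /=; apply: derive_euler_vector => t t0.
  by rewrite Fk// ReRM.
by rewrite Fk// ImRM.
Qed.

Variable U : set (Cn R (d + 1)).
Hypotheses (oU : open U) (dilU : forall (t : R) q, 0 < t -> U q -> U (dilation t q)).

Definition homogeneous k f :=
  forall (t : R) q, 0 < t -> U q -> f (dilation t q) = t ^ k * f q.

Lemma homogeneous_lieF k f p : smooth U f -> homogeneous k f -> U p ->
  lieF (@euler R d) (fun q => (f q)%:C) p = k%:~R * (f p)%:C.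
Proof.
move=> sf fk Up; rewrite (lieF_cderive oU (csmooth_real sf) Up).
by apply: cderive_euler_vector => t t0; rewrite fk// rmorphM.
Qed.

(* Along r |-> f (dilation (exp r) p) the weight equation becomes the linear
   ODE y' = k y. *)
Lemma lieF_homogeneous (k : nat) f : smooth U f ->
  (forall p, U p -> lieF (@euler R d) (fun q => (f q)%:C) p = k%:R * (f p)%:C) ->
  homogeneous k f.
Proof.
move=> sf fL t p t0 Up.
have Dray (s : R) : 0 < s ->
    is_derive s 1 (fun s => f (dilation s p)) (s^-1 * (k%:R * f (dilation s p))).
  move=> s0; have Us := dilU s0 Up.
  have : 'D_(euler_vector (dilation s p)) f (dilation s p) = k%:R * f (dilation s p).
    have := fL _ Us; rewrite (lieF_cderive oU (csmooth_real sf) Us) cderive_real.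
    by rewrite -(rmorph_nat (real_complex R)) -rmorphM => /complexI.
  rewrite euler_vector_dilation (smooth_dirZ _ _ oU sf Us) => <-.
  rewrite mulKf ?gt_eqF//.
  have := derivableP (smooth_derivable (v := euler_vector p) sf Us).
  rewrite {1}dilationE => /is_derive_lineP.
  by under eq_fun do rewrite -dilationE.
pose y r := f (dilation (expR r) p) * expR (- (k%:R * r)).
have dy (r : R) : is_derive r 1 y 0.
  have dexpNk : is_derive r 1 (fun r : R => - (k%:R * r)) (- k%:R).
    have := @is_deriveN R R R _ _ _ _
      (@is_deriveZ R R R id k%:R r 1 1 (is_derive_id _ _)).
    by rewrite [_ *: 1]mulr1.
  have dray := @is_derive1_comp R _ (@expR R) r _ _ (Dray _ (expR_gt0 r))
    (is_derive_expR r).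
  have dexp := @is_derive1_comp R (@expR R) _ r _ _ (is_derive_expR _) dexpNk.
  apply: is_derive_eq (@is_deriveM R R _ _ _ _ _ _ dray dexp) _.
  rewrite /= /GRing.scale /=.
  move: (f _) => a; move: (expR (- _)) (expR r) (expR_gt0 r) => b c c0.
  by field; rewrite gt_eqF.
have := @is_derive_0_is_cst R y (ln t) 0 dy.
rewrite /y expR0 mulr0 oppr0 expR0 mulr1 lnK ?posrE// dilation1 => <-.
rewrite expRN expRM_natl lnK ?posrE// mulrC mulfVK//.
by rewrite expf_neq0// gt_eqF.
Qed.

Lemma homogeneous_del_fiber_neq0 k f p : smooth U f -> homogeneous k f -> U p ->
  k != 0 -> f p != 0 -> del (rshift d ord0) (fun q => (f q)%:C) p != 0.
Proof.
move=> sf fk Up k0 fp0; apply/negP => /eqP del0.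
have := homogeneous_lieF sf fk Up; rewrite /lieF big1 => [/esym/eqP|a _].
  by rewrite mulf_eq0 intr_eq0 complexR_eq0 (negbTE k0) (negbTE fp0).
rewrite (delbar_real oU a sf Up) eulerE /fiber_degree.
by case: eqP => [->|_]; rewrite ?del0 ?conjc0 ?mulr0 ?mul0r ?conjc0 ?mul0r addr0.
Qed.

Definition form_homogeneous k (G : Cn R (d + 1) -> 'M[R[i]]_(d + 1)) :=
  forall (t : R) q, 0 < t -> U q -> pullback (dilation t) G q = (t ^ k)%:C *: G q.

Lemma ddbarR_homogeneous k f : smooth U f -> homogeneous k f ->
  form_homogeneous k (ddbarR f).
Proof.
move=> sf fk t p t0 Up; apply: (pullback_ddbarR oU oU _ _ sf sf Up).
- exact: holo_map_dilation.
- by move=> q; exact: dilU.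
- by move=> q; exact: fk.
Qed.

Lemma lie11_homogeneous k G p : msmooth U G -> form_homogeneous k G -> U p ->
  lie11 (@euler R d) G p = k%:~R *: G p.
Proof.
move=> sG Gk Up; apply/matrixP => a b; rewrite [LHS]mxE [RHS]mxE.
pose m : int := (fiber_degree a + fiber_degree b)%N.
rewrite (lieF_cderive oU (sG a b) Up) (@cderive_euler_vector _ (k - m)).
  under eq_bigr do rewrite del_euler.
  rewrite sum_fiber_degree.
  under eq_bigr do rewrite del_euler conjc_nat.
  rewrite sum_fiber_degree /m rmorphB /= -[X in _ - X]pmulrn natrD.
  by move: (G p a b) => x; ring.
move=> t t0; have tm0 : (t ^+ (fiber_degree a + fiber_degree b))%:C != 0.
  by rewrite complexR_eq0 expf_neq0// gt_eqF.
apply: (mulfI tm0); rewrite mulrA -rmorphM exprnP -expfzDr ?gt_eqF//.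
rewrite subrKC -exprnP rmorphXn -pullback_dilationE Gk//.
by rewrite mxE.
Qed.

End Homogeneity.

(** * Charts of the total space *)

Section Charts.
Variables (R : realType) (d : nat) (D : complexManifold R d).

Lemma chart_image_open (i : cm_idx D) (A : set D) : open A ->
  open (cm_chart i @` (cm_dom i `&` A)).
Proof.
move=> oA; rewrite openE => _ [x [xi xA] <-]; rewrite /interior.
have chart_x : (cm_chart i @` cm_dom i) (cm_chart i x) by exists x.
have near_image : nbhs (cm_chart i x) (cm_chart i @` cm_dom i).
  by apply: open_nbhs_nbhs; split=> //; exact: cm_chart_open.
have near_A : nbhs (cm_chart i x) (cm_inv i @^-1` A).
  apply: (cm_inv_cont chart_x); rewrite cm_chartK//.
  by apply: open_nbhs_nbhs; split.
apply: filterS (filterI near_image near_A) => q [[y yi <-]] /=.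
by rewrite cm_chartK// => yA; exists y.
Qed.

Variable E : lineBundle D.
Implicit Types (i : cm_idx D) (j : lb_idx E).

Lemma base_dom_open i j : open (base_dom i j).
Proof. by apply: chart_image_open; exact: lb_dom_open. Qed.

Lemma total_dom_open i j : open (total_dom i j).
Proof.
apply: openI; last exact: zpart_neq0_open.
by apply: open_preimage_wpart; exact: base_dom_open.
Qed.

Lemma total_dom_dilation i j (t : R) p : 0 < t -> total_dom i j p ->
  total_dom i j (dilation t p).
Proof.
move=> t0 [bw z0]; split; first by rewrite wpart_dilation.
by rewrite zpart_dilation mulf_neq0// complexR_eq0 gt_eqF.
Qed.

Lemma lb_trans_neq0 j k x : lb_dom j x -> lb_dom k x -> lb_trans j k x != 0.
Proof.
move=> xj xk; apply/negP => /eqP t0.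
have inv_eq z : lb_inv j x z = lb_inv k x 0.
  rewrite -[LHS](lb_fibK (j := k)) ?lb_proj_inv//.
  by rewrite (lb_transE (j := j)) ?lb_proj_inv// t0 mul0r.
have := congr1 (lb_fib j) (etrans (inv_eq 1) (esym (inv_eq 0))).
by rewrite !lb_fib_inv// => /eqP; rewrite oner_eq0.
Qed.

Lemma base_domP i j w : base_dom i j w ->
  [/\ cm_dom i (cm_inv i w), lb_dom j (cm_inv i w) & cm_chart i (cm_inv i w) = w].
Proof. by move=> [x [xi xj] <-]; rewrite cm_chartK. Qed.

Lemma lb_inv_off_zero j x z : lb_dom j x -> z != 0 -> off_zero (lb_inv j x z).
Proof.
move=> xj z0 k; rewrite lb_proj_inv// => xk.
rewrite (lb_transE (j := j)) ?lb_proj_inv// lb_fib_inv//.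
by rewrite mulf_neq0// lb_trans_neq0.
Qed.

Definition total_chart i j (e : E) : Cn R (d + 1) :=
  wz_point (cm_chart i (lb_proj e)) (lb_fib j e).

Lemma lb_proj_total_inv i j p : total_dom i j p ->
  lb_proj (total_inv i j p) = cm_inv i (wpart p).
Proof. by move=> [/base_domP[_ xj _] _]; rewrite lb_proj_inv. Qed.

Lemma total_inv_off_zero i j p : total_dom i j p -> off_zero (total_inv i j p).
Proof. by move=> [/base_domP[_ xj _] z0]; exact: lb_inv_off_zero. Qed.

Lemma total_chartK i j e : cm_dom i (lb_proj e) -> lb_dom j (lb_proj e) ->
  total_inv i j (total_chart i j e) = e.
Proof.
move=> ei ej; rewrite /total_inv /total_chart wpart_wz zpart_wz cm_chartK//.
exact: lb_fibK.
Qed.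

Lemma total_chart_dom i j e : off_zero e -> cm_dom i (lb_proj e) ->
  lb_dom j (lb_proj e) -> total_dom i j (total_chart i j e).
Proof.
move=> e0 ei ej; split; rewrite /total_chart ?wpart_wz ?zpart_wz; last exact: e0.
by exists (lb_proj e).
Qed.

Lemma total_chart_cover e : off_zero e ->
  exists i j, total_dom i j (total_chart i j e) /\
              total_inv i j (total_chart i j e) = e.
Proof.
move=> e0; have [i ei] := cm_cover (lb_proj e).
have [j ej] := lb_cover E (lb_proj e).
by exists i, j; split; [exact: total_chart_dom|exact: total_chartK].
Qed.

Section Transition.
Variables (i i' : cm_idx D) (j j' : lb_idx E).

Definition overlap : set (Cn R (d + 1)) :=
  [set p | (cm_chart i @` (cm_dom i `&` (lb_dom j `&` (cm_dom i' `&` lb_dom j'))))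
             (wpart p) /\ zpart p != 0].

Definition transition p := total_chart i' j' (total_inv i j p).

Lemma overlap_open : open overlap.
Proof.
apply: openI; last exact: zpart_neq0_open.
apply: open_preimage_wpart; apply: chart_image_open.
by do 2 (apply: openI; first by [exact: lb_dom_open|exact: cm_dom_open]);
  exact: lb_dom_open.
Qed.

Lemma overlap_total p : overlap p -> total_dom i j p.
Proof. by move=> [[x [xi [xj _]] xw] z0]; split=> //; exists x. Qed.

Lemma overlap_dom p : overlap p ->
  cm_dom i' (lb_proj (total_inv i j p)) /\ lb_dom j' (lb_proj (total_inv i j p)).
Proof.
move=> op; rewrite (lb_proj_total_inv (overlap_total op)).
by move: op => [[x [xi [_ [xi' xj']]] <-] _]; rewrite cm_chartK.
Qed.

Lemma mem_overlap p : total_dom i j p ->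
  cm_dom i' (lb_proj (total_inv i j p)) -> lb_dom j' (lb_proj (total_inv i j p)) ->
  overlap p.
Proof.
move=> tp; rewrite (lb_proj_total_inv tp) => xi' xj'.
have [/base_domP[xi xj wE] z0] := tp.
by split=> //; exists (cm_inv i (wpart p)).
Qed.

Lemma transition_dom p : overlap p -> total_dom i' j' (transition p).
Proof.
move=> op; have [xi' xj'] := overlap_dom op; apply: total_chart_dom => //.
exact: total_inv_off_zero (overlap_total op).
Qed.

Lemma transitionE p : overlap p ->
  total_inv i' j' (transition p) = total_inv i j p.
Proof. by move=> op; have [xi' xj'] := overlap_dom op; exact: total_chartK. Qed.

Lemma holomorphic_base_change l : holomorphic overlap
  (fun p => ccoord (cm_chart i' (cm_inv i (wpart p))) l).
Proof.
have oB := chart_image_open (i := i) (@cm_dom_open _ _ D i').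
apply: (holomorphic_comp overlap_open oB (@holo_map_wpart _ _ _)) (cm_trans_holo i i' l).
by move=> p [[x [xi [_ [xi' _]]] xw] _]; exists x.
Qed.

Lemma holomorphic_fiber_change : holomorphic overlap
  (fun p => lb_trans j j' (cm_inv i (wpart p)) * zpart p).
Proof.
apply: (holomorphicM overlap_open); last exact: holomorphic_ccoord.
have oB := chart_image_open (i := i) (openI (lb_dom_open j) (lb_dom_open j')).
apply: (holomorphic_comp overlap_open oB (@holo_map_wpart _ _ _)) (lb_trans_holo j j' i).
by move=> p [[x [xi [xj [_ xj']]] xw] _]; exists x.
Qed.

Lemma holo_map_transition : holo_map overlap transition.
Proof.
move=> k; case: (split_ordP k) => l ->.
  apply: (eq_holomorphic overlap_open) (holomorphic_base_change l) => p op.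
  by rewrite ccoord_wzl lb_proj_total_inv//; exact: overlap_total.
rewrite (ord1 l).
apply: (eq_holomorphic overlap_open) holomorphic_fiber_change => p op.
have tp := overlap_total op; have projE := lb_proj_total_inv tp.
have [_ xj'] := overlap_dom op; have [/base_domP[_ xj _] _] := tp.
by rewrite ccoord_wzr (lb_transE (j := j)) ?projE// -?projE// lb_fib_inv.
Qed.

End Transition.
End Charts.

(** * The potential of omega_0 *)

Section Potential.
Variables (R : realType) (d : nat) (D : complexManifold R d) (E : lineBundle D).
Variables (h : hermitianMetric E) (i : cm_idx D) (j : lb_idx E).
Local Notation U := (@total_dom R d D E i j).

Definition frame_sqnorm (w : Cn R d) : R := h (lb_frame j (cm_inv i w)).

Definition potential (p : Cn R (d + 1)) : R := (h (total_inv i j p))^-1.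

Let oU : open U. Proof. exact: total_dom_open. Qed.
Let oB : open (base_dom i j). Proof. exact: base_dom_open. Qed.

Lemma sqnorm_total_inv p : U p ->
  h (total_inv i j p) = frame_sqnorm (wpart p) * fiber_sqnorm p.
Proof.
move=> Up; have [/base_domP[_ xj _] _] := Up.
rewrite (@hm_sqE _ _ _ _ h j) (lb_proj_total_inv Up)//; congr (_ * _).
rewrite /total_inv lb_fib_inv// /fiber_sqnorm; case: (zpart p) => x y /=.
by rewrite mulrN opprK !expr2.
Qed.

Lemma frame_sqnorm_gt0 w : base_dom i j w -> 0 < frame_sqnorm w.
Proof. by move=> /base_domP[_ xj _]; exact: hm_pos. Qed.

Lemma sqnorm_total_inv_gt0 p : U p -> 0 < h (total_inv i j p).
Proof.
move=> Up; rewrite sqnorm_total_inv//; case: Up => bw z0.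
by rewrite mulr_gt0 ?frame_sqnorm_gt0 ?fiber_sqnorm_gt0.
Qed.

Lemma potential_gt0 p : U p -> 0 < potential p.
Proof. by move=> Up; rewrite invr_gt0 sqnorm_total_inv_gt0. Qed.

Lemma smooth_ln_frame_sqnorm : smooth (base_dom i j) (fun w => ln (frame_sqnorm w)).
Proof. apply: smooth_ln => //; [exact: frame_sqnorm_gt0|exact: hm_smooth]. Qed.

Lemma smooth_frame_sqnorm_wpart : smooth U (fun p => frame_sqnorm (wpart p)).
Proof.
apply: (smooth_comp oU oB (holo_csmooth_map (@holo_map_wpart _ _ _))).
  by move=> p [].
exact: hm_smooth.
Qed.

Lemma smooth_potential : smooth U potential.
Proof.
apply: smoothV => // [p Up|]; first by rewrite gt_eqF// sqnorm_total_inv_gt0.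
apply: (eq_smooth oU (fun p Up => esym (sqnorm_total_inv Up))).
by apply: smoothM => //; [exact: smooth_frame_sqnorm_wpart|exact: smooth_fiber_sqnorm].
Qed.

Lemma potential_homogeneous : homogeneous U (-2) potential.
Proof.
move=> t p t0 Up; rewrite /potential !sqnorm_total_inv//; last exact: total_dom_dilation.
by rewrite wpart_dilation fiber_sqnorm_dilation mulrCA invfM.
Qed.

(* The term log |z|^2 of log |S|^2 is pluriharmonic. *)
Lemma ddbarR_ln_potential p : U p ->
  ddbarR (fun q => ln (potential q)) p = pullback (@wpart R d) (curvature h i j) p.
Proof.
move=> Up; have hw : holo_map U (@wpart R d) by exact: holo_map_wpart.
have wU q : U q -> base_dom i j (wpart q) by case.
have slnw := smooth_comp oU oB (holo_csmooth_map hw) wU smooth_ln_frame_sqnorm.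
have slnz : smooth U (fun q => ln (fiber_sqnorm q)).
  apply: smooth_ln => //; last exact: smooth_fiber_sqnorm.
  by move=> q [_ z0]; exact: fiber_sqnorm_gt0.
have lnE q : U q -> ln (potential q) =
    - (ln (frame_sqnorm (wpart q)) + ln (fiber_sqnorm q)).
  move=> Uq; rewrite lnV ?posrE ?sqnorm_total_inv_gt0// sqnorm_total_inv//.
  by case: Uq => bw z0; rewrite lnM ?posrE ?frame_sqnorm_gt0 ?fiber_sqnorm_gt0.
apply: etrans (eq_ddbarR oU Up lnE) _.
apply: etrans (ddbarRN oU (smoothD oU slnw slnz) Up) _.
rewrite /pullback mulmxN mulNmx; apply: (congr1 -%R).
apply: etrans (ddbarRD oU slnw slnz Up) _.
have -> : ddbarR (fun q => ln (fiber_sqnorm q)) p = 0.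
  exact: (ddbarR_ln_sqnorm oU (@holomorphic_ccoord R (d + 1) _ (rshift d ord0))
    (fun q (Uq : U q) => Uq.2) Up).
rewrite addr0 -[LHS]scale1r.
exact/esym/(pullback_ddbarR oU oB hw wU slnw smooth_ln_frame_sqnorm Up
  (fun q _ => esym (mul1r _))).
Qed.

Lemma ddbarR_potential p : U p -> ddbarR potential p =
  (potential p)%:C *: pullback (@wpart R d) (curvature h i j) p +
  (potential p)%:C^-1 *: (del_gradient potential p *m ctrmx (del_gradient potential p)).
Proof.
move=> Up; have p0 : (potential p)%:C != 0 by rewrite complexR_eq0 gt_eqF ?potential_gt0.
rewrite -(ddbarR_ln_potential Up) (ddbarR_ln oU potential_gt0 smooth_potential Up).
rewrite scalerBr !scalerA mulfV// scale1r expr2 mulrA mulfV// mul1r.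
by rewrite subrK.
Qed.

Lemma mulmx_vertical (v : 'rV[R[i]]_(d + 1)) (L : 'cV[R[i]]_(d + 1)) :
  lsubmx v = 0 -> (v *m L) 0 0 = v 0 (rshift d ord0) * L (rshift d ord0) 0.
Proof.
move=> /matrixP v0; rewrite mxE big_split_ord /= big_ord1 big1 ?add0r// => k _.
by have := v0 0 k; rewrite !mxE => ->; rewrite mul0r.
Qed.

Lemma curvature_posdef w : kahler_curvature h -> base_dom i j w ->
  posdef (curvature h i j w).
Proof.
move=> /(_ i j)[_ _ pos _ _] bw v v0; rewrite herm_formE.
exact: pos.
Qed.

Lemma potential_posdef p : kahler_curvature h -> U p -> posdef (ddbarR potential p).
Proof.
move=> h_kahler Up v v0; have f0 := potential_gt0 Up; have f0C : 0 < (potential p)%:C.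
  by rewrite ltcR.
rewrite ddbarR_potential// herm_formD !herm_formZ herm_form_rank1.
rewrite herm_form_congruence mul_jac_wpart.
have grad_ge0 : 0 <= (potential p)%:C^-1 * ((v *m del_gradient potential p) 0 0 *
    conjc ((v *m del_gradient potential p) 0 0)).
  by rewrite mulr_ge0 ?invr_ge0 ?mulcJ_ge0// ltW.
have [w0|w0] := eqVneq (lsubmx v) 0; last first.
  apply: ltr_wpDr => //; rewrite mulr_gt0//.
  exact: curvature_posdef h_kahler Up.1 _ w0.
rewrite w0 {1}/herm_form !mul0mx mxE mulr0 add0r lt_def grad_ge0 andbT.
have vz0 : v 0 (rshift d ord0) != 0.
  apply: contraNneq v0 => vz; rewrite -[v]hsubmxK w0 (_ : rsubmx v = 0) ?row_mx0//.
  by apply/rowP => k; rewrite !mxE (ord1 k).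
have grad_z0 : del_gradient potential p (rshift d ord0) 0 != 0.
  rewrite mxE; apply: homogeneous_del_fiber_neq0 potential_homogeneous Up _ _ => //.
    exact: smooth_potential.
  by rewrite gt_eqF.
have prod0 := mulf_neq0 vz0 grad_z0.
by rewrite mulmx_vertical// mulf_neq0 ?invr_eq0 ?(gt_eqF f0C)// mulf_neq0 ?conjc_eq0.
Qed.

Lemma potential_metric : kahler_curvature h -> metric_potential U potential.
Proof.
move=> h_kahler; split=> [|p Up]; first exact: smooth_potential.
apply: posdef_det_gt0; last exact: potential_posdef.
exact: (ddbarR_hermitian oU smooth_potential Up).
Qed.

End Potential.

(** * The soliton equation, weight by weight *)

Section LocalSoliton.
Variables (R : realType) (d : nat) (U : set (Cn R (d + 1))) (f : Cn R (d + 1) -> R).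
Hypotheses (oU : open U) (dilU : forall (t : R) q, 0 < t -> U q -> U (dilation t q)).
Hypotheses (mf : metric_potential U f) (f_homogeneous : homogeneous U (-2) f).
Implicit Types (u : nat -> Cn R (d + 1) -> R) (p : Cn R (d + 1)).

Lemma trlog_pert_homogeneous u m (t : R) p : 0 < t -> U p -> smooth_below U m u ->
  (forall l, (0 < l)%N -> (l + 2 <= m)%N -> homogeneous U l (u l)) ->
  trlog_comp (pert_comp f u (dilation t p)) m =
  (t ^+ m)%:C * trlog_comp (pert_comp f u p) m.
Proof.
move=> t0 Up su hu; apply: (trlog_pert_natural oU oU (holo_map_dilation t oU)
  (fun q => @dilU t q t0) t0 mf mf _ Up su su) => [q Uq|l q l0 lm Uq].
  exact: f_homogeneous.
exact: hu.
Qed.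

Variable u : nat -> Cn R (d + 1) -> R.
Hypotheses (u_smooth : forall k, (0 < k)%N -> smooth U (u k))
  (u_homogeneous : forall k, (0 < k)%N -> homogeneous U k (u k)).

Lemma msmooth_omega_comp m : msmooth U (omega_comp f u m).
Proof.
case: m => [[|k]|[|[|k]]] /=; try exact: msmooth_cst.
- by apply: msmoothN => //; exact: msmooth_ric.
- by apply: msmooth_ddbarR => //; exact: u_smooth.
- exact: msmooth_ddbarR oU _ mf.1.
Qed.

Lemma omega_comp_homogeneous m : form_homogeneous U m (omega_comp f u m).
Proof.
have zero_homogeneous k : form_homogeneous U k (fun=> 0).
  by move=> t q _ _; rewrite /pullback mulmx0 mul0mx scaler0.
case: m => [[|k]|[|[|k]]] /=.
- move=> t q t0 Uq; rewrite expr0z scale1r /pullback mulmxN mulNmx.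
  apply: (congr1 -%R).
  apply: (pullback_ric oU oU (holo_map_dilation t oU) (fun r => @dilU t r t0) t0 mf mf
    _ Uq) => r Ur.
  exact: f_homogeneous.
- exact: (ddbarR_homogeneous oU dilU (@u_smooth k.+1 isT) (@u_homogeneous k.+1 isT)).
- exact: zero_homogeneous.
- exact: (ddbarR_homogeneous oU dilU mf.1 f_homogeneous).
- exact: zero_homogeneous.
Qed.

Lemma lie11_omega_comp m p : U p ->
  lie11 (@euler R d) (omega_comp f u m) p = m%:~R *: omega_comp f u m p.
Proof.
exact: (lie11_homogeneous oU (msmooth_omega_comp m) (@omega_comp_homogeneous m)).
Qed.

Lemma soliton_weightE n (X Y : 'M[R[i]]_n) (c : R[i]) :
  - X + 2^-1 *: (c *: Y) = - Y <-> X = (1 + c / 2) *: Y.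
Proof.
rewrite scalerA (mulrC 2^-1) scalerDl scale1r; set Z := (c / 2) *: Y.
split=> [/eqP|->]; last by rewrite opprD addrNK.
by rewrite addrC subr_eq addrC -subr_eq opprK addrC => /eqP.
Qed.

Lemma formal_solitonP p : U p ->
  formal_soliton_at (@euler R d) f u p <->
  forall k, (0 < k)%N ->
    ddbar (fun q => trlog_comp (pert_comp f u q) k) p =
    (1 + k%:R / 2) *: ddbarR (u k) p.
Proof.
move=> Up.
have lieE m : ric_comp f u m p + 2^-1 *: lie11 (@euler R d) (omega_comp f u m) p =
    ric_comp f u m p + 2^-1 *: (m%:~R *: omega_comp f u m p).
  by apply: congr1; apply: congr1; exact: lie11_omega_comp.
split=> [sol [//|k] _|sol m].
  exact/(soliton_weightE _ _ k.+1%:R).1/(etrans (esym (lieE k.+1)))/sol.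
apply: etrans (lieE m) _; case: m => [[|k]|[|[|k]]].
- by rewrite scale0r scaler0 addr0 opprK.
- exact/(soliton_weightE _ _ k.+1%:R).2/sol.
- by rewrite !scaler0 addr0 oppr0.
- by rewrite /= add0r scalerA mulrN mulVf ?pnatr_eq0// scaleN1r.
- by rewrite !scaler0 addr0 oppr0.
Qed.

End LocalSoliton.

(** * Existence *)

Section OffZero.
Variables (R : realType) (d : nat) (D : complexManifold R d) (E : lineBundle D).

Definition homogeneous_off_zero (k : int) (f : E -> R) :=
  forall i j, homogeneous (total_dom i j) k (fun q => f (total_inv i j q)).

Lemma has_weightP (k : nat) (f : E -> R) : smooth_off_zero f ->
  has_weight k f <-> homogeneous_off_zero k f.
Proof.
move=> sf; split=> hf i j; have oU := @total_dom_open _ _ _ E i j.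
  exact: (lieF_homogeneous oU (@total_dom_dilation _ _ _ E i j) (sf i j) (hf i j)).
by move=> p Up; exact: (homogeneous_lieF oU (sf i j) (hf i j) Up).
Qed.

End OffZero.

Section Existence.
Variables (R : realType) (d : nat) (D : complexManifold R d) (E : lineBundle D).
Variable h : hermitianMetric E.
Hypothesis h_kahler : kahler_curvature h.
Implicit Types (u v : nat -> E -> R) (k : nat) (i : cm_idx D) (j : lb_idx E).

Definition in_chart u i j : nat -> Cn R (d + 1) -> R :=
  fun l q => u l (total_inv i j q).

Definition trlog_chart u k i j (p : Cn R (d + 1)) : R[i] :=
  trlog_comp (pert_comp (potential h i j) (in_chart u i j) p) k.

Lemma smooth_below_in_chart u k i j :
  (forall l, (0 < l)%N -> (l < k)%N -> smooth_off_zero (u l)) ->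
  smooth_below (total_dom i j) k (in_chart u i j).
Proof. by move=> su l l0 lk; apply: su => //; apply: leq_trans lk; rewrite addn2. Qed.

Lemma trlog_chart_transition u k i i' j j' p : overlap i i' j j' p ->
  (forall l, (0 < l)%N -> (l < k)%N -> smooth_off_zero (u l)) ->
  trlog_chart u k i' j' (transition i i' j j' p) = trlog_chart u k i j p.
Proof.
move=> op su.
have sub := @overlap_total _ _ _ E i i' j j'.
have mf := metric_potential_sub sub (potential_metric i j h_kahler).
have su' := smooth_below_in_chart i' j' su.
have suO : smooth_below (overlap i i' j j') k (in_chart u i j).
  by move=> l l0 lk; exact: smooth_sub sub (smooth_below_in_chart i j su l0 lk).
have gf q : overlap i i' j j' q ->
    potential h i' j' (transition i i' j j' q) = (1 ^+ 2)^-1 * potential h i j q.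
  by move=> oq; rewrite expr1n invr1 mul1r /potential transitionE.
have vu l q : (0 < l)%N -> (l + 2 <= k)%N -> overlap i i' j j' q ->
    in_chart u i' j' l (transition i i' j j' q) = 1 ^+ l * in_chart u i j l q.
  by move=> _ _ oq; rewrite expr1n mul1r /in_chart transitionE.
apply: etrans (trlog_pert_natural
  (@overlap_open _ _ _ E i i' j j') (@total_dom_open _ _ _ E i' j')
  (@holo_map_transition _ _ _ E i i' j j') (@transition_dom _ _ _ E i i' j j') ltr01 mf
  (potential_metric i' j' h_kahler) gf op suO su' vu) _.
by rewrite expr1n mul1r.
Qed.

Definition base_chart (e : E) : cm_idx D := sval (cid (cm_cover (lb_proj e))).
Definition fiber_chart (e : E) : lb_idx E := sval (cid (lb_cover E (lb_proj e))).

Lemma base_chartP e : cm_dom (base_chart e) (lb_proj e).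
Proof. exact: svalP (cid (cm_cover (lb_proj e))). Qed.

Lemma fiber_chartP e : lb_dom (fiber_chart e) (lb_proj e).
Proof. exact: svalP (cid (lb_cover E (lb_proj e))). Qed.

Definition next_term u k (e : E) : R :=
  2 / (k%:R + 2) * complex.Re (trlog_chart u k (base_chart e) (fiber_chart e)
    (total_chart (base_chart e) (fiber_chart e) e)).

Lemma eq_next_term u v k : (forall l, (l < k)%N -> u l = v l) ->
  next_term u k = next_term v k.
Proof.
move=> uv; apply/funext => e.
apply: (congr1 (fun x => 2 / (k%:R + 2) * complex.Re x)).
apply: eq_trlog_pert => l _ lk.
by rewrite /in_chart uv//; apply: leq_trans lk; rewrite addn2.
Qed.

Lemma next_term_chart u k i j p :
  (forall l, (0 < l)%N -> (l < k)%N -> smooth_off_zero (u l)) -> total_dom i j p ->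
  next_term u k (total_inv i j p) = 2 / (k%:R + 2) * complex.Re (trlog_chart u k i j p).
Proof.
move=> su Up; set e := total_inv i j p.
have op : overlap i (base_chart e) j (fiber_chart e) p.
  by apply: mem_overlap => //; [exact: base_chartP|exact: fiber_chartP].
apply: (congr1 (fun x => 2 / (k%:R + 2) * complex.Re x)).
exact: trlog_chart_transition op su.
Qed.

Lemma next_term_smooth u k :
  (forall l, (0 < l)%N -> (l < k)%N -> smooth_off_zero (u l)) ->
  smooth_off_zero (next_term u k).
Proof.
move=> su i j; have oU := @total_dom_open _ _ _ E i j.
apply: (eq_smooth oU (fun p Up => esym (next_term_chart su Up))).
apply: smoothM => //; first exact: smooth_cst.
exact: (csmooth_trlog_pert oU (potential_metric i j h_kahler)
  (smooth_below_in_chart i j su)).1.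
Qed.

Lemma next_term_homogeneous u k :
  (forall l, (0 < l)%N -> (l < k)%N -> smooth_off_zero (u l)) ->
  (forall l, (0 < l)%N -> (l < k)%N -> homogeneous_off_zero l (u l)) ->
  homogeneous_off_zero k (next_term u k).
Proof.
move=> su hu i j t p t0 Up; have Ut := total_dom_dilation t0 Up.
apply: etrans (next_term_chart su Ut) _.
apply: etrans _ (congr1 ( *%R (t ^ k)) (esym (next_term_chart su Up))).
rewrite mulrCA; apply: (congr1 ( *%R (2 / (k%:R + 2)))).
apply: etrans _ (ReRM _ _); apply: (congr1 (@complex.Re R)).
apply: (trlog_pert_homogeneous (@total_dom_open _ _ _ E i j)
  (@total_dom_dilation _ _ _ E i j) (potential_metric i j h_kahler)
  (potential_homogeneous h (i := i) (j := j)) t0 Up (smooth_below_in_chart i j su)).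
by move=> l l0 lk; apply: hu => //; apply: leq_trans lk; rewrite addn2.
Qed.

(* Iterating [next_term] on the whole sequence fixes one more term each time. *)
Definition iterates n := iter n next_term (fun _ _ => 0).
Definition expansion k := iterates k.+1 k.

Lemma iterates_stable k n : (k < n)%N -> iterates n k = expansion k.
Proof.
elim/ltn_ind: k n => k IH [//|n] kn.
apply: (@eq_next_term (iterates n) (iterates k) k) => l lk.
by rewrite (IH _ lk n) ?(IH _ lk k)//; exact: leq_trans lk kn.
Qed.

Lemma expansionE k : expansion k = next_term expansion k.
Proof.
apply: (@eq_next_term (iterates k) expansion k) => l lk.
exact: iterates_stable.
Qed.

Lemma expansion_smooth k : smooth_off_zero (expansion k).
Proof.
elim/ltn_ind: k => k IH; rewrite expansionE; apply: next_term_smooth => l _.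
exact: IH.
Qed.

Lemma expansion_homogeneous k : homogeneous_off_zero k (expansion k).
Proof.
elim/ltn_ind: k => k IH; rewrite expansionE; apply: next_term_homogeneous => l _.
  by move=> _; exact: expansion_smooth.
exact: IH.
Qed.

Lemma trlog_expansion k i j p : total_dom i j p ->
  trlog_chart expansion k i j p = ((1 + k%:R / 2) * in_chart expansion i j k p)%:C.
Proof.
move=> Up; have su l : (0 < l)%N -> (l < k)%N -> smooth_off_zero (expansion l).
  by move=> _ _; exact: expansion_smooth.
have expE := etrans (congr1 (fun f => f (total_inv i j p)) (expansionE k))
  (next_term_chart su Up).
apply: etrans (esym (trlog_pert_real (@total_dom_open _ _ _ E i j)
  (potential_metric i j h_kahler) (smooth_below_in_chart i j su) Up)) _.
apply: (congr1 (real_complex R)); rewrite [in_chart _ _ _ _ _]expE /trlog_chart.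
move: (complex.Re _) => x; have k2 : (k%:R + 2 : R) != 0.
  by rewrite gt_eqF// ltr_wpDl// ltr0n.
by field.
Qed.

Lemma expansion_soliton : soliton_expansion h expansion.
Proof.
split=> [k _|k _|i j p Up]; first exact: expansion_smooth.
  exact/(has_weightP k (expansion_smooth k))/expansion_homogeneous.
have oU := @total_dom_open _ _ _ E i j.
apply/(formal_solitonP oU (@total_dom_dilation _ _ _ E i j)
  (potential_metric i j h_kahler) (potential_homogeneous h (i := i) (j := j))
  (fun l _ => @expansion_smooth l i j) (fun l _ => @expansion_homogeneous l i j) Up).
move=> k _; apply: etrans (eq_ddbar oU Up (fun q => @trlog_expansion k i j q)) _.
apply: etrans (ddbarRZ oU (1 + k%:R / 2) (expansion_smooth k i j) Up) _.
by rewrite rmorphD rmorph1 rmorphM rmorph_nat fmorphV rmorph_nat.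
Qed.

End Existence.

(** * The maximum principle *)

Lemma second_derivative_max (R : realType) n (U : set (Cn R n)) (f : Cn R n -> R) p u :
  open U -> smooth U f -> U p -> (forall q, U q -> f q <= f p) ->
  'D_u (fun q => 'D_u f q) p <= 0.
Proof.
move=> oU sf Up fmax; have sDf := smooth_derive u sf.
have := smooth_cvg_second_difference (u := u) (v := - u) oU sf Up.
have -> : 'D_(- u) (fun q => 'D_u f q) p = - 'D_u (fun q => 'D_u f q) p.
  by rewrite -scaleN1r (smooth_dirZ _ _ oU sDf Up) mulN1r.
move=> /cvgr_to_ge diff_ge; rewrite -oppr_ge0; apply: diff_ge.
have near_U : \forall s \near 0^'+, forall a b : R, `|a| <= s -> `|b| <= s ->
    U (p + a *: u + b *: (- u)).
  by apply: near_parallelogram; exact: open_near oU Up _.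
near=> s; have s0 : 0 < s by near: s; exact: nbhs_right_gt.
have U_s (a b : R) : `|a| <= s -> `|b| <= s -> U (p + a *: u + b *: (- u)).
  by move: a b; near: s; exact: near_U.
have s_le : `|s| <= s by rewrite gtr0_norm.
have norm0_le : `|0 : R| <= s by rewrite normr0 ltW.
have := fmax _ (U_s s 0 s_le norm0_le); have := fmax _ (U_s 0 s norm0_le s_le).
rewrite !scale0r !addr0 => max_minus max_plus.
rewrite mulr_ge0 ?invr_ge0 ?mulr_ge0 ?(ltW s0)// /second_difference scalerN addrK.
by move: max_minus max_plus; rewrite scalerN; lra.
Unshelve. all: by end_near. Qed.

Section MaximumPrinciple.
Variables (R : realType) (n : nat).
Implicit Types (p : Cn R n) (v : 'rV[R[i]]_n).

Definition complex_line p v (z : Cn R 1) : Cn R n :=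
  (\row_a complex.Re (ccoord p a + ccoord z ord0 * v 0 a),
   \row_a complex.Im (ccoord p a + ccoord z ord0 * v 0 a)).

Lemma ccoord_complex_line p v z a :
  ccoord (complex_line p v z) a = ccoord p a + ccoord z ord0 * v 0 a.
Proof. by rewrite {1}/ccoord /complex_line /= !mxE; case: (ccoord p a + _). Qed.

Lemma holo_map_complex_line W p v : open W -> holo_map W (complex_line p v).
Proof.
move=> oW a; under eq_fun do rewrite ccoord_complex_line.
apply: holomorphicD => //; first exact: holomorphic_cst.
by apply: holomorphicM => //; [exact: holomorphic_ccoord|exact: holomorphic_cst].
Qed.

Lemma jac_complex_line p v z : jac (complex_line p v) z = v.
Proof.
apply/matrixP => k a; rewrite mxE !ord1.
under eq_fun do rewrite ccoord_complex_line.
have sz := @csmooth_ccoord R 1 setT ord0.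
have scst c := csmooth_cst (V := Cn R 1) setT c.
rewrite (delD _ (scst _) (csmoothM (@openT _) sz (scst _)) I) (delM _ sz (scst _) I).
by rewrite !del_cst del_ccoord eqxx add0r mulr0 add0r mul1r.
Qed.

Lemma complex_line0 p v : complex_line p v 0 = p.
Proof.
have pE a : ccoord p a + ccoord (0 : Cn R 1) ord0 * v 0 a = ccoord p a.
  by rewrite /ccoord !mxE /= mul0r addr0.
case: p pE => x y pE; congr (_, _); apply/rowP => a; rewrite mxE pE.
  by [].
by [].
Qed.

Lemma herm_form_ddbarR_max (U : set (Cn R n)) (f : Cn R n -> R) p v :
  open U -> smooth U f -> U p -> (forall q, U q -> f q <= f p) ->
  herm_form (ddbarR f p) v <= 0.
Proof.
move=> oU sf Up fmax; pose W := complex_line p v @^-1` U.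
have oW : open W.
  apply: open_comp => // z _.
  have hT := holo_map_complex_line p v (@openT (Cn R 1)).
  exact: (csmooth_map_continuous (holo_csmooth_map hT) I).
have hW := holo_map_complex_line p v oW.
have WU z : W z -> U (complex_line p v z) by [].
have W0 : W 0 by rewrite /W /= complex_line0.
have sfl := smooth_comp oW oU (holo_csmooth_map hW) WU sf.
have flmax z : W z -> f (complex_line p v z) <= f (complex_line p v 0).
  by rewrite complex_line0; exact: fmax.
have := ddbar_pullback oW oU hW WU (csmooth_real sf) W0.
rewrite /pullback jac_complex_line complex_line0 /herm_form => /matrixP/(_ 0 0) <-.
rewrite [X in X <= _](ddbarR_diag oW 0 sfl W0) (lecR _ 0).
rewrite pmulr_rle0 ?mulr_gt0 ?invr_gt0// -[leRHS]addr0.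
by apply: lerD; exact: (second_derivative_max _ oW sfl W0 flmax).
Qed.

End MaximumPrinciple.

Section Compactness.
Variables (R : realType) (d : nat) (D : complexManifold R d) (E : lineBundle D).
Hypothesis D_compact : compact [set: D].
Implicit Types g : E -> R.

Definition unit_circle : set (R * R) := [set z | z.1 * z.1 + z.2 * z.2 = 1].

Lemma compact_unit_circle : compact unit_circle.
Proof.
apply: (@subclosed_compact _ _ (`[(-1 : R), 1] `*` `[(-1 : R), 1])).
- apply: (@closed_comp _ _ (fun z : R * R => z.1 * z.1 + z.2 * z.2) [set 1]).
    by move=> z _; apply: cvgD; apply: cvgM; (exact: cvg_fst || exact: cvg_snd).
  exact: closed_eq.
- by apply: compact_setX; exact: segment_compact.
- have abs_le1 (x y : R) : x * x + y * y = 1 -> - 1 <= x <= 1.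
    move=> xy1; rewrite -ler_norml -(@ler_pXn2r _ 2)// ?nnegrE// expr1n.
    by rewrite real_normK ?num_real// -xy1 expr2 lerDl -expr2 sqr_ge0.
  move=> z z1; split; rewrite /= in_itv /=; first exact: abs_le1 z1.
  by apply: (@abs_le1 _ z.1); rewrite addrC.
Qed.

Lemma wz_point_continuous :
  continuous (fun q : Cn R d * (R * R) => wz_point q.1 (q.2.1 +i* q.2.2)).
Proof.
have coordE i : exists2 c : Cn R d * (R * R) -> R, continuous c &
    (fun q => real_coord (wz_point q.1 (q.2.1 +i* q.2.2)) i) = c.
  case: i => k; case: (split_ordP k) => l ->.
  - exists ((@real_coord R d)^~ (inl l) \o fst); last first.
      by apply/funext => q; rewrite /= row_mxEl.
    by move=> q; apply: continuous_comp; [exact: cvg_fst|exact: real_coord_continuous].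
  - exists (fst \o snd); last first.
      by apply/funext => q; rewrite /= row_mxEr mxE (ord1 l) eqxx mulr1n.
    by move=> q; apply: continuous_comp; [exact: cvg_snd|exact: cvg_fst].
  - exists ((@real_coord R d)^~ (inr l) \o fst); last first.
      by apply/funext => q; rewrite /= row_mxEl.
    by move=> q; apply: continuous_comp; [exact: cvg_fst|exact: real_coord_continuous].
  - exists (snd \o snd); last first.
      by apply/funext => q; rewrite /= row_mxEr mxE (ord1 l) eqxx mulr1n.
    by move=> q; apply: continuous_comp; [exact: cvg_snd|exact: cvg_snd].
move=> q; apply: cvg_real_coord => i; have [c cc cE] := coordE i.
by move: (cc q); rewrite -cE.
Qed.

Lemma exists_unit_dilation (p : Cn R (d + 1)) : zpart p != 0 ->
  exists2 t : R, 0 < t & fiber_sqnorm (dilation t p) = 1.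
Proof.
move=> /fiber_sqnorm_gt0 s0; exists (Num.sqrt (fiber_sqnorm p))^-1.
  by rewrite invr_gt0 sqrtr_gt0.
by rewrite fiber_sqnorm_dilation exprVn sqr_sqrtr ?ltW// mulVf// gt_eqF.
Qed.

Definition continuous_off_zero g := forall i j p, total_dom i j p ->
  {for p, continuous (fun q => g (total_inv i j q))}.

Lemma bounded_on_circles g i j (w0 : Cn R d) :
  continuous_off_zero g -> base_dom i j w0 ->
  \forall w \near w0 & M \near +oo, forall z, unit_circle z ->
    g (total_inv i j (wz_point w (z.1 +i* z.2))) <= M.
Proof.
move=> gc bw0; have /compact_near_coveringP covering := compact_unit_circle.
apply: (covering _ (filter_prod (nbhs w0) +oo)
  (fun wM z => g (total_inv i j (wz_point wM.1 (z.1 +i* z.2))) <= wM.2)) => z z1.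
pose p0 := wz_point w0 (z.1 +i* z.2).
have Up0 : total_dom i j p0.
  split; rewrite ?wpart_wz// zpart_wz; apply: contraPneq z1 => -[z10 z20].
  by rewrite /unit_circle /= z10 z20 mulr0 addr0 => /esym/eqP; rewrite oner_eq0.
have g_near : \forall q \near p0, g (total_inv i j q) <= g (total_inv i j p0) + 1.
  by apply: (cvgr_le _ (gc i j p0 Up0)); rewrite ltrDl.
have [[A B] /= [nA nB] AB] := @wz_point_continuous (w0, z) _ g_near.
exists (B, A `*` [set M | g (total_inv i j p0) + 1 <= M]) => /=.
  split=> //; exists (A, [set M | g (total_inv i j p0) + 1 <= M]) => //=.
  by split=> //; apply: nbhs_pinfty_ge; exact: num_real.
move=> [z' [w M]] /= [Bz' [Aw]]; apply: le_trans.
exact: (AB (w, z')).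
Qed.

Lemma scale_invariant_bounded_near g (x : D) :
  continuous_off_zero g -> homogeneous_off_zero 0 g ->
  \forall y \near x & M \near +oo, forall e, lb_proj e = y -> off_zero e -> g e <= M.
Proof.
move=> gc gh; have [i xi] := cm_cover x; have [j xj] := lb_cover E x.
have bx : base_dom i j (cm_chart i x) by exists x.
have [[A C] /= [nA nC] AC] := bounded_on_circles gc bx.
exists (cm_dom i `&` lb_dom j `&` cm_chart i @^-1` A, C) => /=.
  split=> //; apply: filterI; last exact: cm_chart_cont.
  by apply: filterI; apply: open_nbhs_nbhs; split=> //;
    [exact: cm_dom_open|exact: lb_dom_open].
move=> [y M] /= [[[yi yj] Ay] CM] e ey e0.
have Up : total_dom i j (total_chart i j e) by apply: total_chart_dom; rewrite ?ey.
have [t t0] := exists_unit_dilation Up.2; set q := dilation t _ => q1.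
have -> : g e = g (total_inv i j q).
  by rewrite (gh i j t _ t0 Up) expr0z mul1r total_chartK ?ey.
have qE : q = wz_point (cm_chart i y) (complex.Re (zpart q) +i* complex.Im (zpart q)).
  rewrite -[LHS]wz_pointK wpart_dilation /total_chart wpart_wz ey.
  by case: (zpart q).
rewrite qE; apply: (AC (cm_chart i y, M) (conj Ay CM)
  (complex.Re (zpart q), complex.Im (zpart q))).
move: q1; rewrite /fiber_sqnorm /unit_circle /=.
by case: (zpart q) => a b /=; rewrite mulrN opprK.
Qed.

Lemma scale_invariant_bounded g : continuous_off_zero g -> homogeneous_off_zero 0 g ->
  exists M : R, forall e, off_zero e -> g e <= M.
Proof.
move=> gc gh; have /compact_near_coveringP covering := D_compact.
have /filter_ex[M gM] : \forall M \near +oo, [set: D] `<=`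
    [set x | forall e, lb_proj e = x -> off_zero e -> g e <= M].
  by apply: covering => x _; exact: scale_invariant_bounded_near.
by exists M => e; exact: (gM (lb_proj e) I e erefl).
Qed.

Lemma scale_invariant_max g (e1 : E) : off_zero e1 ->
  continuous_off_zero g -> homogeneous_off_zero 0 g ->
  exists2 e0, off_zero e0 & forall e, off_zero e -> g e <= g e0.
Proof.
move=> e10 gc gh; have [M gM] := scale_invariant_bounded gc gh.
pose S := [set g e | e in @off_zero _ _ _ E].
have hS : has_sup S.
  by split; [exists (g e1); exists e1|exists M => _ [e e0 <-]; exact: gM].
have gS e : off_zero e -> g e <= sup S.
  by move=> e0; apply: sup_upper_bound => //; exists e.
have [[e0 e00 ge0]|not_attained] := pselect (exists2 e0, off_zero e0 & g e0 = sup S).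
  by exists e0 => // e e_off; rewrite ge0; exact: gS.
have gap e : off_zero e -> 0 < sup S - g e.
  move=> e0; rewrite subr_gt0 lt_neqAle gS// andbT; apply/eqP => ge.
  by apply: not_attained; exists e.
(* If the supremum is not attained, 1 / (sup S - g) is unbounded. *)
have [|i j t p t0 Up|N gN] := @scale_invariant_bounded (fun e => (sup S - g e)^-1).
- move=> i j p Up; apply: (@continuousV _ _ (fun q => sup S - g (total_inv i j q))).
    by rewrite gt_eqF// gap//; exact: total_inv_off_zero.
  by apply: continuousB; [exact: cst_continuous|exact: gc].
- by rewrite (gh i j t p t0 Up) !expr0z !mul1r.
have N0 : 0 < N by apply: lt_le_trans (gN e1 e10); rewrite invr_gt0 gap.
have invN0 : 0 < N^-1 by rewrite invr_gt0.
have [_ [e e0 <-]] := sup_adherent invN0 hS.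
rewrite ltrBlDr -ltrBlDl => close.
have := gN e e0; rewrite leNgt => /negP[].
by rewrite -[ltLHS]invrK ltf_pV2 ?posrE ?invr_gt0// gap.
Qed.

End Compactness.

(** * Uniqueness *)

Lemma open_smooth_gt0 (R : realType) (V : normedModType R) (U : set V) (f : V -> R) :
  open U -> smooth U f -> open [set x | U x /\ 0 < f x].
Proof.
move=> oU sf; rewrite openE => x [Ux fx]; apply: filterI.
  by apply: open_nbhs_nbhs; split.
exact: (cvgr_gt _ (smooth_continuous sf Ux)).
Qed.

Lemma exists_horizontal_lift (K : fieldType) d (w : 'rV[K]_d) (L : 'cV[K]_(d + 1)) :
  L (rshift d ord0) 0 != 0 ->
  exists2 v : 'rV[K]_(d + 1), lsubmx v = w & (v *m L) 0 0 = 0.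
Proof.
move=> L0; pose c := - ((w *m usubmx L) 0 0 / L (rshift d ord0) 0).
exists (row_mx w c%:M); first by rewrite row_mxKl.
rewrite -[L in _ *m L]vsubmxK mul_row_col mul_scalar_mx !mxE /c.
by rewrite mulNr divfK// mxE subrr.
Qed.

Section Vanishing.
Variables (R : realType) (d : nat) (D : complexManifold R d) (E : lineBundle D).
Variable h : hermitianMetric E.
Hypotheses (d_gt0 : (0 < d)%N) (D_compact : compact [set: D]).
Hypothesis h_kahler : kahler_curvature h.

Section LogBarrier.
Variables (i : cm_idx D) (j : lb_idx E) (U : set (Cn R (d + 1))) (k : R).
Variable F : Cn R (d + 1) -> R.
Hypotheses (oU : open U) (UE : U `<=` total_dom i j).
Hypotheses (F0 : forall q, U q -> 0 < F q) (sF : smooth U F).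

(* The logarithm of F^2 |S|^(-2k). *)
Definition log_barrier q : R := 2 * ln (F q) + k * ln (potential h i j q).

Let smooth_ln_F : smooth U (fun q => ln (F q)). Proof. exact: smooth_ln. Qed.

Let smooth_ln_potential : smooth U (fun q => ln (potential h i j q)).
Proof.
apply: smooth_ln => // [q Uq|]; first exact: potential_gt0 (UE Uq).
exact: smooth_sub UE (smooth_potential h i j).
Qed.

Let smooth_double_ln_F : smooth U (fun q => 2 * ln (F q)).
Proof. exact: smoothM (smooth_cst U 2) smooth_ln_F. Qed.

Let smooth_scale_ln_potential : smooth U (fun q => k * ln (potential h i j q)).
Proof. exact: smoothM (smooth_cst U k) smooth_ln_potential. Qed.

Lemma smooth_log_barrier : smooth U log_barrier.
Proof. exact: smoothD. Qed.

(* Where the Hessian of F vanishes, that of log F is negative along dF only. *)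
Lemma herm_form_log_barrier p v : U p ->
  ddbarR F p = 0 -> (v *m del_gradient F p) 0 0 = 0 ->
  herm_form (ddbarR log_barrier p) v =
  k%:C * herm_form (curvature h i j (wpart p)) (lsubmx v).
Proof.
move=> Up hessF0 vF.
have -> : ddbarR log_barrier p = 2%:C *: ddbarR (fun q => ln (F q)) p +
    k%:C *: pullback (@wpart R d) (curvature h i j) p.
  apply: etrans (ddbarRD oU smooth_double_ln_F smooth_scale_ln_potential Up) _.
  apply: congr2 (ddbarRZ oU 2 smooth_ln_F Up) _.
  apply: etrans (ddbarRZ oU k smooth_ln_potential Up) _.
  by apply: congr1; exact: ddbarR_ln_potential (UE Up).
rewrite (ddbarR_ln oU F0 sF Up) hessF0 scaler0 sub0r -scaleNr scalerA.
rewrite herm_formD !herm_formZ herm_form_rank1 vF mul0r mulr0 add0r.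
by rewrite /pullback herm_form_congruence mul_jac_wpart.
Qed.

End LogBarrier.

Lemma pluriharmonic_no_positive_max i j (k : nat) (F : Cn R (d + 1) -> R) p :
  (0 < k)%N -> total_dom i j p -> smooth (total_dom i j) F ->
  homogeneous (total_dom i j) k F -> ddbarR F p = 0 -> 0 < F p ->
  ~ (forall q, total_dom i j q ->
       F q ^+ 2 * potential h i j q ^+ k <= F p ^+ 2 * potential h i j p ^+ k).
Proof.
move=> k0 tp sF hF hessF0 Fp Fmax; have oT := @total_dom_open _ _ _ E i j.
pose U := [set q | total_dom i j q /\ 0 < F q].
have oU : open U by exact: open_smooth_gt0.
have UE : U `<=` total_dom i j by move=> q [].
have F0 q : U q -> 0 < F q by case.
have Up : U p by [].
have barrierE q : U q ->
    log_barrier i j k%:R F q = ln (F q ^+ 2 * potential h i j q ^+ k).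
  move=> [tq Fq]; have pot0 := potential_gt0 h tq.
  by rewrite lnM ?posrE ?exprn_gt0// !lnXn// /log_barrier !mulr_natl.
have barrier_max q : U q -> log_barrier i j k%:R F q <= log_barrier i j k%:R F p.
  move=> Uq; rewrite !barrierE// ler_ln ?posrE ?mulr_gt0 ?exprn_gt0 ?F0//.
  - exact/Fmax/UE.
  - exact: potential_gt0 (UE q Uq).
  - exact: potential_gt0 tp.
have Fz : del_gradient F p (rshift d ord0) 0 != 0.
  rewrite mxE; apply: (homogeneous_del_fiber_neq0 oT sF hF tp); last by rewrite gt_eqF.
  by rewrite eqz_nat -lt0n.
pose w : 'rV[R[i]]_d := delta_mx 0 (Ordinal d_gt0).
have w0 : w != 0.
  apply/eqP => /rowP/(_ (Ordinal d_gt0)); rewrite !mxE !eqxx => /eqP.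
  by rewrite oner_eq0.
have [v vw vF] := exists_horizontal_lift w Fz.
have sF' := smooth_sub UE sF.
have := herm_form_ddbarR_max v oU (smooth_log_barrier k%:R oU UE F0 sF') Up barrier_max.
rewrite (herm_form_log_barrier _ oU UE F0 sF' Up hessF0 vF) vw; apply/negP.
by rewrite lt_geF// mulr_gt0 ?ltcR ?ltr0n// (curvature_posdef h_kahler tp.1).
Qed.

Lemma pluriharmonic_no_max i j (k : nat) (F : Cn R (d + 1) -> R) p :
  (0 < k)%N -> total_dom i j p -> smooth (total_dom i j) F ->
  homogeneous (total_dom i j) k F -> ddbarR F p = 0 -> F p != 0 ->
  ~ (forall q, total_dom i j q ->
       F q ^+ 2 * potential h i j q ^+ k <= F p ^+ 2 * potential h i j p ^+ k).
Proof.
move=> k0 tp sF hF hessF0; have oT := @total_dom_open _ _ _ E i j.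
rewrite neq_lt => /orP[Fneg|Fpos]; last exact: pluriharmonic_no_positive_max.
move=> Fmax; have F'0 : 0 < - F p by rewrite oppr_gt0.
apply: (pluriharmonic_no_positive_max k0 tp (smoothN oT sF) _ _ F'0).
- by move=> t q t0 tq; rewrite hF// mulrN.
- by rewrite (ddbarRN oT sF tp) hessF0 oppr0.
- by move=> q tq; rewrite !sqrrN; exact: Fmax.
Qed.

Lemma pluriharmonic_homogeneous_eq0 (k : nat) (f : E -> R) : (0 < k)%N ->
  smooth_off_zero f -> homogeneous_off_zero k f ->
  (forall i j p, total_dom i j p -> ddbarR (fun q => f (total_inv i j q)) p = 0) ->
  forall e, off_zero e -> f e = 0.
Proof.
move=> k0 sf hf hess0 e1 e10; apply/eqP/negPn/negP => f1.
pose g e : R := f e ^+ 2 * (h e)^-1 ^+ k.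
have gE i j q : g (total_inv i j q) =
  f (total_inv i j q) ^+ 2 * potential h i j q ^+ k by [].
have gc : continuous_off_zero g.
  move=> i j p tp; have oT := @total_dom_open _ _ _ E i j.
  apply: smooth_continuous tp; apply: smoothM => //; apply: smoothX => //.
  exact: smooth_potential.
have gh : homogeneous_off_zero 0 g.
  move=> i j t q t0 tq; rewrite !gE (hf i j t q t0 tq).
  rewrite (potential_homogeneous h t0 tq) expr0z mul1r !exprMn mulrACA.
  by rewrite -!exprnP -exprM exprVn -exprM mulnC mulfV ?mul1r// expf_neq0// gt_eqF.
have [e0 e00 gmax] := scale_invariant_max D_compact e10 gc gh.
have [i [j [tp pE]]] := total_chart_cover e00; set p := total_chart i j e0 in tp pE.
have f0 : f e0 != 0.
  apply: contraTneq (gmax e1 e10) => f0; rewrite /g f0 expr0n mul0r -ltNge.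
  have [i1 [j1 [t1 e1E]]] := total_chart_cover e10.
  apply: mulr_gt0; first by rewrite exprn_even_gt0// f1.
  by apply: exprn_gt0; rewrite -e1E; exact: (potential_gt0 h t1).
apply: (pluriharmonic_no_max k0 tp (sf i j) (hf i j) (hess0 i j p tp)); rewrite pE//.
move=> q tq; have := gmax _ (total_inv_off_zero tq).
by rewrite gE -[in X in _ <= X -> _]pE gE pE.
Qed.

End Vanishing.

Section Uniqueness.
Variables (R : realType) (d : nat) (D : complexManifold R d) (E : lineBundle D).
Variable h : hermitianMetric E.
Hypotheses (d_gt0 : (0 < d)%N) (D_compact : compact [set: D]).
Hypothesis h_kahler : kahler_curvature h.
Implicit Types u v : nat -> E -> R.

Lemma soliton_expansion_smooth v k : soliton_expansion h v -> (0 < k)%N ->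
  smooth_off_zero (v k).
Proof. by move=> [sv _ _]; exact: sv. Qed.

Lemma soliton_expansion_homogeneous v k : soliton_expansion h v -> (0 < k)%N ->
  homogeneous_off_zero k (v k).
Proof. by move=> [sv wv _] k0; exact/(has_weightP k (sv k k0))/wv. Qed.

Lemma soliton_expansion_ddbar v k i j p :
  soliton_expansion h v -> (0 < k)%N -> total_dom i j p ->
  ddbar (trlog_chart h v k i j) p =
  (1 + k%:R / 2) *: ddbarR (in_chart v i j k) p.
Proof.
move=> sol k0 tp; have [_ _ eqv] := sol.
exact: ((formal_solitonP (@total_dom_open _ _ _ E i j)
  (@total_dom_dilation _ _ _ E i j) (potential_metric i j h_kahler)
  (potential_homogeneous h (i := i) (j := j))
  (fun l l0 => soliton_expansion_smooth sol l0 i j)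
  (fun l l0 => @soliton_expansion_homogeneous v l sol l0 i j) tp).1 (eqv i j p tp) k k0).
Qed.

Lemma eq_soliton_expansion_ddbar u v k i j p :
  soliton_expansion h u -> soliton_expansion h v -> (0 < k)%N -> total_dom i j p ->
  (forall l e, (0 < l)%N -> (l < k)%N -> off_zero e -> u l e = v l e) ->
  ddbarR (in_chart u i j k) p = ddbarR (in_chart v i j k) p.
Proof.
move=> solu solv k0 tp uv; have oT := @total_dom_open _ _ _ E i j.
have trlogE q : total_dom i j q -> trlog_chart h u k i j q = trlog_chart h v k i j q.
  move=> tq; apply: eq_trlog_pert => l l0 lk.
  apply: (eq_ddbarR oT tq) => r tr; apply: uv => //; last exact: total_inv_off_zero.
  by apply: leq_trans lk; rewrite addn2.
have k2 : (1 + k%:R / 2 : R[i]) != 0.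
  by rewrite gt_eqF// ltr_pwDl// divr_ge0.
apply: (scalerI k2); apply: etrans (esym (soliton_expansion_ddbar solu k0 tp)) _.
apply: etrans (eq_ddbar oT tp trlogE) _.
exact: soliton_expansion_ddbar solv k0 tp.
Qed.

Lemma soliton_expansion_unique u v k e :
  soliton_expansion h u -> soliton_expansion h v -> (0 < k)%N -> off_zero e ->
  v k e = u k e.
Proof.
move=> solu solv; elim/ltn_ind: k e => k IH e k0 e0.
have su := soliton_expansion_smooth solu k0.
have sv := soliton_expansion_smooth solv k0.
apply/eqP; rewrite -subr_eq0; apply/eqP.
apply: (pluriharmonic_homogeneous_eq0 d_gt0 D_compact h_kahler k0
  (f := fun e => v k e - u k e)) => // [i j|i j t q t0 tq|i j p tp].
- by apply: smoothB; [exact: total_dom_open|exact: sv|exact: su].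
- rewrite (soliton_expansion_homogeneous solv k0 t0 tq).
  by rewrite (soliton_expansion_homogeneous solu k0 t0 tq) mulrBr.
have oT := @total_dom_open _ _ _ E i j.
apply: etrans (ddbarRD oT (sv i j) (smoothN oT (su i j)) tp) _.
apply/eqP; rewrite (ddbarRN oT (su i j) tp) subr_eq0; apply/eqP.
by apply: eq_soliton_expansion_ddbar => // l e' l0 lk; exact: IH.
Qed.

End Uniqueness.

Theorem proposition5p40 (R : realType) (d : nat) (d_gt0 : (0 < d)%N)
    (D : complexManifold R d) (D_compact : compact [set: D])
    (E : lineBundle D) (E_ample : ample E)
    (h : hermitianMetric E) (h_kahler : kahler_curvature h) :
  exists u : nat -> E -> R,
    soliton_expansion h u /\
    forall v : nat -> E -> R, soliton_expansion h v ->
      forall k e, (0 < k)%N -> off_zero e -> v k e = u k e.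
Proof.
have soliton_u := expansion_soliton h_kahler.
exists (expansion h); split=> // v soliton_v k e k0 e0.
exact: (soliton_expansion_unique d_gt0 D_compact h_kahler soliton_u soliton_v k0 e0).
Qed.
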